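(* Let $q>0$, $q\ne1$. Suppose that $\frac{c_1}{1-c_0}>0$, $\frac{c_0-q}{1-c_0}>0$, $\frac{c_2-q}{1-c_2}>0$ and $c_3>0$. Consider, for $0<x<1$, $t>0$, the coupled system $$\widetilde z_{tt}(x,t)=\widetilde z_{xx}(x,t),\quad \widetilde z_x(0,t)=\tfrac{c_1}{1-c_0}\widetilde z(0,t)+\tfrac{c_0-q}{1-c_0}\widetilde z_t(0,t),\quad \widetilde z(1,t)=0,$$ $$\varepsilon_{tt}(x,t)=\varepsilon_{xx}(x,t),\quad \varepsilon_x(0,t)=-q\varepsilon_t(0,t)+c_1\varepsilon(0,t),\quad \varepsilon_x(1,t)=-\widetilde z_x(1,t)-Y_x(1,t),$$ $$Y_t(x,t)=-Y_x(x,t),\quad Y(0,t)=-c_0\varepsilon(0,t),$$ $$\widetilde w_{tt}(x,t)=\widetilde w_{xx}(x,t),\quad \widetilde w_x(0,t)=\tfrac{c_2-q}{1-c_2}\widetilde w_t(0,t)+c_1\varepsilon(0,t),\quad \widetilde w_x(1,t)=-c_3\widetilde w(1,t),$$ $$Z_t(x,t)=-Z_x(x,t),\quad Z(0,t)=-\tfrac{c_2}{1-c_2}\widetilde w(0,t).$$ For any initial value $(\varepsilon_0,\varepsilon_1,Y_0,\widetilde z_0,\widetilde z_1,\widetilde w_0,\widetilde w_1,Z_0)\in\mathscr{X}$ of $(\varepsilon,\varepsilon_t,Y,\widetilde z,\widetilde z_t,\widetilde w,\widetilde w_t,Z)$ at $t=0$ with the compatibility conditions $Y_0(0)=-c_0\varepsilon_0(0)$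 and $Z_0(0)=-\frac{c_2}{1-c_2}\widetilde w_0(0)$, there exists a unique solution $(\varepsilon,\varepsilon_t,Y,\widetilde z,\widetilde z_t,\widetilde w,\widetilde w_t,Z)\in C(0,\infty;\mathscr{X})$ to this system, and $$\|(\varepsilon,\varepsilon_t,Y,\widetilde z,\widetilde z_t,\widetilde w,\widetilde w_t,Z)(\cdot,t)\|_{\mathscr{X}}\le Me^{-\mu t},\quad t\ge0,$$ with some $M,\mu>0$.
   Context: $\mathbb{H}=H^1(0,1)\times L^2(0,1)$ with the usual inner product, $H^1_R(0,1)=\{\phi\in H^1(0,1):\phi(1)=0\}$, and $\mathscr{X}=\mathbb{H}\times H^1(0,1)\times H^1_R(0,1)\times L^2(0,1)\times\mathbb{H}\times H^1(0,1)$. The $c_i$ are real constants. $C(0,\infty;X)$ denotes the continuous functions $[0,\infty)\to X$; solutions with this regularity are understood in the usual generalized (mild/weak) sense. *)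

(* Defs.v *)
From mathcomp Require Import all_boot all_order all_algebra.
From mathcomp Require Import all_classical all_reals all_analysis.

Set Implicit Arguments.
Unset Strict Implicit.
Unset Printing Implicit Defensive.

Import Order.TTheory GRing.Theory Num.Theory.
Import numFieldNormedType.Exports.

Local Open Scope classical_set_scope.
Local Open Scope ring_scope.

Section Spaces.
Context {R : realType}.

Notation mu := (@lebesgue_measure R).

(* Elements of L^2(0,1) and H^1(0,1) are represented by functions on the whole
   line, of which only the restriction to [0,1] matters.  The codomain is R^o
   (R as a module over itself) so that functions, and tuples of functions,
   inherit the library's vector space structure. *)
Definition fct := R -> R^o.

Definition L2 (f : fct) : Prop :=
  measurable_fun (`[0, 1] : set R) (f : R -> R) /\
  mu.-integrable `[0, 1] (fun x => (f x ^+ 2)%:E).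

(* Real-valued integral: only meaningful when L2 f. *)
Definition L2normsq (f : fct) : R := \int[mu]_(x in `[0, 1]) (f x ^+ 2).

(* f is the (absolutely) continuous representative on [0,1] of an element of
   H^1(0,1) and g represents its derivative, an element of L^2(0,1).  Since f
   is the continuous representative, the boundary values f 0 and f 1 are the
   traces. *)
Definition H1_deriv (f g : fct) : Prop :=
  L2 g /\ forall x : R, 0 <= x <= 1 -> f x = f 0 + \int[mu]_(y in `[0, x]) g y.

Definition H1 (f : fct) : Prop := exists g : fct, H1_deriv f g.

Definition H1R (f : fct) : Prop := H1 f /\ f 1 = 0.

(* A chosen derivative; it is determined almost everywhere on [0,1]. *)
Definition deriv_of (f : fct) : fct := xget (0 : fct) [set g | H1_deriv f g].

Definition H1normsq (f : fct) : R := L2normsq f + L2normsq (deriv_of f).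

(* Tuples (eps, eps_t, Y, z, z_t, w, w_t, Z). *)
Definition state : Type :=
  (fct * fct * fct * fct * fct * fct * fct * fct)%type.

Definition inX (u : state) : Prop :=
  let: (eps, eps', Y, z, z', w, w', Z) := u in
  [/\ H1 eps /\ L2 eps', H1 Y, H1R z /\ L2 z', H1 w /\ L2 w' & H1 Z].

Definition normX (u : state) : R :=
  let: (eps, eps', Y, z, z', w, w', Z) := u in
  Num.sqrt (H1normsq eps + L2normsq eps' + H1normsq Y + H1normsq z
            + L2normsq z' + H1normsq w + L2normsq w' + H1normsq Z).

Definition eqH1 (f g : fct) : Prop := forall x : R, 0 <= x <= 1 -> f x = g x.

Definition eqL2 (f g : fct) : Prop :=
  {ae mu, forall x : R, 0 <= x <= 1 -> f x = g x}.

(* Equality of the elements of the state space represented by u and v. *)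
Definition eqX (u v : state) : Prop :=
  let: (eps, eps', Y, z, z', w, w', Z) := u in
  let: (feps, feps', fY, fz, fz', fw, fw', fZ) := v in
  [/\ eqH1 eps feps /\ eqL2 eps' feps', eqH1 Y fY, eqH1 z fz /\ eqL2 z' fz',
      eqH1 w fw /\ eqL2 w' fw' & eqH1 Z fZ].

Definition continuous_path (U : R -> state) : Prop :=
  (forall t, 0 <= t -> inX (U t)) /\
  forall t0, 0 <= t0 ->
    normX (U t - U t0) @[t --> within `[0, +oo[ (nbhs t0)] --> (0 : R).

(* For a continuous path U, this characterizes V as the (Bochner, or vector
   valued Riemann) integral of U over [0,t]: the Riemann sums over uniform
   subdivisions converge to it in norm. *)
Definition is_integral (U : R -> state) (t : R) (V : state) : Prop :=
  inX V /\
  normX (\sum_(k < n) (t / n%:R) *: U (k%:R * t / n%:R) - V) @[n --> \oo]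
    --> (0 : R).

(* The operator A of the system written as the first-order equation U' = A U:
   [genA q c0 c1 c2 c3 V W] says that V is in the domain of A and W = A V.
   The domain consists of those V for which A V is in the state space
   and the boundary conditions hold, eps', z', w' standing for the time
   derivatives of eps, z, w.  The functions fx and fxx are the first and second
   space derivatives of f; each first derivative has a derivative in turn, so
   its boundary values are well defined. *)
Definition genA (q c0 c1 c2 c3 : R) (V W : state) : Prop :=
  let: (eps, eps', Y, z, z', w, w', Z) := V in
  exists epsx epsxx Yx zx zxx wx wxx Zx : fct,
    let AV : state := (eps', epsxx, - Yx, z', zxx, w', wxx, - Zx) in
    [/\ [/\ H1_deriv eps epsx, H1_deriv z zx, H1_deriv w wx,
            H1_deriv Y Yx & H1_deriv Z Zx],
        [/\ H1_deriv epsx epsxx, H1_deriv zx zxx & H1_deriv wx wxx],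
        [/\ zx 0 = c1 / (1 - c0) * z 0 + (c0 - q) / (1 - c0) * z' 0
            /\ z 1 = 0,
            epsx 0 = - q * eps' 0 + c1 * eps 0 /\ epsx 1 = - zx 1 - Yx 1,
            Y 0 = - c0 * eps 0,
            wx 0 = (c2 - q) / (1 - c2) * w' 0 + c1 * eps 0
            /\ wx 1 = - c3 * w 1 &
            Z 0 = - (c2 / (1 - c2)) * w 0],
        inX V /\ inX AV &
        eqX W AV].

(* Mild solution of U' = A U, U(0) = U0, with U in C(0,oo;X): for all t >= 0,
   the integral of U over [0,t] is in the domain of A and
   U(t) = U(0) + A (integral of U over [0,t]). *)
Definition mild_solution (q c0 c1 c2 c3 : R) (U0 : state) (U : R -> state) :
    Prop :=
  [/\ continuous_path U,
      eqX (U 0) U0 &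
      forall t, 0 <= t ->
        exists V, is_integral U t V /\ genA q c0 c1 c2 c3 V (U t - U 0)].

End Spaces.

Arguments fct : clear implicits.
Arguments state : clear implicits.

(* Main.v *)
(* With v = eps + Y + z the system becomes a cascade.  Both v and z solve the
   wave equation with v_x(0) = a v(0) + b v_t(0), where a = c1 / (1 - c0) and
   b = (c0 - q) / (1 - c0), and with v_x(1) = 0, z(1) = 0.  The trace
   eps(0) = (v - z)(0) / (1 - c0) drives the transport equation for Y and the
   damped wave w, and w(0) drives the transport equation for Z.

   Decay and uniqueness.  Some symmetric form B, equivalent to the squared norm,
   satisfies B(V, A V) <= - m B(V, V) for all V in the domain of A such that A V
   satisfies the compatibility conditions.  If U is a mild solution with integral
   V, then P(t) = V(t + h) - V(t) is a classical solution, so it decays like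
   exp(- m t); dividing by h and letting h tend to 0 gives the decay of U.
   Uniqueness follows by applying this to a difference of mild solutions.

   Existence.  Each wave is p(t - x) + r(t + x); the boundary conditions say that
   the profiles f = p' and g = r' are related by reflections at the two ends, each
   of which amounts to a scalar linear ODE.  The reflection at x = 1 looks back by
   a time 2, so the profiles are obtained by iteration.  The continuity of
   translations in L^2 makes these formulas mild solutions. *)

Require Import Defs.
From HB Require Import structures.
From mathcomp Require Import all_boot all_order all_algebra.
From mathcomp Require Import all_classical all_reals all_analysis.
From mathcomp Require Import measurable_realfun ring lra.

Set Implicit Arguments.
Unset Strict Implicit.
Unset Printing Implicit Defensive.

Import Order.TTheory GRing.Theory Num.Theory.
Import numFieldNormedType.Exports.

Local Open Scope classical_set_scope.
Local Open Scope ring_scope.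

(** * Integrals over intervals *)

Section L2on.
Context {R : realType}.
Notation mu := (@lebesgue_measure R).
Implicit Types (a b c x y : R) (f g h : R -> R).

(** Why compatibility of A V matters: the norm contains [Y_x] and [Z_x], whose energies are fed by
    the inflow values [Y_x(0)] and [Z_x(0)], which membership in the domain leaves free.
    Compatibility of A V rewrites them as [c0 eps_t(0)] and [c2 / (1 - c2) w_t(0)]. Velocity traces
    are not bounded by the norm either; only the boundary damping of v, z and w can absorb them, so
    the weights in B are fixed from the end of the cascade backwards.

    For each wave the energy is dissipated only at the boundary. The multiplier [1 - x] gives
    interior decay but no control of the position trace at 0. That comes from the product of this
    trace with a functional such as the integral of v_t plus b v(0), whose time derivative is
    [- a v(0)].

    Derivatives are chosen representatives, determined almost everywhere. Hence the forms are
    semi-inner products on a linear subspace of functions, and identities between chosen derivatives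
    are used only under integrals. *)

Definition L1on a b f := mu.-integrable `[a, b] (EFin \o f).

Definition L2on a b f :=
  measurable_fun (`[a, b] : set R) f /\ L1on a b (fun x => f x ^+ 2).

Definition intg a b f : R := \int[mu]_(x in `[a, b]) f x.

Lemma itv_subset a b c d : c <= a -> b <= d ->
  (`[a, b] : set R) `<=` `[c, d].
Proof. by move=> ca bd; apply: subset_itv; rewrite bnd_simp. Qed.

Lemma L1on_sub a b c d f : L1on c d f -> c <= a -> b <= d -> L1on a b f.
Proof.
move=> lf ca bd; apply: (integrableS _ _ _ lf) => //; exact: itv_subset.
Qed.

Lemma L1onD a b f g : L1on a b f -> L1on a b g -> L1on a b (fun x => f x + g x).
Proof. by move=> lf lg; apply: (integrableD _ lf lg). Qed.

Lemma L1onZ a b k f : L1on a b f -> L1on a b (fun x => k * f x).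
Proof. by move=> lf; apply: (integrableZl _ k lf). Qed.

Lemma L1onB a b f g : L1on a b f -> L1on a b g -> L1on a b (fun x => f x - g x).
Proof. by move=> lf lg; apply: (integrableB _ lf lg). Qed.

Lemma eq_L1on a b f g : (forall x, a <= x <= b -> f x = g x) ->
  L1on a b f -> L1on a b g.
Proof.
move=> fg; apply: eq_integrable => // x; rewrite inE/= in_itv/= => xab.
by rewrite fg.
Qed.

Lemma L1on_meas a b f : L1on a b f -> measurable_fun `[a, b] f.
Proof. by move=> /measurable_int /measurable_EFinP. Qed.

Lemma le_L1on a b f g : measurable_fun (`[a, b] : set R) f ->
  (forall x, a <= x <= b -> `|f x| <= g x) -> L1on a b g -> L1on a b f.
Proof.
move=> mf fg lg; apply: (le_integrable _ _ _ lg) => //.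
  exact/measurable_EFinP.
move=> x /=; rewrite in_itv/= => xab; rewrite lee_fin.
by rewrite (le_trans (fg _ xab))// ler_norm.
Qed.

Lemma L1on_norm a b f : L1on a b f -> L1on a b (fun x => `|f x|).
Proof. by move=> lf; apply: (integrable_norm lf). Qed.

Lemma L1on_cont a b f : {within `[a, b], continuous f} -> L1on a b f.
Proof. by move=> cf; apply: continuous_compact_integrable => //; exact: segment_compact. Qed.

Lemma L1on_cst a b k : L1on a b (fun _ => k).
Proof. by apply: L1on_cont => x; exact: cvg_cst. Qed.

Lemma eq_int a b f g : (forall x, a <= x <= b -> f x = g x) ->
  intg a b f = intg a b g.
Proof.
by move=> fg; apply: eq_Rintegral => x; rewrite inE/= in_itv/= => /fg.
Qed.

Lemma intD a b f g : L1on a b f -> L1on a b g ->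
  intg a b (fun x => f x + g x) = intg a b f + intg a b g.
Proof. by move=> lf lg; exact: RintegralD. Qed.

Lemma intB a b f g : L1on a b f -> L1on a b g ->
  intg a b (fun x => f x - g x) = intg a b f - intg a b g.
Proof. by move=> lf lg; exact: RintegralB. Qed.

Lemma intZ a b k f : L1on a b f -> intg a b (fun x => k * f x) = k * intg a b f.
Proof. by move=> lf; exact: RintegralZl. Qed.

Lemma intN a b f : L1on a b f -> intg a b (fun x => - f x) = - intg a b f.
Proof.
move=> lf; rewrite -mulN1r -intZ//; by apply: eq_int => x _; rewrite mulN1r.
Qed.

Lemma int_cst a b k : a <= b -> intg a b (fun _ => k) = k * (b - a).
Proof.
move=> ab; rewrite /intg Rintegral_cst//=; congr (_ * _).
rewrite lebesgue_measure_itv/= lte_fin.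
by move: ab; rewrite le_eqVlt => /predU1P[->|->//]; rewrite ltxx/= subrr.
Qed.

Lemma int_pt a f : intg a a f = 0.
Proof. by rewrite /intg set_itv1 Rintegral_set1. Qed.

Lemma int_rev a b f : b < a -> intg a b f = 0.
Proof. by move=> ba; rewrite /intg set_itv_ge ?bnd_simp -?ltNge// Rintegral_set0. Qed.

Lemma le_int a b f g : L1on a b f -> L1on a b g ->
  (forall x, a <= x <= b -> f x <= g x) -> intg a b f <= intg a b g.
Proof.
move=> lf lg fg; apply: le_Rintegral => // x /=; rewrite in_itv/=; exact: fg.
Qed.

Lemma int_ge0 a b f : (forall x, a <= x <= b -> 0 <= f x) -> 0 <= intg a b f.
Proof.
by move=> f0; apply: Rintegral_ge0 => x /=; rewrite in_itv/=; exact: f0.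
Qed.

Lemma norm_int a b f : L1on a b f -> `|intg a b f| <= intg a b (fun x => `|f x|).
Proof. by move=> lf; exact: le_normr_Rintegral. Qed.

Lemma int_cat a c b f : a <= c -> c <= b -> L1on a b f ->
  intg a b f = intg a c f + intg c b f.
Proof.
move=> ac cb lf; apply/eqP; rewrite addrC -subr_eq; apply/eqP.
rewrite /intg Rintegral_itvB ?bnd_simp//.
rewrite Rintegral_itv_obnd_cbnd//; apply: integrableS lf => //.
by apply: subset_itv; rewrite bnd_simp.
Qed.

Lemma L2on_L1 a b f : L2on a b f -> L1on a b f.
Proof.
move=> [mf lf]; apply: (@le_L1on _ _ _ (fun x => 1 + f x ^+ 2)) => //.
  by move=> x _; rewrite ler_norml; nra.
by apply: L1onD => //; exact: L1on_cst.
Qed.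

Lemma L2on_mul a b f g : L2on a b f -> L2on a b g -> L1on a b (fun x => f x * g x).
Proof.
move=> [mf lf] [mg lg].
apply: (@le_L1on _ _ _ (fun x => f x ^+ 2 + g x ^+ 2)) => //.
- exact: measurable_funM.
- by move=> x _; rewrite ler_norml; nra.
- exact: L1onD.
Qed.

Lemma L2on_meas a b f : L2on a b f -> measurable_fun `[a, b] f.
Proof. by case. Qed.

Lemma L2on_sqr a b f : L2on a b f -> L1on a b (fun x => f x ^+ 2).
Proof. by case. Qed.

Lemma le_L2on a b f g : measurable_fun (`[a, b] : set R) f ->
  (forall x, a <= x <= b -> `|f x| <= g x) -> L2on a b g -> L2on a b f.
Proof.
move=> mf fg [mg lg]; split => //; apply: le_L1on lg => //.
  exact: measurable_funX.
move=> x xab; rewrite normrX; apply: lerXn2r (fg _ xab); rewrite ?nnegrE//.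
exact: le_trans (fg _ xab).
Qed.

Lemma eq_L2on a b f g : (forall x, a <= x <= b -> f x = g x) ->
  L2on a b f -> L2on a b g.
Proof.
move=> fg [mf lf]; split.
  by apply: eq_measurable_fun mf => x; rewrite inE/= in_itv/=; exact: fg.
by apply: eq_L1on lf => x /fg ->.
Qed.

Lemma L2onD a b f g : L2on a b f -> L2on a b g -> L2on a b (fun x => f x + g x).
Proof.
move=> lf lg; split; first by apply: measurable_funD; apply: L2on_meas.
have l := L1onD (L1onD (L2on_sqr lf) (L2on_sqr lg)) (L1onZ 2 (L2on_mul lf lg)).
by apply: eq_L1on l => x _; ring.
Qed.

Lemma L2onZ a b k f : L2on a b f -> L2on a b (fun x => k * f x).
Proof.
move=> lf; split; first by apply: measurable_funM => //; exact: L2on_meas.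
by apply: eq_L1on (L1onZ (k ^+ 2) (L2on_sqr lf)) => x _; ring.
Qed.

Lemma L2onN a b f : L2on a b f -> L2on a b (fun x => - f x).
Proof. by move=> /(L2onZ (-1)); apply: eq_L2on => x _; rewrite mulN1r. Qed.

Lemma L2onB a b f g : L2on a b f -> L2on a b g -> L2on a b (fun x => f x - g x).
Proof. by move=> lf /L2onN; exact: L2onD. Qed.

Lemma L2on_sub a b c d f : L2on c d f -> c <= a -> b <= d -> L2on a b f.
Proof.
move=> [mf lf] ca bd; split; last exact: L1on_sub ca bd.
by apply: measurable_funS mf => //; exact: itv_subset.
Qed.

Lemma L2on_cont a b f : {within `[a, b], continuous f} -> L2on a b f.
Proof.
move=> cf; split; first exact: L1on_meas (L1on_cont cf).
by apply: L1on_cont => x; exact: (cvgM (cf x) (cf x)).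
Qed.

Lemma L2on_cst a b k : L2on a b (fun _ => k).
Proof. by apply: L2on_cont => x; exact: cvg_cst. Qed.

Lemma L2on_mulc a b f g : {within `[a, b], continuous f} -> L2on a b g ->
  L2on a b (fun x => f x * g x).
Proof.
move=> cf lg.
have [M [_ Mf]] := compact_bounded (continuous_compact cf (segment_compact (a := a) (b := b))).
apply: (@le_L2on _ _ _ (fun x => `|(`|M| + 1) * g x|)).
- by apply: measurable_funM; [exact: L2on_meas (L2on_cont cf)|exact: L2on_meas lg].
- move=> x xab; rewrite !normrM ler_wpM2r//.
  rewrite [leRHS]ger0_norm ?addr_ge0//; apply: Mf.
    by rewrite ltr_pwDr// ler_norm.
  by exists x => //=; rewrite in_itv.
- have [m l] := L2onZ (`|M| + 1) lg; split; first exact: measurableT_comp.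
  by apply: eq_L1on l => x _; rewrite real_normK ?num_real.
Qed.

Lemma int_sqr_ge0 a b f : 0 <= intg a b (fun x => f x ^+ 2).
Proof. by apply: int_ge0 => x _; exact: sqr_ge0. Qed.

(* The quadratic polynomial [s |-> intg (f + s g)^2] is nonnegative. *)
Lemma int_CS a b f g : L2on a b f -> L2on a b g ->
  intg a b (fun x => f x * g x) ^+ 2 <=
  intg a b (fun x => f x ^+ 2) * intg a b (fun x => g x ^+ 2).
Proof.
move=> lf lg.
have F := L2on_sqr lf; have G := L2on_sqr lg; have FG := L2on_mul lf lg.
have H s : 0 <= intg a b (fun x => f x ^+ 2) + s * (2 * intg a b (fun x => f x * g x))
             + s ^+ 2 * intg a b (fun x => g x ^+ 2).
  rewrite -intZ// -intZ ?L1onZ// -intZ// -intD ?L1onZ// -intD ?L1onZ ?L1onD ?L1onZ//.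
  by apply: int_ge0 => x _; have := sqr_ge0 (f x + s * g x); nra.
set A := intg _ _ _ in H *; set B := intg _ _ _ in H *; set C := intg _ _ _ in H *.
have C0 : 0 <= C by exact: int_sqr_ge0.
have [C1|C1] := eqVneq C 0.
  have [->|B0] := eqVneq B 0; first by rewrite C1 mulr0 expr0n.
  (* When [C = 0] the polynomial is affine, and at this point its value is -1. Otherwise its
     minimum, at [- B / C], gives the inequality. *)
  have := H (- (A + 1) / (2 * B)).
  rewrite C1 mulr0 addr0 divfK ?mulf_neq0 ?pnatr_eq0//; lra.
have Cp : 0 < C by rewrite lt_neqAle eq_sym C1.
have := H (- B / C).
have -> : A + - B / C * (2 * B) + (- B / C) ^+ 2 * C = (A * C - B ^+ 2) / C by field.
by rewrite pmulr_lge0 ?invr_gt0// subr_ge0.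
Qed.

End L2on.

(** * Absolutely continuous functions *)

Section prim.
Context {R : realType}.
Notation mu := (@lebesgue_measure R).
Implicit Types (a b c x y k : R) (f g h F G : R -> R).

Lemma norm_le_sqr x y : 0 <= y -> x ^+ 2 <= y ^+ 2 -> `|x| <= y.
Proof.
by move=> y0; rewrite -[x ^+ 2]real_normK ?num_real// ler_pXn2r ?nnegrE.
Qed.

Lemma le0_of_harmonic (e K : R) :
  (forall n : nat, e <= K / n.+1%:R) -> e <= 0.
Proof.
move=> H; rewrite leNgt; apply/negP => e0.
have K0 : 0 <= K by have := H 0; rewrite divr1; lra.
pose n := Num.trunc (K / e).
have := H n; rewrite ler_pdivlMr ?ltr0n// leNgt => /negP; apply.
by rewrite -ltr_pdivrMl// mulrC truncnS_gt.
Qed.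

(** Telescoping over [n.+1] equal pieces bounds the total increment by the mesh times [P b - P a],
    which tends to 0. This replaces an argument by derivatives, which exist only almost everywhere
    for the functions at hand. *)
Lemma flat_eq (D P : R -> R) a b : a <= b ->
  (forall x y, a <= x -> x <= y -> y <= b ->
     `|D y - D x| <= (y - x) * (P y - P x)) ->
  D b = D a.
Proof.
move=> ab H; apply/eqP; rewrite -subr_eq0 -normr_le0.
apply: (@le0_of_harmonic _ ((b - a) * (P b - P a))) => n.
pose s (i : nat) := a + (b - a) / n.+1%:R * i%:R.
have d0 : 0 <= (b - a) / n.+1%:R by rewrite divr_ge0 ?subr_ge0.
have s0 : s 0 = a by rewrite /s mulr0 addr0.
have sn : s n.+1 = b by rewrite /s divfK ?pnatr_eq0// addrC subrK.
have ss i : s i.+1 - s i = (b - a) / n.+1%:R by rewrite /s -natr1; ring.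
have ms i j : (i <= j)%N -> s i <= s j.
  by move=> ij; rewrite /s lerD2l ler_wpM2l// ler_nat.
have -> : D b - D a = \sum_(0 <= i < n.+1) (D (s i.+1) - D (s i)).
  by rewrite (telescope_sumr (fun i => D (s i)))// sn s0.
have -> : P b - P a = \sum_(0 <= i < n.+1) (P (s i.+1) - P (s i)).
  by rewrite (telescope_sumr (fun i => P (s i)))// sn s0.
rewrite (le_trans (ler_norm_sum _ _ _))//.
rewrite mulrAC mulr_sumr big_nat [leRHS]big_nat; apply: ler_sum => i /andP[_ ilt].
rewrite -(ss i); apply: H; first by rewrite -s0 ms.
  exact: ms.
by rewrite -sn ms.
Qed.

(** Absolute continuity with a square integrable density; on [[0, 1]] it is convertible to
    [H1_deriv]. *)
Definition prim a b F f := L2on a b f /\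
  forall x, a <= x <= b -> F x = F a + intg a x f.

Lemma prim_L2 a b F f : prim a b F f -> L2on a b f.
Proof. by case. Qed.

Lemma prim_diff a b F f x y : prim a b F f -> a <= x -> x <= y -> y <= b ->
  F y - F x = intg x y f.
Proof.
move=> [lf Ff] ax xy yb.
rewrite (Ff y) ?(le_trans ax xy)//= (Ff x) ?ax ?(le_trans xy yb)//.
rewrite (int_cat ax xy); first by ring.
by apply: L1on_sub (L2on_L1 lf) _ _.
Qed.

Lemma primI a b F f : L2on a b f ->
  (forall x y, a <= x -> x <= y -> y <= b -> F y - F x = intg x y f) ->
  prim a b F f.
Proof.
by move=> lf H; split => // x /andP[ax xb]; rewrite -(H a x)// addrC subrK.
Qed.

Lemma prim_sub a b c d F f : prim c d F f -> c <= a -> b <= d -> prim a b F f.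
Proof.
move=> H ca bd; apply: primI; first exact: L2on_sub (prim_L2 H) _ _.
move=> x y ax xy yb; apply: (prim_diff H) => //.
  exact: le_trans ax.
exact: le_trans bd.
Qed.

Lemma eq_prim a b F f G g : (forall x, a <= x <= b -> F x = G x) ->
  (forall x, a <= x <= b -> f x = g x) -> prim a b F f -> prim a b G g.
Proof.
move=> FG fg H; apply: primI; first exact: eq_L2on (prim_L2 H).
move=> x y ax xy yb.
rewrite -!FG ?(le_trans ax xy) ?ax ?yb ?(le_trans xy)//.
rewrite (prim_diff H)//; apply: eq_int => z /andP[xz zy].
by apply: fg; rewrite (le_trans ax xz) (le_trans zy yb).
Qed.

Lemma primD a b F f G g : prim a b F f -> prim a b G g ->
  prim a b (fun x => F x + G x) (fun x => f x + g x).
Proof.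
move=> [lf Ff] [lg Gg]; split; first exact: L2onD.
move=> x xab; have /andP[_ xb] := xab; rewrite Ff// Gg// intD; first by ring.
- by apply: L1on_sub (L2on_L1 lf) _ _.
- by apply: L1on_sub (L2on_L1 lg) _ _.
Qed.

Lemma primZ a b k F f : prim a b F f -> prim a b (fun x => k * F x) (fun x => k * f x).
Proof.
move=> [lf Ff]; split; first exact: L2onZ.
move=> x xab; have /andP[_ xb] := xab; rewrite Ff// intZ; first by ring.
by apply: L1on_sub (L2on_L1 lf) _ _.
Qed.

Lemma primN a b F f : prim a b F f -> prim a b (fun x => - F x) (fun x => - f x).
Proof.
by move=> /(primZ (-1)); apply: eq_prim => x _; rewrite mulN1r.
Qed.

Lemma primB a b F f G g : prim a b F f -> prim a b G g ->
  prim a b (fun x => F x - G x) (fun x => f x - g x).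
Proof. by move=> Ff /primN; exact: primD. Qed.

Lemma prim_cst a b k : prim a b (fun _ => k) (fun _ => 0).
Proof.
split; first exact: L2on_cst.
by move=> x /andP[ax _]; rewrite int_cst// mul0r addr0.
Qed.

Lemma prim_id a b : prim a b (fun x => x) (fun _ => 1).
Proof.
split; first exact: L2on_cst.
by move=> x /andP[ax _]; rewrite int_cst// mul1r addrC subrK.
Qed.

Lemma prim_cont a b F f : prim a b F f -> {within `[a, b], continuous F}.
Proof.
move=> [lf Ff].
have [ab|ba] := leP a b; last first.
  by rewrite set_itv_ge ?bnd_simp -?ltNge//; exact: continuous_subspace0.
have H : {within `[a, b], continuous (fun x => F a + intg a x f)}.
  move=> x; apply: cvgD; first exact: cvg_cst.
  exact: (parameterized_integral_continuous ab (L2on_L1 lf)).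
by move: H; apply: subspace_eq_continuous => x; rewrite inE/= in_itv/= => /Ff.
Qed.

Lemma prim_L2on a b F f : prim a b F f -> L2on a b F.
Proof. by move=> /prim_cont /L2on_cont. Qed.

(** Cauchy-Schwarz for the density against the constant 1. *)
Lemma prim_sqr_diff a b F f x y : prim a b F f -> a <= x -> x <= y -> y <= b ->
  (F y - F x) ^+ 2 <= (y - x) * intg x y (fun z => f z ^+ 2).
Proof.
move=> H ax xy yb; rewrite (prim_diff H)//.
have lf : L2on x y f by apply: L2on_sub (prim_L2 H) _ _.
have := int_CS lf (L2on_cst x y 1).
rewrite (eq_int (g := f)); last by move=> z _; rewrite mulr1.
rewrite (@eq_int _ _ _ (fun _ => 1 ^+ 2) (fun _ => 1)); last by move=> z _; rewrite expr1n.
by rewrite int_cst// mul1r mulrC.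
Qed.

Lemma int_mono a b c d f : L1on c d f -> (forall x, c <= x <= d -> 0 <= f x) ->
  c <= a -> a <= b -> b <= d -> intg a b f <= intg c d f.
Proof.
move=> lf f0 ca ab bd.
rewrite (int_cat ca (le_trans ab bd) lf).
rewrite (int_cat (f := f) ab bd); last by apply: L1on_sub lf _ _.
have h1 : 0 <= intg c a f.
  apply: int_ge0 => x /andP[cx xa]; apply: f0; rewrite cx/=.
  exact: le_trans xa (le_trans ab bd).
have h2 : 0 <= intg b d f.
  apply: int_ge0 => x /andP[bx xd]; apply: f0; rewrite xd andbT.
  exact: le_trans (le_trans ca ab) bx.
lra.
Qed.

(** Cauchy-Schwarz and [prim_sqr_diff] give [y - x] times the geometric mean of the two energies;
    the arithmetic mean is used instead because it is additive over intervals, as [flat_eq]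
    requires. *)
Lemma int_dev a b F f g x y : prim a b F f -> L2on a b g ->
  a <= x -> x <= y -> y <= b ->
  `|intg x y (fun z => g z * (F z - F x))| <=
   (y - x) * (1/2 * (intg x y (fun z => f z ^+ 2) + intg x y (fun z => g z ^+ 2))).
Proof.
move=> H lg ax xy yb.
have Hxy : prim x y F f by apply: prim_sub H _ _.
have lfx := prim_L2 Hxy.
have lgx : L2on x y g by apply: L2on_sub lg _ _.
have lF : L2on x y (fun z => F z - F x).
  by apply: L2onB (prim_L2on Hxy) (L2on_cst _ _ _).
have CS := int_CS lgx lF.
set B := intg _ _ _ in CS *; set A := intg x y (fun z => g z ^+ 2) in CS *.
set C := intg x y (fun z => f z ^+ 2).
have A0 : 0 <= A by exact: int_sqr_ge0.
have C0 : 0 <= C by exact: int_sqr_ge0.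
have yx0 : 0 <= y - x by rewrite subr_ge0.
have HC : intg x y (fun z => (F z - F x) ^+ 2) <= (y - x) * C * (y - x).
  rewrite -int_cst//; apply: le_int; [exact: L2on_sqr|exact: L1on_cst|].
  move=> z /andP[xz zy]; rewrite (le_trans (prim_sqr_diff Hxy _ _ _))//.
  apply: ler_pM; rewrite ?subr_ge0 ?int_sqr_ge0 ?lerD2r//.
  by apply: int_mono => //; [exact: L2on_sqr|move=> ? _; exact: sqr_ge0].
apply: norm_le_sqr; first by rewrite mulr_ge0// mulr_ge0// addr_ge0.
rewrite (le_trans CS)// (le_trans (ler_wpM2l A0 HC))//.
have := sqr_ge0 ((y - x) * (A - C)); nra.
Qed.

(** The product minus its candidate primitive has increments of second order in [y - x], so
    [flat_eq] makes it constant. Integration by parts follows without Fubini's theorem. *)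
Lemma primM a b F f G g : prim a b F f -> prim a b G g ->
  prim a b (fun x => F x * G x) (fun x => F x * g x + f x * G x).
Proof.
move=> HF HG.
have lf := prim_L2 HF; have lg := prim_L2 HG.
have l1 : L2on a b (fun x => F x * g x + f x * G x).
  apply: L2onD; first exact: L2on_mulc (prim_cont HF) lg.
  by apply: eq_L2on (L2on_mulc (prim_cont HG) lf) => x _; rewrite mulrC.
split=> // c /andP[ac cb].
set h := fun x => _ in l1 *.
pose D x := F x * G x - intg a x h.
(* Three error terms occur, each at most [y - x] times half of the two energies. *)
pose P x := 3/2 * (intg a x (fun z => f z ^+ 2) + intg a x (fun z => g z ^+ 2)).
suff : D c = D a by rewrite /D int_pt subr0 => <-; rewrite subrK.
apply: (@flat_eq D P) => // x y ax xy yc.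
have yb := le_trans yc cb.
have xb := le_trans xy yb.
have ay := le_trans ax xy.
have L1sub (l : R -> R) : L1on a b l -> L1on a y l by move=> lk; apply: L1on_sub lk _ _.
have -> : P y - P x = 3/2 * (intg x y (fun z => f z ^+ 2) + intg x y (fun z => g z ^+ 2)).
  rewrite /P (int_cat (f := fun z => f z ^+ 2) ax xy); last exact/L1sub/L2on_sqr.
  rewrite (int_cat (f := fun z => g z ^+ 2) ax xy); last exact/L1sub/L2on_sqr.
  by ring.
have HFx : prim x y F f by apply: prim_sub HF _ _.
have HGx : prim x y G g by apply: prim_sub HG _ _.
have lfx := prim_L2 HFx; have lgx := prim_L2 HGx.
have d1 := int_dev HG lf ax xy yb.
have d2 := int_dev HF lg ax xy yb.
have dF := prim_sqr_diff HF ax xy yb.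
have dG := prim_sqr_diff HG ax xy yb.
have -> : D y - D x = (F y - F x) * (G y - G x)
   - intg x y (fun z => f z * (G z - G x)) - intg x y (fun z => g z * (F z - F x)).
  rewrite /D (int_cat (f := h) ax xy); last exact/L1sub/L2on_L1.
  rewrite (@eq_int _ x y h (fun z => (f z * (G z - G x) + g z * (F z - F x)) +
      (G x * f z + F x * g z))); last by move=> z _; rewrite /h; ring.
  have q1 : L1on x y (fun z => f z * (G z - G x)).
    by apply: L2on_mul => //; apply: L2onB (prim_L2on HGx) (L2on_cst _ _ _).
  have q2 : L1on x y (fun z => g z * (F z - F x)).
    by apply: L2on_mul => //; apply: L2onB (prim_L2on HFx) (L2on_cst _ _ _).
  have q3 : L1on x y (fun z => G x * f z) by exact/L1onZ/L2on_L1.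
  have q4 : L1on x y (fun z => F x * g z) by exact/L1onZ/L2on_L1.
  rewrite (intD (L1onD q1 q2) (L1onD q3 q4)) (intD q1 q2) (intD q3 q4).
  rewrite (intZ _ (L2on_L1 lfx)) (intZ _ (L2on_L1 lgx)).
  by rewrite -(prim_diff HF ax xy yb) -(prim_diff HG ax xy yb); ring.
move: d1 d2 dF dG.
set I1 := intg _ _ _; set A := intg _ _ (fun z => g z ^+ 2).
set C := intg _ _ (fun z => f z ^+ 2); set I2 := intg _ _ _.
set p := F y - F x; set q := G y - G x => d1 d2 dF dG.
have A0 : 0 <= A by exact: int_sqr_ge0.
have C0 : 0 <= C by exact: int_sqr_ge0.
have yx0 : 0 <= y - x by rewrite subr_ge0.
have pq : `|p * q| <= (y - x) * (1/2 * (A + C)).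
  by rewrite ler_norml; have := sqr_ge0 (p + q); have := sqr_ge0 (p - q); nra.
rewrite (le_trans (ler_normB _ _))// (le_trans (lerD (ler_normB _ _) (lexx _)))//.
nra.
Qed.

Lemma prim_ibp a b F f G g : a <= b -> prim a b F f -> prim a b G g ->
  intg a b (fun x => F x * g x) + intg a b (fun x => f x * G x) =
  F b * G b - F a * G a.
Proof.
move=> ab HF HG.
rewrite (prim_diff (primM HF HG) (lexx _) ab (lexx _)) intD//.
  by apply: L2on_mul (prim_L2on HF) (prim_L2 HG).
by apply: L2on_mul (prim_L2 HF) (prim_L2on HG).
Qed.

(** Lebesgue differentiation: extended by zero, [f] has a vanishing primitive whose derivative is
    [f] almost everywhere. *)
Lemma int_sqr_ae a b f : (forall x, a <= x <= b -> intg a x f = 0) -> L2on a b f ->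
  {ae mu, forall x, a <= x <= b -> f x = 0}.
Proof.
move=> f0 lf.
have [ab|ba] := leP a b; last first.
  by apply: aeW => x /andP[ax xb]; move: (le_lt_trans (le_trans ax xb) ba); rewrite ltxx.
pose k : R -> R := f \_ `[a, b].
have kE x : a <= x <= b -> k x = f x.
  by move=> xab; rewrite /k patchE mem_set//= in_itv.
have kE' x : ~~ (a <= x <= b) -> k x = 0.
  by move=> xab; rewrite /k patchE memNset//= in_itv/=; exact/negP.
have ik : mu.-integrable setT (EFin \o k).
  by rewrite -restrict_EFin; apply/integrable_restrict => //=; rewrite setTI; exact: L2on_L1.
have lk : locally_integrable setT k by apply: integrable_locally_restrict => //; exact: L2on_L1.
have I0 x : intg a x k = 0.
  have [ax|xa] := leP a x; last by rewrite int_rev.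
  have [xb|bx] := leP x b.
    rewrite (@eq_int _ _ _ _ f) ?f0 ?ax//.
    by move=> z /andP[az zx]; rewrite kE// az (le_trans zx).
  have l1 : L1on a x k by apply: integrableS ik.
  rewrite (int_cat ab (ltW bx))//.
  rewrite (@eq_int _ _ _ k f) ?f0 ?ab ?lexx//.
  rewrite add0r /intg -Rintegral_itv_obnd_cbnd; last first.
    by apply: integrableS ik.
  rewrite -[RHS](mul0r (fine (mu `]b, x]))) -Rintegral_cst//.
  apply: eq_Rintegral => z; rewrite inE/= in_itv/= => /andP[bz zx].
  by rewrite kE'// negb_and -!ltNge bz orbT.
have ik' y : mu.-integrable [set` Interval (BLeft a) (BRight y)] (EFin \o k).
  by apply: integrableS ik.
have := FTC1 ik' lk.
have na : {ae mu, forall x, x != a}.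
  exists [set a]; split => //=; first exact: lebesgue_measure_set1.
  by move=> x /= /negP/negPn/eqP ->.
apply: (@filterS2 _ _ (ae_filter_ringOfSetsType mu) _ _ _ _ na) => x xa /= H xab.
have ax : a < x by move/andP : xab => [h _]; rewrite lt_neqAle eq_sym xa.
have [_] := H ax.
rewrite (_ : (fun x => _) = (fun=> 0)); last by apply/funext => z; exact: I0.
by rewrite derive1_cst kE.
Qed.

Lemma int_sqr_uniq a b f : a <= b -> (forall x, a <= x <= b -> intg a x f = 0) -> L2on a b f ->
  intg a b (fun x => f x ^+ 2) = 0.
Proof.
move=> ab f0 lf; have h := int_sqr_ae f0 lf.
rewrite /intg /Rintegral (ae_eq_integral (cst 0)) ?integral0//.
- exact: (measurable_int mu (L2on_sqr lf)).
- by apply: (@filterS _ _ (ae_filter_ringOfSetsType mu) _ _ _ h) => x /= hx; rewrite in_itv/= => /hx ->; rewrite expr0n.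
Qed.

Lemma sqr3_le x y k : (x + y + k) ^+ 2 <= 3 * (x ^+ 2 + y ^+ 2 + k ^+ 2).
Proof.
have := sqr_ge0 (x - y); have := sqr_ge0 (x - k); have := sqr_ge0 (y - k); nra.
Qed.

Lemma int_sqr3 a b f g h : L2on a b f -> L2on a b g -> L2on a b h ->
  intg a b (fun x => (f x + g x + h x) ^+ 2) <=
  3 * (intg a b (fun x => f x ^+ 2) + intg a b (fun x => g x ^+ 2) + intg a b (fun x => h x ^+ 2)).
Proof.
move=> lf lg lh.
have lfg := L1onD (L2on_sqr lf) (L2on_sqr lg).
rewrite -(intD (L2on_sqr lf) (L2on_sqr lg)) -(intD lfg (L2on_sqr lh)).
rewrite -intZ; last by apply: L1onD => //; exact: L2on_sqr.
apply: le_int; [exact/L2on_sqr/L2onD/lh/L2onD|by apply/L1onZ/L1onD => //; exact: L2on_sqr|].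
by move=> x _; exact: sqr3_le.
Qed.

End prim.

(** * Semi-inner products and Riemann sums *)

Section sip_def.
Context {R : realType} {E : lmodType R}.

Definition linsub (X : E -> Prop) :=
  X 0 /\ forall k u v, X u -> X v -> X (k *: u + v).

(** Relative to [X] because integrals are linear only on integrable functions, and without
    definiteness because functions equal almost everywhere remain distinct elements of [E]. *)
Definition sip (X : E -> Prop) (b : E -> E -> R) :=
  [/\ forall u v, X u -> X v -> b u v = b v u,
      forall k u v w, X u -> X v -> X w -> b (k *: u + v) w = k * b u w + b v w &
      forall u, X u -> 0 <= b u u].

Definition nrm (b : E -> E -> R) u := Num.sqrt (b u u).

Definition cpath (X : E -> Prop) (b : E -> E -> R) (U : R -> E) :=
  (forall t : R, 0 <= t -> X (U t)) /\
  forall t0 e : R, 0 <= t0 -> 0 < e -> exists2 d : R, 0 < d &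
    forall t : R, 0 <= t -> `|t - t0| < d -> nrm b (U t - U t0) < e.

(** The relation [P' = W] with [W] continuous, encoded by the mean value inequality so that neither
    a limit nor a vector-valued integral occurs. *)
Definition C1path (b : E -> E -> R) (P W : R -> E) :=
  forall s r w : R, 0 <= s -> s <= r ->
    (forall t : R, s <= t <= r -> nrm b (W t - W s) <= w) ->
    nrm b (P r - P s - (r - s) *: W s) <= (r - s) * w.

End sip_def.

Section sip_theory.
Context {R : realType} {E : lmodType R} (X : E -> Prop) (b : E -> E -> R).
Hypothesis hX : linsub X.
Hypothesis hb : sip X b.
Implicit Types (u v w : E) (k : R).

Lemma sub0 : X 0. Proof. exact: hX.1. Qed.

Lemma subD u v : X u -> X v -> X (u + v).
Proof. by move=> Xu Xv; rewrite -[u]scale1r; exact: hX.2. Qed.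

Lemma subZ k u : X u -> X (k *: u).
Proof. by move=> Xu; rewrite -[_ *: _]addr0; apply: hX.2 => //; exact: sub0. Qed.

Lemma subN u : X u -> X (- u).
Proof. by move=> Xu; rewrite -scaleN1r; exact: subZ. Qed.

Lemma subB u v : X u -> X v -> X (u - v).
Proof. by move=> Xu Xv; apply: subD => //; exact: subN. Qed.

Lemma sub_sum n (F : 'I_n -> E) : (forall i, X (F i)) -> X (\sum_(i < n) F i).
Proof. by move=> XF; elim/big_ind : _ => //; [exact: sub0|exact: subD]. Qed.

Hint Resolve sub0 subD subZ subN subB : sip.
Local Ltac sip := try solve [auto 8 with sip].

Lemma sipC u v : X u -> X v -> b u v = b v u.
Proof. by case: hb => + _ _; apply. Qed.

Lemma sip_ge0 u : X u -> 0 <= b u u.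
Proof. by case: hb => _ _; apply. Qed.

Lemma sipDl u v w : X u -> X v -> X w -> b (u + v) w = b u w + b v w.
Proof.
by case: hb => _ H _ Xu Xv Xw; rewrite -[u in LHS]scale1r H// mul1r.
Qed.

Lemma sip0l w : X w -> b 0 w = 0.
Proof.
move=> Xw; have := sipDl sub0 sub0 Xw; rewrite addr0 => /eqP.
by rewrite -subr_eq0 opprD addrA subrr add0r oppr_eq0 => /eqP.
Qed.

Lemma sipZl k u w : X u -> X w -> b (k *: u) w = k * b u w.
Proof.
case: hb => _ H _ Xu Xw; rewrite -[_ *: _]addr0 H ?sip0l ?addr0//; exact: sub0.
Qed.

Lemma sipNl u w : X u -> X w -> b (- u) w = - b u w.
Proof. by move=> Xu Xw; rewrite -scaleN1r sipZl// mulN1r. Qed.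

Lemma sipBl u v w : X u -> X v -> X w -> b (u - v) w = b u w - b v w.
Proof. by move=> Xu Xv Xw; rewrite sipDl ?sipNl//; exact: subN. Qed.

Lemma sipDr u v w : X u -> X v -> X w -> b w (u + v) = b w u + b w v.
Proof. by move=> Xu Xv Xw; rewrite sipC ?sipDl// ?(sipC Xw)//; exact: subD. Qed.

Lemma sipZr k u w : X u -> X w -> b w (k *: u) = k * b w u.
Proof. by move=> Xu Xw; rewrite sipC ?sipZl// ?(sipC Xw)//; exact: subZ. Qed.

Lemma sip_suml n (F : 'I_n -> E) w : (forall i, X (F i)) -> X w ->
  b (\sum_(i < n) F i) w = \sum_(i < n) b (F i) w.
Proof.
move=> XF Xw.
have [] : X (\sum_(i < n) F i) /\ b (\sum_(i < n) F i) w = \sum_(i < n) b (F i) w; last by [].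
elim/big_ind2 : _ => [|x1 x2 y1 y2 [X1 <-] [X2 <-]|i _]; split => //.
- exact: sub0.
- exact: sip0l.
- exact: subD.
- by rewrite sipDl.
Qed.

Lemma nrm_ge0 u : 0 <= nrm b u. Proof. exact: sqrtr_ge0. Qed.

Lemma nrm_sqr u : X u -> nrm b u ^+ 2 = b u u.
Proof. by move=> Xu; rewrite sqr_sqrtr// sip_ge0. Qed.

Lemma sip_CS u v : X u -> X v -> `|b u v| <= nrm b u * nrm b v.
Proof.
move=> Xu Xv.
apply: norm_le_sqr; first by rewrite mulr_ge0 ?nrm_ge0.
rewrite exprMn !nrm_sqr//.
have H s : 0 <= b u u + s * (2 * b u v) + s ^+ 2 * b v v.
  have Xs : X (s *: v) by exact: subZ.
  have := sip_ge0 (subD Xu Xs).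
  rewrite sipDl; sip; rewrite !sipDr; sip; rewrite !sipZl; sip; rewrite !sipZr; sip.
  rewrite (sipC Xv Xu); by move=> h; rewrite (le_trans h)//; nra.
have C0 := sip_ge0 Xv.
have [C1|C1] := eqVneq (b v v) 0.
  have [->|B0] := eqVneq (b u v) 0; first by rewrite C1 mulr0 expr0n.
  have := H (- (b u u + 1) / (2 * b u v)).
  rewrite C1 mulr0 addr0 divfK ?mulf_neq0 ?pnatr_eq0//; lra.
have Cp : 0 < b v v by rewrite lt_neqAle eq_sym C1.
have := H (- b u v / b v v).
have -> : b u u + - b u v / b v v * (2 * b u v) + (- b u v / b v v) ^+ 2 * b v v =
  (b u u * b v v - b u v ^+ 2) / b v v by field.
by rewrite pmulr_lge0 ?invr_gt0// subr_ge0.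
Qed.

Lemma nrmD u v : X u -> X v -> nrm b (u + v) <= nrm b u + nrm b v.
Proof.
move=> Xu Xv; rewrite -(ler_pXn2r (ltn0Sn 1)) ?nnegrE ?addr_ge0 ?nrm_ge0//.
rewrite nrm_sqr; sip; rewrite sipDl; sip; rewrite !sipDr; sip.
rewrite (sipC Xv Xu) -(nrm_sqr Xu) -(nrm_sqr Xv).
have := sip_CS Xu Xv; rewrite ler_norml; nra.
Qed.

Lemma nrmZ k u : X u -> nrm b (k *: u) = `|k| * nrm b u.
Proof.
move=> Xu; rewrite /nrm sipZl; sip; rewrite sipZr; sip.
rewrite mulrA -expr2 sqrtrM ?sqr_ge0//; by rewrite sqrtr_sqr.
Qed.

Lemma nrmN u : X u -> nrm b (- u) = nrm b u.
Proof. by move=> Xu; rewrite -scaleN1r nrmZ// normrN1 mul1r. Qed.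

Lemma nrmB u v : X u -> X v -> nrm b (u - v) = nrm b (v - u).
Proof. by move=> Xu Xv; rewrite -opprB nrmN//; exact: subB. Qed.

Lemma nrm0 : nrm b 0 = 0.
Proof. by rewrite /nrm sip0l ?sqrtr0//; exact: sub0. Qed.

Lemma nrm_sum n (F : 'I_n -> E) : (forall i, X (F i)) ->
  nrm b (\sum_(i < n) F i) <= \sum_(i < n) nrm b (F i).
Proof.
move=> XF.
have [] : X (\sum_(i < n) F i) /\ nrm b (\sum_(i < n) F i) <= \sum_(i < n) nrm b (F i); last by [].
elim/big_ind2 : _ => [|x1 x2 y1 y2 [X1 h1] [X2 h2]|i _]; split => //.
- exact: sub0.
- by rewrite nrm0.
- exact: subD.
- by rewrite (le_trans (nrmD _ _))// lerD.
Qed.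

(** The Riemann sum minus the telescoped increment of [F] is a sum of [n] first-order errors. A
    tolerance [e / (2 (t + 1))] per unit of length keeps their sum below [e], also for [t = 0]. *)
Lemma riemann_cvg (F u : R -> E) (t : R) : 0 <= t ->
  (forall s : R, 0 <= s <= t -> X (F s) /\ X (u s)) ->
  (forall e : R, 0 < e -> exists2 d : R, 0 < d & forall s r : R, 0 <= s -> s <= r -> r <= t ->
     r - s < d -> nrm b (F r - F s - (r - s) *: u s) <= e * (r - s)) ->
  nrm b (\sum_(k < n) (t / n%:R) *: u (k%:R * t / n%:R) - (F t - F 0)) @[n --> \oo] --> (0:R).
Proof.
move=> t0 XF H; apply/cvgrPdist_lt => e e0.
have et : 0 < e / (2 * (t + 1)) by rewrite divr_gt0// mulr_gt0// ltr_pwDr.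
have [d d0 Hd] := H _ et.
pose N := (Num.trunc (t / d)).+1.
exists N => // n /= Nn.
have n0 : (0 < n)%N by exact: leq_trans Nn.
have n0R : 0 < n%:R :> R by rewrite ltr0n.
have tn0 : 0 <= t / n%:R by rewrite divr_ge0// ltW.
have tnd : t / n%:R < d.
  rewrite ltr_pdivrMr// mulrC -ltr_pdivrMr//.
  by rewrite (lt_le_trans (truncnS_gt _))// ler_nat.
pose s (k : nat) := k%:R * t / n%:R.
have ss (k : nat) : s k.+1 - s k = t / n%:R by rewrite /s -natr1; ring.
have ms (k l : nat) : (k <= l)%N -> s k <= s l.
  by move=> kl; rewrite /s -!mulrA ler_wpM2r// ler_nat.
have s0 : s 0 = 0 by rewrite /s mul0r mul0r.
have sn : s n = t by rewrite /s mulrAC mulfV ?mul1r// gt_eqF.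
have sI (k : nat) : (k <= n)%N -> 0 <= s k <= t.
  by move=> kn; rewrite -{1}s0 -sn !ms.
have -> : F t - F 0 = \sum_(k < n) (F (s k.+1) - F (s k)).
  by rewrite -(big_mkord xpredT (fun k : nat => F (s k.+1) - F (s k))) (telescope_sumr (fun k : nat => F (s k)))// sn s0.
have -> : \sum_(k < n) (t / n%:R) *: u (k%:R * t / n%:R) - \sum_(k < n) (F (s k.+1) - F (s k))
   = \sum_(k < n) - (F (s k.+1) - F (s k) - (s k.+1 - s k) *: u (s k)).
  rewrite -sumrB; apply: eq_bigr => k _; by rewrite ss [in RHS]opprB.
have Xk (k : 'I_n) : X (F (s k.+1) - F (s k) - (s k.+1 - s k) *: u (s k)).
  have [X1 X2] := XF _ (sI k (ltnW (ltn_ord k))).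
  have [X3 _] := XF _ (sI k.+1 (ltn_ord k)).
  by apply: subB; [exact: subB|exact: subZ].
rewrite sub0r normrN ger0_norm ?nrm_ge0//.
rewrite (le_lt_trans (nrm_sum _))//; first by move=> k; exact/subN/Xk.
apply: (@le_lt_trans _ _ (\sum_(k < n) (e / (2 * (t + 1)) * (t / n%:R)))).
  apply: ler_sum => k _; rewrite nrmN ?Xk// -(ss k).
  apply: Hd; rewrite ?ss//.
  - by have /andP[] := sI k (ltnW (ltn_ord k)).
  - exact: ms.
  - by have /andP[] := sI k.+1 (ltn_ord k).
have t10 : 0 < t + 1 by rewrite ltr_wpDl.
rewrite sumr_const card_ord.
have -> : e / (2 * (t + 1)) * (t / n%:R) *+ n = e * (t / (2 * (t + 1))).
  by rewrite -mulr_natr; field; rewrite !gt_eqF.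
rewrite gtr_pMr// ltr_pdivrMr ?mulr_gt0//; lra.
Qed.

(* Lebesgue number argument, phrased with the near-covering form of compactness. *)
Lemma cpath_unif (U : R -> E) (t e : R) : cpath X b U -> 0 < e -> exists2 d : R, 0 < d &
  forall s r : R, 0 <= s -> s <= r -> r <= t -> r - s < d -> nrm b (U r - U s) <= e.
Proof.
move=> [XU cU] e0.
have e20 : 0 < e / 2 by rewrite divr_gt0.
have /compact_near_coveringP/near_covering_withinP H : compact (`[0, t]%classic : set R).
  exact: segment_compact.
have := H R (0^'+) (fun d x => forall r, 0 <= r -> `|r - x| < d -> nrm b (U r - U x) <= e) _.
move=> /(_ _)[].
  move=> x /=; rewrite in_itv/= => /andP[x0 xt].
  have [d d0 Hd] := cU _ _ x0 e20.
  have d20 : 0 < d / 2 by rewrite divr_gt0.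
  (* Halving the modulus at [x] puts both [y] and every [r] close to [y] within [d] of [x]. *)
  exists ([set y | `|y - x| < d / 2], [set z | z < d / 2]) => /=.
    split; first by exists (d / 2) => //= y /=; rewrite distrC.
    by exists (d / 2) => //= y /=; rewrite sub0r normrN => /ltr_normlW.
  move=> [y z]/= [yx zd]; rewrite in_itv/= => /andP[y0 _] r r0 ry.
  have rx : `|r - x| < d.
    rewrite (splitr d) (le_lt_trans (ler_distD y _ _))// ltrD// (lt_trans ry)//.
  have yx' : `|y - x| < d by rewrite (lt_trans yx)// ltr_pdivrMr// ltr_pMr// ltr1n.
  have -> : U r - U y = (U r - U x) - (U y - U x) by rewrite opprB addrA subrK.
  have Xr := XU r r0; have Xx := XU x x0; have Xy := XU y y0.
  rewrite (splitr e) (le_trans (nrmD _ _)); sip; rewrite nrmN; sip.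
  by apply: lerD; apply: ltW; apply: Hd.
move=> d /= d0 Hd.
exists (d / 2); first by rewrite divr_gt0.
move=> s r s0 sr rt rsd.
apply: (Hd (d / 2)) => //=.
- rewrite sub0r normrN gtr0_norm ?divr_gt0// ltr_pdivrMr// ltr_pMr// ltr1n//.
- by rewrite divr_gt0.
- by rewrite in_itv/= s0 (le_trans sr).
- exact: le_trans sr.
- by rewrite ger0_norm// subr_ge0.
Qed.

End sip_theory.

(** * Paths in a semi-inner product space *)

Lemma is_derive_eps {R : realType} (f : R -> R) (x d : R) :
  (forall e : R, 0 < e -> exists2 r : R, 0 < r &
     forall h : R, `|h| < r -> `|f (x + h) - f x - h * d| <= e * `|h|) ->
  is_derive x (1 : R) f d.
Proof.
move=> H.
have C : h^-1 *: (f (h *: (1:R) + x) - f x) @[h --> (0:R)^'] --> (d : R).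
  apply/cvgrPdist_le => e e0.
  have [r r0 Hr] := H _ e0.
  exists r => //= h /=; rewrite sub0r normrN => hr hn0.
  have hp : 0 < `|h| by rewrite normr_gt0.
  have := Hr _ hr; rewrite -ler_pdivrMr// -[X in _ / X]normr_id -normf_div.
  move=> {}Hr; rewrite distrC (le_trans _ Hr)// le_eqVlt; apply/orP; left; apply/eqP.
  rewrite normf_div normr_id -normf_div; congr `|_|.
  rewrite /GRing.scale/= mulr1 [h + x]addrC; by field.
by apply: DeriveDef; [apply/cvg_ex; exists d|exact: cvg_lim C].
Qed.

Section scalar_sip.
Context {R : realType}.

(** The real line as an instance of the abstract setting, so that uniform continuity and Riemann
    sums of scalar functions follow from the general lemmas. *)
Definition rsip (x y : R^o) : R := x * y.

Lemma rlinsub : linsub (fun _ : R^o => True). Proof. by []. Qed.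

Lemma rsip_sip : sip (fun _ => True) rsip.
Proof.
split=> *; [exact: mulrC| |exact: sqr_ge0].
by rewrite /rsip /GRing.scale/= mulrDl mulrA.
Qed.

Lemma rnrm (x : R^o) : nrm rsip x = `|x|.
Proof. by rewrite /nrm /rsip -expr2 sqrtr_sqr. Qed.

Lemma continuous_path_within (t : R) (f : R -> R) :
  cpath (fun _ : R^o => True) rsip f -> {within `[0, t], continuous f}.
Proof.
move=> [_ cf]; apply/subspace_continuousP => x.
rewrite /= in_itv/= => /andP[x0 xt]; apply/cvgrPdist_lt => e e0.
have [d d0 Hd] := cf _ _ x0 e0.
exists d => //= y /=; rewrite distrC => yx; rewrite in_itv/= => /andP[y0 _].
by have := Hd _ y0 yx; rewrite rnrm distrC.
Qed.

Lemma riemann_scalar (f : R -> R) (t : R) : 0 <= t ->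
  cpath (fun _ : R^o => True) rsip f ->
  \sum_(k < n) (t / n%:R) * f (k%:R * t / n%:R) @[n --> \oo] --> intg 0 t f.
Proof.
move=> t0 cf.
have cw := @continuous_path_within t _ cf.
have lf : L1on 0 t f by exact: L1on_cont.
have key : forall e : R, 0 < e -> exists2 d : R, 0 < d & forall s r : R, 0 <= s ->
    s <= r -> r <= t -> r - s < d ->
    nrm rsip ((intg 0 r f : R^o) - intg 0 s f - (r - s) *: (f s : R^o)) <= e * (r - s).
  move=> e e0; have [d d0 Hd] := cpath_unif rlinsub rsip_sip t cf e0.
  exists d => // s r s0 sr rt rsd; rewrite rnrm.
  have lsr : L1on s r f by apply: L1on_sub lf _ _.
  rewrite (int_cat s0 sr); last by apply: L1on_sub lf _ _.
  rewrite [intg 0 s f + _]addrC addrK.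
  have -> : (r - s) *: (f s : R^o) = intg s r (fun _ => f s).
    by rewrite int_cst// mulrC.
  rewrite -intB//; last exact: L1on_cst.
  have lB : L1on s r (fun x => f x - f s) by apply: L1onB => //; exact: L1on_cst.
  rewrite (le_trans (norm_int lB))// -int_cst//.
  apply: le_int; [exact: L1on_norm|exact: L1on_cst|].
  move=> x /andP[sx xr]; rewrite -rnrm; apply: Hd => //.
    exact: le_trans xr rt.
  by rewrite (le_lt_trans _ rsd)// lerD2r.
have := @riemann_cvg R R^o _ rsip rlinsub rsip_sip (fun s => intg 0 s f) f t t0 (fun _ _ => conj I I) key.
rewrite int_pt => HN.
apply/cvgrPdist_lt => e e0; move/cvgrPdist_lt/(_ _ e0) : HN.
apply: filterS => n; rewrite rnrm sub0r normrN normr_id subr0 distrC.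
by apply.
Qed.

End scalar_sip.

Section paths.
Context {R : realType} {E : lmodType R} (X : E -> Prop) (b : E -> E -> R).
Hypothesis hX : linsub X.
Hypothesis hb : sip X b.
Implicit Types (u v w : E) (k : R).

Let sub0 := sub0 hX.
Let subD := subD hX.
Let subZ := subZ hX.
Let subN := subN hX.
Let subB := subB hX.
Hint Resolve sub0 subD subZ subN subB : sip.
Local Ltac sip := try solve [auto 8 with sip].

Definition integral_of (U : R -> E) (t : R) V := X V /\
  nrm b (\sum_(k < n) (t / n%:R) *: U (k%:R * t / n%:R) - V) @[n --> \oo] --> (0 : R).

Lemma cpath_sip (U : R -> E) w : cpath X b U -> X w ->
  cpath (fun _ : R^o => True) rsip (fun s => b (U s) w).
Proof.
move=> [XU cU] Xw; split => // t0 e t00 e0.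
have e1 : 0 < e / (nrm b w + 1) by rewrite divr_gt0// ltr_wpDl ?nrm_ge0.
have [d d0 Hd] := cU _ _ t00 e1; exists d => // t t0' td.
have Xt := XU t t0'; have Xt0 := XU t0 t00.
rewrite rnrm -(sipBl hX hb)//; sip.
rewrite (le_lt_trans (sip_CS hX hb _ _))//; sip.
apply: (@le_lt_trans _ _ (nrm b (U t - U t0) * (nrm b w + 1))).
  by rewrite ler_wpM2l ?nrm_ge0// lerDl.
by rewrite -ltr_pdivlMr ?ltr_wpDl ?nrm_ge0//; exact: Hd.
Qed.

(** Pairing with [w] is continuous by Cauchy-Schwarz, so it commutes with the limit of Riemann sums.
    Additivity in [t] is then inherited from the Lebesgue integral. *)
Lemma integral_of_sip (U : R -> E) (t : R) V w : 0 <= t -> cpath X b U ->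
  integral_of U t V -> X w -> b V w = intg 0 t (fun s => b (U s) w).
Proof.
move=> t0 cU [XV iV] Xw.
have H1 := riemann_scalar t0 (cpath_sip cU Xw).
suff H2 : \sum_(k < n) (t / n%:R) * b (U (k%:R * t / n%:R)) w @[n --> \oo] --> b V w.
  by rewrite -(cvg_lim _ H1)// -(cvg_lim _ H2).
apply/cvgrPdist_lt => e e0.
have e1 : 0 < e / (nrm b w + 1) by rewrite divr_gt0// ltr_wpDl ?nrm_ge0.
move/cvgrPdist_lt/(_ _ e1) : iV; apply: filterS => n.
rewrite sub0r normrN ger0_norm ?nrm_ge0// => Hn.
have XU (i : 'I_n) : X ((t / n%:R) *: U (i%:R * t / n%:R)).
  by apply: subZ; apply: cU.1; rewrite divr_ge0// mulr_ge0.
have -> : \sum_(k < n) t / n%:R * b (U (k%:R * t / n%:R)) w =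
    b (\sum_(k < n) (t / n%:R) *: U (k%:R * t / n%:R)) w.
  rewrite (sip_suml hX hb)//; apply: eq_bigr => i _; rewrite (sipZl hX hb)//.
  by apply: cU.1; rewrite divr_ge0// mulr_ge0.
have XS := sub_sum hX XU.
rewrite distrC -(sipBl hX hb)//.
rewrite (le_lt_trans (sip_CS hX hb _ _))//; sip.
apply: (@le_lt_trans _ _ (nrm b (\sum_(i < n) (t / n%:R) *: U (i%:R * t / n%:R) - V) * (nrm b w + 1))).
  by rewrite ler_wpM2l ?nrm_ge0// lerDl.
by rewrite -ltr_pdivlMr ?ltr_wpDl ?nrm_ge0.
Qed.

(** Pair the error [D] with itself: its squared norm is the integral over [[s, r]] of
    [b (U x - U s) D], at most [(r - s) * w * nrm b D], and one factor [nrm b D] cancels. *)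
Lemma integral_of_C1 (U V : R -> E) : cpath X b U ->
  (forall t : R, 0 <= t -> integral_of U t (V t)) -> C1path b V U.
Proof.
move=> cU iV s r w s0 sr Hw.
have r0 := le_trans s0 sr.
have Xs := (iV s s0).1; have Xr := (iV r r0).1; have XUs := cU.1 s s0.
set D := _ - _ - _.
have XD : X D by rewrite /D; sip.
have w0 : 0 <= w by rewrite (le_trans (nrm_ge0 b (U s - U s)))// Hw// lexx.
have lU (t : R) : L1on 0 t (fun s => b (U s) D).
  exact/L1on_cont/continuous_path_within/cpath_sip.
have lsr : L1on s r (fun s => b (U s) D) by apply: L1on_sub (lU r) _ _.
have H : nrm b D ^+ 2 <= (r - s) * w * nrm b D.
  rewrite (nrm_sqr hb)// {1}/D (sipBl hX hb); sip.
  rewrite (sipBl hX hb); sip; rewrite (sipZl hX hb)//.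
  rewrite (integral_of_sip s0 cU (iV s s0))// (integral_of_sip r0 cU (iV r r0))//.
  rewrite (int_cat s0 sr)// [intg 0 s _ + _]addrC addrK.
  rewrite mulrC -int_cst// -intB//; last exact: L1on_cst.
  rewrite -mulrA mulrC -int_cst//.
  apply: le_int; [by apply: L1onB => //; exact: L1on_cst|exact: L1on_cst|].
  move=> x sxr; have /andP[sx xr] := sxr.
  have Xx := cU.1 x (le_trans s0 sx).
  rewrite -(sipBl hX hb)// (le_trans (ler_norm _))//.
  rewrite (le_trans (sip_CS hX hb _ _))//; sip.
  by rewrite ler_wpM2r ?nrm_ge0// Hw.
have [->|D0] := eqVneq (nrm b D) 0; first by rewrite mulr_ge0// subr_ge0.
have Dp : 0 < nrm b D by rewrite lt_neqAle eq_sym D0 nrm_ge0.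
by move: H; rewrite expr2 ler_pM2r.
Qed.

(** To the left of [t] the mean value bound starts at [s]: the oscillation of [W] on [[s, t]] costs
    [2 e / 3], and replacing [W s] with [W t] costs the remaining [e / 3]. *)
Lemma C1path_diff (P W : R -> E) (t : R) : cpath X b W ->
  (forall t : R, 0 <= t -> X (P t)) -> C1path b P W -> 0 <= t ->
  forall e : R, 0 < e -> exists2 d : R, 0 < d & forall s : R, 0 <= s -> `|s - t| < d ->
     nrm b (P s - P t - (s - t) *: W t) <= e * `|s - t|.
Proof.
move=> [XW cW] XP C t0 e e0.
have e1 : 0 < e / 3 by rewrite divr_gt0.
have [d d0 Hd] := cW _ _ t0 e1.
exists d => // s s0 std.
have Xs := XP s s0; have Xt := XP t t0; have XWs := XW s s0; have XWt := XW t t0.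
have [ts|st] := leP t s.
  rewrite (ger0_norm (_ : 0 <= s - t)) ?subr_ge0//.
  rewrite [leRHS]mulrC; apply: C => // r /andP[tr rs].
  apply: (@le_trans _ _ (e / 3)); last by lra.
  apply/ltW/Hd; first exact: le_trans tr.
  by rewrite ger0_norm ?subr_ge0// (le_lt_trans _ std)// ger0_norm ?subr_ge0// lerD2r.
rewrite distrC (gtr0_norm (_ : 0 < t - s)) ?subr_gt0//.
have st0 : 0 <= t - s by rewrite subr_ge0 ltW.
have -> : P s - P t - (s - t) *: W t =
    - (P t - P s - (t - s) *: W s) + (t - s) *: (W t - W s).
  rewrite scalerBr -[s - t]opprB scaleNr opprK [in RHS]addrC [in RHS]opprB.
  by rewrite addrA subrK [in RHS]opprB addrC.
have h1 : nrm b (P t - P s - (t - s) *: W s) <= (t - s) * (2 * e / 3).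
  apply: C => //; first exact: ltW.
  move=> r /andP[sr rt].
  have Xr := XW r (le_trans s0 sr).
  have -> : W r - W s = (W r - W t) - (W s - W t) by rewrite opprB addrA subrK.
  rewrite (le_trans (nrmD hX hb _ _))//; sip; rewrite (nrmN hX hb)//; sip.
  have a1 : nrm b (W r - W t) < e / 3.
    apply: Hd; first exact: le_trans sr.
    rewrite distrC ger0_norm ?subr_ge0// (le_lt_trans _ std)// distrC ger0_norm// lerD2l lerN2//.
  have a2 : nrm b (W s - W t) < e / 3 by exact: Hd.
  lra.
have h2 : nrm b (W t - W s) <= e / 3.
  by rewrite (nrmB hX hb)//; apply/ltW/Hd.
rewrite (le_trans (nrmD hX hb _ _))//; sip; rewrite (nrmN hX hb)//; sip.
rewrite (nrmZ hX hb) ?ger0_norm//; sip.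
by rewrite (le_trans (lerD h1 (ler_wpM2l st0 h2)))//; nra.
Qed.

Definition diffpath (P W : R -> E) := forall t : R, 0 <= t ->
  forall e : R, 0 < e -> exists2 d : R, 0 < d & forall s : R, 0 <= s -> `|s - t| < d ->
     nrm b (P s - P t - (s - t) *: W t) <= e * `|s - t|.

(* Energy estimate: [t |-> bt (P t) (P t)] has derivative [2 * bt (P t) (W t)]. *)
Lemma C1path_decay (bt : E -> E -> R) (C m : R) (P W : R -> E) :
  sip X bt -> 0 < C -> (forall u, X u -> bt u u <= C ^+ 2 * b u u) ->
  (forall t : R, 0 <= t -> X (P t) /\ X (W t)) -> diffpath P W ->
  (forall t : R, 0 <= t -> bt (P t) (W t) <= - m * bt (P t) (P t)) ->
  forall t : R, 0 <= t -> bt (P t) (P t) <= expR (- (2 * m) * t) * bt (P 0) (P 0).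
Proof.
move=> hbt C0 HC XPW HP diss.
have XP (t : R) (t0 : 0 <= t) := (XPW t t0).1.
have XW (t : R) (t0 : 0 <= t) := (XPW t t0).2.
pose f t := bt (P t) (P t).
have nbt u : X u -> nrm bt u <= C * nrm b u.
  move=> Xu; rewrite -(ler_pXn2r (ltn0Sn 1)) ?nnegrE ?mulr_ge0 ?nrm_ge0 ?(ltW C0)//.
  by rewrite exprMn (nrm_sqr hb)// (nrm_sqr hbt)// HC.
have cP (t : R) : 0 <= t -> forall e : R, 0 < e -> exists2 d : R, 0 < d & forall s : R, 0 <= s ->
    `|s - t| < d -> `|f s - f t - (s - t) * (2 * bt (P t) (W t))| <= e * `|s - t|.
  move=> t0 e e0.
  have Xt := XP t t0; have XWt := XW t t0.
  (* The linearisation error of [f] is [2 * bt (P t) r + bt q q], where [q = h *: W t + r] is the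
     increment of [P]. [K] serves the first term and [L] the norm of [q]; [e1] and the radius give
     each term half of [e]. *)
  pose K := nrm bt (P t) * C; pose L := C * nrm b (W t) + C.
  have K0 : 0 <= K by rewrite mulr_ge0 ?nrm_ge0// ltW.
  have L0 : 0 < L by rewrite ltr_wpDl ?mulr_ge0 ?nrm_ge0// ltW.
  pose e1 := Num.min 1 (e / (4 * (K + 1))).
  have e10 : 0 < e1.
    by rewrite lt_min ltr01/= divr_gt0// mulr_gt0// ltr_wpDl.
  have e11 : e1 <= 1 by rewrite ge_min lexx.
  have e12 : 2 * (K * e1) <= e / 2.
    have : e1 <= e / (4 * (K + 1)) by rewrite ge_min lexx orbT.
    rewrite ler_pdivlMr; last by rewrite mulr_gt0// ltr_wpDl.
    nra.
  have [d d0 Hd] := HP t t0 _ e10.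
  exists (Num.min d (e / (2 * L ^+ 2))).
    by rewrite lt_min d0/= divr_gt0// mulr_gt0// exprn_gt0.
  move=> s s0; rewrite lt_min => /andP[std ste].
  have Xs := XP s s0.
  have := Hd _ s0 std; set h := s - t in std ste *; move rE : (_ - _ - _) => r hr.
  have Xr : X r by rewrite -rE; sip.
  have [q [qE Ps]] : exists q, q = h *: W t + r /\ P s = P t + q.
    exists (h *: W t + r); split => //.
    by rewrite -rE addrC [h *: _ + _]addrC subrK subrK.
  have Xq : X q by rewrite qE; sip.
  have -> : f s - f t - h * (2 * bt (P t) (W t)) = 2 * bt (P t) r + bt q q.
    rewrite /f Ps (sipDl hbt); sip; rewrite !(sipDr hX hbt); sip.
    rewrite (sipC hbt Xq Xt) {1 2}qE (sipDr hX hbt); sip; rewrite (sipZr hX hbt)//.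
    by ring.
  have b1 : `|bt (P t) r| <= K * (e1 * `|h|).
    rewrite (le_trans (sip_CS hX hbt _ _))// /K -mulrA ler_wpM2l ?nrm_ge0//.
    by rewrite (le_trans (nbt _ Xr))// ler_wpM2l// ltW.
  have b2 : nrm bt q <= L * `|h|.
    rewrite qE.
    rewrite (le_trans (nrmD hX hbt _ _))//; sip; rewrite (nrmZ hX hbt)//.
    have n1 := nbt _ XWt; have n2 := nbt _ Xr.
    have h0 := normr_ge0 h.
    rewrite /L mulrDl; apply: lerD; first by rewrite mulrC ler_wpM2r.
    rewrite (le_trans n2)// ler_wpM2l ?(ltW C0)// (le_trans hr)//.
    by rewrite ler_piMl.
  have b3 : bt q q <= (e / 2) * `|h|.
    rewrite -(nrm_sqr hbt)//.
    have h0 := normr_ge0 h.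
    apply: (@le_trans _ _ ((L * `|h|) ^+ 2)); first by rewrite ler_pXn2r ?nnegrE ?nrm_ge0// mulr_ge0// ltW.
    rewrite exprMn [`|h| ^+ 2]expr2 mulrA ler_wpM2r//.
    rewrite ltr_pdivlMr in ste; last by rewrite mulr_gt0// exprn_gt0.
    nra.
  have b0 := sip_ge0 hbt Xq.
  rewrite (le_trans (ler_normD _ _))// normrM (ger0_norm b0) ger0_norm//.
  have h0 := normr_ge0 h.
  nra.
move=> t t0.
have [->|tn0] := eqVneq t 0; first by rewrite mulr0 expR0 mul1r.
have tp : 0 < t by rewrite lt_neqAle eq_sym tn0.
(* Decay of [f] is monotonicity of [g]. Derivatives are taken at positive times only; at 0 the
   one-sided expansion [cP] supplies continuity. *)
pose g s := expR (2 * m * s) * f s.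
have dE (s : R) : is_derive s (1:R) (fun s => expR (2 * m * s)) (2 * m * expR (2 * m * s)).
  have -> : (fun s => expR (2 * m * s)) = expR \o (fun s => 2 * m * s) by [].
  by apply: is_derive_eq; rewrite /GRing.scale/= mulr1 mulrC.
have df (s : R) : 0 < s -> is_derive s (1:R) f (2 * bt (P s) (W s)).
  move=> s0; apply: is_derive_eps => e e0.
  have [d d0 Hd] := cP s (ltW s0) _ e0.
  exists (Num.min d s); first by rewrite lt_min d0.
  move=> h; rewrite lt_min => /andP[hd hs].
  have := Hd (s + h); rewrite addrAC subrr add0r; apply => //.
  by move: hs; rewrite ltr_norml => /andP[]; lra.
have dg (s : R) : 0 < s -> is_derive s (1:R) g
   (expR (2 * m * s) * (2 * bt (P s) (W s)) + f s * (2 * m * expR (2 * m * s))).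
  move=> s0; have H1 := df s s0; have H2 := dE s.
  exact: is_deriveM.
have gle : g t <= g 0.
  apply: (@ler0_derive1_le_cc R g 0 t) => //.
  - move=> s; rewrite in_itv/= => /andP[s0 _]; by have [] := dg s s0.
  - move=> s; rewrite in_itv/= => /andP[s0 _].
    have H := dg s s0; rewrite derive1E derive_val.
    have := diss s (ltW s0); have := expR_gt0 (2 * m * s); rewrite -/(f s).
    set ex := expR _; set B := bt (P s) (W s); nra.
  - apply/subspace_continuousP => // s /=; rewrite in_itv/= => /andP[s0 st].
    apply: cvgM.
      apply: cvg_within_filter.
      by have /derivable1_diffP/differentiable_continuous := @ex_derive _ _ _ _ _ _ _ (dE s).
    apply/cvgrPdist_le => e e0.
    set A := 2 * bt (P s) (W s) in cP.
    have [d d0 Hd] := cP s s0 1 ltr01.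
    exists (Num.min d (e / (1 + `|2 * bt (P s) (W s)|))).
      by rewrite /= lt_min d0/= divr_gt0// ltr_pwDl.
    move=> r /=; rewrite lt_min distrC => /andP[rd re]; rewrite in_itv/= => /andP[r0 _].
    have := Hd r r0 rd; rewrite mul1r => H.
    rewrite ltr_pdivlMr in re; last by rewrite ltr_pwDl.
    have -> : f s - f r = - (f r - f s - (r - s) * (2 * bt (P s) (W s))) - (r - s) * (2 * bt (P s) (W s)) by ring.
    rewrite (le_trans (ler_normB _ _))// normrN normrM.
    rewrite (le_trans (lerD H (lexx _)))// -{1}[`|r - s|]mulr1 -mulrDr ltW//.
  - by rewrite in_itv/= t0 lexx.
  - by rewrite in_itv/= t0 lexx.
move: gle; rewrite /g mulr0 expR0 mul1r -/(f t) -/(f 0) => gle.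
by rewrite mulNr expRN mulrC ler_pdivlMr ?expR_gt0// mulrC.
Qed.

End paths.

Lemma subrACA4 (V : zmodType) (a b c d : V) : a - b - (c - d) = a - c - (b - d).
Proof. by rewrite !opprD !opprK addrACA. Qed.

Definition lsub {R : realType} {E : lmodType R} (u v : E) : E := u - v.

Definition lincr {R : realType} {E : lmodType R} (k : R) (u v w : E) : E := u - v - k *: w.

Definition lriemann {R : realType} {E : lmodType R} (U : R -> E) (t : R) (V : E) n : E :=
  \sum_(k < n) (t / n%:R) *: U (k%:R * t / n%:R) - V.

Definition linform {R : realType} {E : lmodType R} (X : E -> Prop) (f : E -> R) :=
  forall k u v, X u -> X v -> f (k *: u + v) = k * f u + f v.

(** * Mild solutions of an abstract linear equation *)

Section mild.
Context {R : realType} {E : lmodType R} (X : E -> Prop) (b : E -> E -> R).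
Variable A : E -> E -> Prop.
Hypothesis hX : linsub X.
Hypothesis hb : sip X b.
Hypothesis HA : forall V1 V2 W1 W2, A V1 W1 -> A V2 W2 -> A (V1 - V2) (W1 - W2).

Definition mildlike (U : R -> E) := cpath X b U /\
  forall t : R, 0 <= t -> exists V, integral_of X b U t V /\ A V (U t - U 0).

Lemma nrm_eq0_sub u v w : X u -> X v -> X w -> nrm b (u - w) = 0 -> nrm b (v - w) = 0 ->
  nrm b (u - v) = 0.
Proof.
move=> Xu Xv Xw n1 n2; apply/eqP; rewrite eq_le nrm_ge0 andbT.
have -> : u - v = (u - w) + - (v - w) by rewrite opprB addrA subrK.
have y1 := subB hX Xu Xw; have y2 := subB hX Xv Xw.
by rewrite (le_trans (nrmD hX hb y1 (subN hX y2)))// (nrmN hX hb y2) n1 n2 addr0.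
Qed.

Lemma integral_of_incr (U V : R -> E) (t : R) : 0 <= t ->
  (forall s : R, 0 <= s -> X (U s) /\ X (V s)) -> V 0 = 0 ->
  (forall e : R, 0 < e -> exists2 d : R, 0 < d & forall s r : R, 0 <= s -> s <= r -> r <= t ->
     r - s < d -> nrm b (lincr (r - s) (V r) (V s) (U s)) <= e * (r - s)) ->
  integral_of X b U t (V t).
Proof.
move=> t0 XU V0 H; split; first exact: (XU t t0).2.
have -> : V t = V t - V 0 by rewrite V0 subr0.
apply: (riemann_cvg hX hb t0) => // s /andP[s0 _].
by have [? ?] := XU s s0.
Qed.

Lemma mildlikeB (U1 U2 : R -> E) : mildlike U1 -> mildlike U2 ->
  mildlike (fun t => U1 t - U2 t).
Proof.
move=> [[X1 cU1] i1] [[X2 cU2] i2];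
split.
  split; first by move=> t t0; apply: (subB hX); [exact: X1|exact: X2].
  move=> t0 e t00 e0; have e20 : 0 < e / 2 by rewrite divr_gt0.
  have [d1 d10 H1] := cU1 _ _ t00 e20; have [d2 d20 H2] := cU2 _ _ t00 e20.
  exists (Num.min d1 d2); first by rewrite lt_min d10.
  move=> t t0'; rewrite lt_min => /andP[td1 td2].
  rewrite subrACA4.
  have x1 := subB hX (X1 t t0') (X1 t0 t00); have x2 := subB hX (X2 t t0') (X2 t0 t00).
  rewrite (le_lt_trans (nrmD hX hb x1 (subN hX x2)))// (nrmN hX hb x2) (splitr e).
  by apply: ltrD; [exact: H1|exact: H2].
move=> t t0; have [V1 [[XV1 iV1] gV1]] := i1 t t0; have [V2 [[XV2 iV2] gV2]] := i2 t t0.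
exists (V1 - V2); split.
  split; first exact: (subB hX).
  apply/cvgrPdist_lt => e e0; have e20 : 0 < e / 2 by rewrite divr_gt0.
  move/cvgrPdist_lt/(_ _ e20) : iV1 => iV1; move/cvgrPdist_lt/(_ _ e20) : iV2 => iV2.
  apply: filterS2 iV1 iV2 => n.
  rewrite !sub0r !normrN !(ger0_norm (nrm_ge0 _ _)) => h1 h2.
  have pt (i : 'I_n) : 0 <= i%:R * t / n%:R by rewrite divr_ge0// mulr_ge0.
  have y1 := sub_sum hX (fun i : 'I_n => subZ hX (t / n%:R) (X1 _ (pt i))).
  have y2 := sub_sum hX (fun i : 'I_n => subZ hX (t / n%:R) (X2 _ (pt i))).
  rewrite (eq_bigr (fun i : 'I_n => (t / n%:R) *: U1 (i%:R * t / n%:R) - (t / n%:R) *: U2 (i%:R * t / n%:R))); last first.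
    by move=> i _; rewrite scalerBr.
  rewrite sumrB subrACA4.
  have y1' := subB hX y1 XV1; have y2' := subB hX y2 XV2.
  rewrite (le_lt_trans (nrmD hX hb y1' (subN hX y2')))// (nrmN hX hb y2') (splitr e).
  by rewrite ltrD.
have := HA gV1 gV2.
by rewrite subrACA4.
Qed.

(** Applied to the first-order expansion of [V] at [t], the functional kills the increment and
    leaves [f (U t)] bounded by an arbitrarily small error. This carries the compatibility
    conditions from the integrals, which lie in the domain, to the solution. *)
Lemma linf_C1path0 (f : E -> R) (C : R) (V U : R -> E) :
  linform X f -> 0 <= C -> (forall W, X W -> `|f W| <= C * nrm b W) ->
  (forall t : R, 0 <= t -> X (V t)) -> (forall t : R, 0 <= t -> X (U t)) -> diffpath b V U ->
  (forall t : R, 0 <= t -> f (V t) = 0) ->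
  forall t : R, 0 <= t -> f (U t) = 0.
Proof.
move=> lf C0 fC XV XU dV fV t t0.
have fN W : X W -> f (- W) = - f W.
  move=> XW; have f0 : f 0 = 0.
    by have := lf (-1) _ _ hX.1 hX.1; rewrite scaleN1r oppr0 addr0 => h; lra.
  by have := lf (-1) _ _ XW hX.1; rewrite scaleN1r addr0 f0 => ->; lra.
have fD W W' : X W -> X W' -> f (W + W') = f W + f W'.
  by move=> XW XW'; have := lf 1 _ _ XW XW'; rewrite scale1r mul1r.
have fZ k W : X W -> f (k *: W) = k * f W.
  move=> XW; have := lf k _ _ XW (subZ hX 0 XW); rewrite scale0r addr0 => ->.
  by have := lf (-1) _ _ hX.1 hX.1; rewrite scaleN1r oppr0 addr0; lra.
apply/eqP; rewrite -normr_le0; apply/ler_addgt0Pl => e e0; rewrite addr0.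
have e1 : 0 < e / (C + 1) by rewrite divr_gt0// ltr_wpDl.
have [d d0 Hd] := dV t t0 _ e1.
pose s := t + d / 2.
have s0 : 0 <= s by rewrite addr_ge0// divr_ge0// ltW.
have stE : s - t = d / 2 by rewrite /s addrAC subrr add0r.
have std : `|s - t| = d / 2 by rewrite stE gtr0_norm// divr_gt0.
have dd : d / 2 < d by rewrite ltr_pdivrMr// ltr_pMr// ltr1n.
have := Hd s s0; rewrite std stE => /(_ dd) H.
have xs := XV s s0; have xt := XV t t0; have ut := XU t t0.
have xD := subB hX xs xt; have xZ := subZ hX (d / 2) ut.
have := fC _ (subB hX xD xZ).
rewrite fD//; last exact: subN.
rewrite (fD _ _ xs (subN hX xt)) !fN// (fV s s0) (fV t t0) subr0 sub0r fZ// normrN normrM.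
rewrite gtr0_norm ?divr_gt0// => H2.
have d20 : 0 < d / 2 by rewrite divr_gt0.
rewrite -(ler_pM2l d20) (le_trans H2)//.
apply: (@le_trans _ _ (C * (e / (C + 1) * (d / 2)))); first exact: ler_wpM2l.
rewrite mulrCA mulrA mulrC ler_pM2l// mulrC mulrA [C * e]mulrC -mulrA ger_pMr//.
by rewrite ler_pdivrMr ?mul1r ?lerDl// ltr_wpDl.
Qed.


Lemma diffpath_incr (V U : R -> E) (h : R) : 0 <= h ->
  (forall t : R, 0 <= t -> X (V t)) -> (forall t : R, 0 <= t -> X (U t)) ->
  diffpath b V U -> diffpath b (fun t => V (t + h) - V t) (fun t => U (t + h) - U t).
Proof.
move=> h0 XV XU D t t0 e e0; have e20 : 0 < e / 2 by rewrite divr_gt0.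
have th0 := addr_ge0 t0 h0.
have [d1 d10 H1] := D _ th0 _ e20; have [d2 d20 H2] := D _ t0 _ e20.
exists (Num.min d1 d2); first by rewrite lt_min d10.
move=> s s0; rewrite lt_min => /andP[s1 s2].
have sh0 := addr_ge0 s0 h0.
have E1 : s + h - (t + h) = s - t by rewrite opprD addrACA subrr addr0.
have := H1 _ sh0; rewrite E1 => /(_ s1) {}H1.
have {}H2 := H2 _ s0 s2.
rewrite scalerBr (subrACA4 (V (s + h)) (V s)) (subrACA4 (V (s + h) - V (t + h))).
have y1 := subB hX (subB hX (XV _ sh0) (XV _ th0)) (subZ hX (s - t) (XU _ th0)).
have y2 := subB hX (subB hX (XV _ s0) (XV _ t0)) (subZ hX (s - t) (XU _ t0)).
rewrite (le_trans (nrmD hX hb y1 (subN hX y2)))// (nrmN hX hb y2).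
by rewrite (le_trans (lerD H1 H2))// -mulrDl -splitr.
Qed.

(** [fs] holds the compatibility functionals. They vanish on the domain, hence on [U] by
    [linf_C1path0], hence on [U (t + h) - U t], which is both the derivative and the image under [A]
    of [V (t + h) - V t]; dissipation is assumed only for such images. *)
Lemma mildlike_decay (bt : E -> E -> R) (m c C K : R) (fs : seq (E -> R)) :
  sip X bt -> 0 < m -> 0 < c -> 0 < C -> 0 <= K ->
  (forall u, X u -> c * b u u <= bt u u <= C * b u u) ->
  (forall f, List.In f fs -> linform X f /\ forall u, X u -> `|f u| <= K * nrm b u) ->
  (forall V W f, A V W -> List.In f fs -> f V = 0) ->
  (forall V W, X W -> A V W -> (forall f, List.In f fs -> f W = 0) ->
     bt V W <= - m * bt V V) ->
  exists2 M : R, 0 < M & forall U, mildlike U -> forall t : R, 0 <= t ->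
    nrm b (U t) <= M * expR (- m * t) * nrm b (U 0).
Proof.
move=> hbt m0 c0 C0 K0 Hbt Hfs Afs diss.
(* The energy estimate holds for [bt]; passing from [b] to [bt] and back costs the ratio of the
   equivalence constants. *)
pose M := Num.sqrt (C / c).
have M0 : 0 < M by rewrite sqrtr_gt0 divr_gt0.
exists M => // U [cU iU].
pose V t := xget 0 [set W | integral_of X b U t W /\ A W (U t - U 0)].
have VP (t : R) : 0 <= t -> integral_of X b U t (V t) /\ A (V t) (U t - U 0).
  by move=> t0; have := iU t t0; move/(xgetPex 0).
have XU := cU.1.
have XV (t : R) (t0 : 0 <= t) : X (V t) := (VP t t0).1.1.
have dV : diffpath b V U.
  move=> t t0 e e0; apply: (C1path_diff hX hb cU XV _ t0 e0).
  exact: (integral_of_C1 hX hb cU (fun t t0 => (VP t t0).1)).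
have fU f : List.In f fs -> forall t : R, 0 <= t -> f (U t) = 0.
  move=> ff; have [lf Kf] := Hfs _ ff.
  apply: (linf_C1path0 lf K0 Kf XV XU dV) => t t0.
  exact: (Afs _ _ _ (VP t t0).2 ff).
have fB f : List.In f fs -> forall u v, X u -> X v -> f u = 0 -> f v = 0 -> f (u - v) = 0.
  move=> ff u v Xu Xv fu fv; have [lf _] := Hfs _ ff.
  by have := lf (-1) _ _ Xv Xu; rewrite fu fv mulr0 addr0 scaleN1r addrC.
(* [V 0] has seminorm 0 but need not be 0, so the difference [V h - V 0] is kept. *)
have step (h t : R) : 0 <= h -> 0 <= t ->
    nrm b (V (t + h) - V t) <= M * expR (- m * t) * nrm b (V h - V 0).
  move=> h0 t0.
  have XW (s : R) : 0 <= s -> X (V (s + h) - V s) /\ X (U (s + h) - U s).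
    by move=> s0; split; apply: (subB hX); do ?[exact: XV|exact: XU]; [apply: XV|apply: XU]; exact: addr_ge0.
  have := C1path_decay hX hb hbt (_ : 0 < Num.sqrt C) _ XW (diffpath_incr h0 XV XU dV) _ t0.
  rewrite sqrtr_gt0 sqr_sqrtr ?(ltW C0)// add0r => H.
  have {}H := H m C0 (fun u Xu => (elimTF andP (Hbt u Xu)).2).
  have {}H : bt (V (t + h) - V t) (V (t + h) - V t) <=
      expR (- (2 * m) * t) * bt (V h - V 0) (V h - V 0).
    apply: H => s s0; have sh := addr_ge0 s0 h0.
    apply: diss; first by have [] := XW s s0.
      have := HA (VP _ sh).2 (VP _ s0).2.
      by rewrite subrACA4 subrr subr0.
    by move=> f ff; apply: (fB _ ff); do ?[exact: XU|exact: fU].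
  have X1 := (XW t t0).1; have X0 := (XW 0 (lexx _)).1; rewrite add0r in X0.
  have /andP[a1 _] := Hbt _ X1; have /andP[_ a2] := Hbt _ X0.
  rewrite -(ler_pXn2r (ltn0Sn 1)) ?nnegrE ?mulr_ge0 ?nrm_ge0 ?expR_ge0 ?(ltW M0)//.
  rewrite !exprMn (nrm_sqr hb X1) (nrm_sqr hb X0) sqr_sqrtr ?divr_ge0 ?(ltW C0) ?(ltW c0)//.
  rewrite -expRM_natl.
  rewrite -(ler_pM2l c0) (le_trans a1)// (le_trans H)//.
  rewrite (_ : - (2 * m) * t = 2 * (- m * t)); last by ring.
  apply: (le_trans (ler_wpM2l (expR_ge0 _) a2)).
  rewrite le_eqVlt; apply/orP; left; apply/eqP; field.
  by rewrite gt_eqF.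
move=> t t0.
pose L := M * expR (- m * t).
have L0 : 0 <= L by rewrite mulr_ge0 ?expR_ge0// ltW.
apply/ler_addgt0Pl => e e0.
have e1 : 0 < e / (L + 1) by rewrite divr_gt0// ltr_wpDl.
have [d1 d10 H1] := dV t t0 _ e1; have [d2 d20 H2] := dV 0 (lexx _) _ e1.
(* One [h] serves the expansions at [t] and at 0. Their errors, the second multiplied by [L], add up
   to [e * h]. *)
pose h := Num.min d1 d2 / 2.
have h0 : 0 < h by rewrite divr_gt0// lt_min d10.
have [hd1 hd2] : h < d1 /\ h < d2.
  have hh : h < Num.min d1 d2 by rewrite ltr_pdivrMr// ltr_pMr ?ltr1n// lt_min d10.
  by move: hh; rewrite lt_min => /andP.
have th0 : 0 <= t + h by rewrite addr_ge0// ltW.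
have thE : t + h - t = h by rewrite addrAC subrr add0r.
have := H1 _ th0; rewrite thE gtr0_norm// => /(_ hd1) {}H1.
have := H2 _ (ltW h0); rewrite subr0 gtr0_norm// => /(_ hd2) {}H2.
have st := step _ _ (ltW h0) t0.
have Xt := XU t t0; have X0 := XU 0 (lexx _).
have y1 := subB hX (XV _ th0) (XV _ t0); have y2 := subB hX (XV _ (ltW h0)) (XV 0 (lexx _)).
have z1 := subZ hX h Xt; have z2 := subZ hX h X0.
have g1 : h * nrm b (U t) <= nrm b (V (t + h) - V t) + e / (L + 1) * h.
  rewrite -[h in leLHS]gtr0_norm// -(nrmZ hX hb)//.
  rewrite -[h *: U t](subrK (V (t + h) - V t)) addrC.
  rewrite (le_trans (nrmD hX hb y1 (subB hX z1 y1)))// lerD2l.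
  by rewrite (nrmB hX hb z1 y1).
have g2 : nrm b (V h - V 0) <= h * nrm b (U 0) + e / (L + 1) * h.
  rewrite -[X in _ <= X * _ + _]gtr0_norm// -(nrmZ hX hb)//.
  rewrite -[V h - V 0](subrK (h *: U 0)) addrC.
  by rewrite (le_trans (nrmD hX hb z2 (subB hX y2 z2)))// lerD2l.
rewrite -(ler_pM2l h0).
apply: (le_trans g1).
have g3 := ler_wpM2l L0 g2.
rewrite -/L in st *.
rewrite (le_trans (lerD (le_trans st g3) (lexx _)))//.
rewrite le_eqVlt; apply/orP; left; apply/eqP; field.
by rewrite gt_eqF// ltr_wpDl.
Qed.

End mild.

(** * The state space *)

Section state_space.
Context {R : realType}.
Notation mu := (@lebesgue_measure R).
Notation state := (state R).
Notation fct := (fct R).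
Notation "''I01' f" := (intg 0 1 f) (at level 10, f at level 8).

Lemma L2E (f : fct) : L2 f <-> L2on 0 1 (f : R -> R).
Proof. by []. Qed.

Lemma deriv_ofP (f : fct) : H1 f -> prim 0 1 (f : R -> R) (deriv_of f).
Proof. by move=> H1f; apply: (xgetPex (0 : fct) H1f). Qed.

Lemma prim_uniq (a b : R) (F f g : R -> R) : a <= b -> prim a b F f -> prim a b F g ->
  intg a b (fun x => (f x - g x) ^+ 2) = 0.
Proof.
move=> ab Hf Hg; apply: int_sqr_uniq => //.
  move=> x /andP[ax xb]; rewrite intB.
  - by rewrite -(prim_diff Hf)// -(prim_diff Hg)// subrr.
  - by apply: L1on_sub (L2on_L1 (prim_L2 Hf)) _ _.
  - by apply: L1on_sub (L2on_L1 (prim_L2 Hg)) _ _.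
exact: L2onB (prim_L2 Hf) (prim_L2 Hg).
Qed.

Lemma int_mul0 (a b : R) (f h : R -> R) : L2on a b f -> L2on a b h ->
  intg a b (fun x => f x ^+ 2) = 0 -> intg a b (fun x => f x * h x) = 0.
Proof.
move=> lf lh f0; apply/eqP; rewrite -sqrf_eq0 eq_le sqr_ge0 andbT.
by rewrite (le_trans (int_CS lf lh))// f0 mul0r.
Qed.

Lemma int_eq_mod (a b : R) (f g h : R -> R) : L2on a b f -> L2on a b g ->
  L2on a b h -> intg a b (fun x => (f x - g x) ^+ 2) = 0 ->
  intg a b (fun x => f x * h x) = intg a b (fun x => g x * h x).
Proof.
move=> lf lg lh f0; apply/eqP; rewrite -subr_eq0 -intB ?L2on_mul//; apply/eqP.
rewrite -[RHS](int_mul0 (L2onB lf lg) lh f0).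
by apply: eq_int => x _; rewrite mulrBl.
Qed.

(** [deriv_of f] and [g] may differ on a null set, which is invisible under an integral. *)
Lemma int_deriv_of (f g : fct) (h : R -> R) : prim 0 1 (f : R -> R) g ->
  L2on 0 1 h -> 'I01 (fun x => deriv_of f x * h x) = 'I01 (fun x => g x * h x).
Proof.
move=> Hf lh; have Hd : prim 0 1 (f : R -> R) (deriv_of f).
  by apply: deriv_ofP; exists g.
by apply: int_eq_mod (prim_L2 Hd) (prim_L2 Hf) lh (prim_uniq ler01 Hd Hf).
Qed.

Lemma L2normsqE (f : fct) : L2normsq f = 'I01 (fun x => f x ^+ 2).
Proof. by []. Qed.

Lemma L2normsq_ge0 (f : fct) : 0 <= L2normsq f.
Proof. exact: int_sqr_ge0. Qed.

Lemma H1normsqE (f g : fct) : prim 0 1 (f : R -> R) g ->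
  H1normsq f = L2normsq f + L2normsq g.
Proof.
move=> Hf; congr (_ + _); rewrite !L2normsqE.
have Hd : prim 0 1 (f : R -> R) (deriv_of f) by apply: deriv_ofP; exists g.
transitivity ('I01 (fun x => deriv_of f x * g x)).
  rewrite -[RHS](_ : 'I01 (fun x => g x * deriv_of f x) = _); last first.
    by apply: eq_int => x _; rewrite mulrC.
  rewrite -(int_deriv_of Hf (prim_L2 Hd)).
  by apply: eq_int => x _; rewrite expr2.
rewrite (int_deriv_of Hf (prim_L2 Hf)).
by apply: eq_int => x _; rewrite expr2.
Qed.

Definition l2ip (f g : fct) : R := 'I01 (fun x => f x * g x).
Definition h1ip (f g : fct) : R := l2ip f g + l2ip (deriv_of f) (deriv_of g).

Lemma l2ipC f g : l2ip f g = l2ip g f.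
Proof. by apply: eq_int => x _; rewrite mulrC. Qed.

Lemma l2ip_lin k (f g h : fct) : L2on 0 1 (f : R -> R) -> L2on 0 1 (g : R -> R) ->
  L2on 0 1 (h : R -> R) -> l2ip (k *: f + g) h = k * l2ip f h + l2ip g h.
Proof.
move=> lf lg lh; rewrite /l2ip -intZ ?L2on_mul// -intD ?L1onZ ?L2on_mul//.
by apply: eq_int => x _; rewrite mulrA -mulrDl.
Qed.

Lemma L2on_lin (a b : R) k (f g : fct) : L2on a b (f : R -> R) -> L2on a b (g : R -> R) ->
  L2on a b (k *: f + g : fct).
Proof. by move=> lf lg; exact: (L2onD (L2onZ k lf) lg). Qed.

Lemma prim_lin (a b : R) k (F f G g : fct) : prim a b (F : R -> R) f -> prim a b (G : R -> R) g ->
  prim a b (k *: F + G : fct) (k *: f + g : fct).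
Proof. by move=> Hf Hg; exact: (primD (primZ k Hf) Hg). Qed.

Lemma H1_lin k (f g : fct) : H1 f -> H1 g -> H1 (k *: f + g).
Proof.
by move=> [f' Hf] [g' Hg]; exists (k *: f' + g'); apply: prim_lin.
Qed.

Lemma deriv_of_lin k (f g h : fct) : H1 f -> H1 g -> L2on 0 1 (h : R -> R) ->
  l2ip (deriv_of (k *: f + g)) h = k * l2ip (deriv_of f) h + l2ip (deriv_of g) h.
Proof.
move=> Hf Hg lh; have df := deriv_ofP Hf; have dg := deriv_ofP Hg.
rewrite -l2ip_lin ?(prim_L2 df) ?(prim_L2 dg)//; [|exact: prim_L2 df|exact: prim_L2 dg].
by apply: int_deriv_of => //; apply: prim_lin.
Qed.

Lemma h1ipC f g : h1ip f g = h1ip g f.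
Proof. by rewrite /h1ip l2ipC [X in _ + X]l2ipC. Qed.

Lemma H1_L2 (f : fct) : H1 f -> L2on 0 1 (f : R -> R).
Proof. by move=> [g Hg]; exact: prim_L2on Hg. Qed.

Lemma deriv_of_L2 (f : fct) : H1 f -> L2on 0 1 (deriv_of f : R -> R).
Proof. by move=> /deriv_ofP/prim_L2. Qed.

Lemma h1ip_lin k (f g h : fct) : H1 f -> H1 g -> H1 h ->
  h1ip (k *: f + g) h = k * h1ip f h + h1ip g h.
Proof.
move=> Hf Hg Hh; rewrite /h1ip l2ip_lin ?deriv_of_lin; try exact: H1_L2; last first.
- exact: deriv_of_L2.
- by [].
- by [].
by ring.
Qed.

Lemma l2ip_ge0 f : 0 <= l2ip f f.
Proof. by apply: int_ge0 => x _; rewrite -expr2 sqr_ge0. Qed.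

Lemma l2ip_sqr f : l2ip f f = L2normsq f.
Proof. by apply: eq_int => x _; rewrite expr2. Qed.

Local Ltac gen_ip :=
  repeat match goal with |- context [h1ip ?a ?b] => move: (h1ip a b) => ? end;
  repeat match goal with |- context [l2ip ?a ?b] => move: (l2ip a b) => ? end.

(** Polarisation of the squared norm. *)
Definition bX (U V : state) : R :=
  let: (eps, eps', Y, z, z', w, w', Z) := U in
  let: (feps, feps', fY, fz, fz', fw, fw', fZ) := V in
  h1ip eps feps + l2ip eps' feps' + h1ip Y fY + h1ip z fz
            + l2ip z' fz' + h1ip w fw + l2ip w' fw' + h1ip Z fZ.

Lemma normXE (U : state) : normX U = nrm bX U.
Proof.
by case: U => [[[[[[[e e'] Y] z] z'] w] w'] Z]; rewrite /nrm /bX /h1ip !l2ip_sqr.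
Qed.

Lemma state_lin k (e e' Y z z' w w' Z f f' fY fz fz' fw fw' fZ : fct) :
  k *: ((e, e', Y, z, z', w, w', Z) : state) + (f, f', fY, fz, fz', fw, fw', fZ) =
  (k *: e + f, k *: e' + f', k *: Y + fY, k *: z + fz, k *: z' + fz',
   k *: w + fw, k *: w' + fw', k *: Z + fZ).
Proof. by []. Qed.

(* The operations of [state], as found by unification for a product and as
   inherited from a generic left module, are convertible but slow to compare:
   the constants [lsub], [lincr] and [lriemann] mark the latter. *)
Lemma lsub_tuple (e e' Y z z' w w' Z f f' fY fz fz' fw fw' fZ : fct) :
  lsub ((e, e', Y, z, z', w, w', Z) : state) (f, f', fY, fz, fz', fw, fw', fZ) =
  (e - f, e' - f', Y - fY, z - fz, z' - fz', w - fw, w' - fw', Z - fZ).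
Proof. by []. Qed.

Lemma lincr_tuple k (e e' Y z z' w w' Z f f' fY fz fz' fw fw' fZ g g' gY gz gz' gw gw' gZ : fct) :
  lincr k ((e, e', Y, z, z', w, w', Z) : state) (f, f', fY, fz, fz', fw, fw', fZ)
    (g, g', gY, gz, gz', gw, gw', gZ) =
  (e - f - k *: g, e' - f' - k *: g', Y - fY - k *: gY, z - fz - k *: gz,
   z' - fz' - k *: gz', w - fw - k *: gw, w' - fw' - k *: gw', Z - fZ - k *: gZ).
Proof. by []. Qed.

Lemma state_lsub (U V : state) : U - V = lsub U V.
Proof.
case: U => [[[[[[[e e'] Y] z] z'] w] w'] Z]; case: V => [[[[[[[f f'] fY] fz] fz'] fw] fw'] fZ].
by rewrite lsub_tuple.
Qed.

Lemma state_lriemann (U : R -> state) (t : R) V n :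
  \sum_(k < n) (t / n%:R) *: U (k%:R * t / n%:R) - V = lriemann U t V n.
Proof. by rewrite state_lsub /lriemann -/(lsub _ V); congr (lsub _ V). Qed.

Lemma normXB (U V : state) : normX (U - V) = nrm bX (lsub U V).
Proof. by rewrite state_lsub; exact: normXE. Qed.

Lemma state0 : 0 = ((0, 0, 0, 0, 0, 0, 0, 0) : state).
Proof. by []. Qed.

Lemma fct_linE k (f g : fct) x : (k *: f + g) x = k * f x + g x.
Proof. by []. Qed.

Lemma inX_linsub : linsub (@inX R).
Proof.
have H10 : H1 (0 : fct) by exists 0; exact: (prim_cst 0 1 0).
have L20 : L2 (0 : fct) by exact: (L2on_cst 0 1 0).
split; first by rewrite state0; split.
move=> k [[[[[[[e e'] Y] z] z'] w] w'] Z] [[[[[[[f f'] fY] fz] fz'] fw] fw'] fZ].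
rewrite state_lin.
move=> [[a1 a2] a3 [[a4 a4'] a5] [a6 a7] a8] [[b1 b2] b3 [[b4 b4'] b5] [b6 b7] b8].
have c1 := H1_lin k a1 b1; have c2 := L2on_lin k a2 b2.
have c3 := H1_lin k a3 b3; have c4 := H1_lin k a4 b4.
have c5 := L2on_lin k a5 b5; have c6 := H1_lin k a6 b6.
have c7 := L2on_lin k a7 b7; have c8 := H1_lin k a8 b8.
have c4' : (k *: z + fz) 1 = 0 by rewrite fct_linE a4' b4' mulr0 addr0.
by split.
Qed.

Lemma bX_sip : sip (@inX R) bX.
Proof.
split.
- move=> [[[[[[[e e'] Y] z] z'] w] w'] Z] [[[[[[[f f'] fY] fz] fz'] fw] fw'] fZ] _ _.
  by rewrite /bX h1ipC (l2ipC e') (h1ipC Y) (h1ipC z) (l2ipC z') (h1ipC w) (l2ipC w') (h1ipC Z).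
- move=> k [[[[[[[e e'] Y] z] z'] w] w'] Z] [[[[[[[f f'] fY] fz] fz'] fw] fw'] fZ]
     [[[[[[[g g'] gY] gz] gz'] gw] gw'] gZ].
  rewrite state_lin.
  move=> [[a1 a2] a3 [[a4 _] a5] [a6 a7] a8] [[b1 b2] b3 [[b4 _] b5] [b6 b7] b8].
  move=> [[d1 d2] d3 [[d4 _] d5] [d6 d7] d8].
  rewrite /bX.
  rewrite (h1ip_lin k a1 b1 d1) (l2ip_lin k a2 b2 d2) (h1ip_lin k a3 b3 d3)
    (h1ip_lin k a4 b4 d4) (l2ip_lin k a5 b5 d5) (h1ip_lin k a6 b6 d6)
    (l2ip_lin k a7 b7 d7) (h1ip_lin k a8 b8 d8).
  by gen_ip; ring.
- move=> [[[[[[[e e'] Y] z] z'] w] w'] Z] _.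
  by rewrite /bX /h1ip !addr_ge0// l2ip_ge0.
Qed.

Lemma trace_sqr (f g : R -> R) (x y : R) : prim 0 1 f g -> 0 <= x <= 1 -> 0 <= y <= 1 ->
  (f x - f y) ^+ 2 <= 'I01 (fun s => g s ^+ 2).
Proof.
move=> H.
wlog xy : x y / x <= y.
  move=> W hx hy; have [xy|yx] := leP x y; first exact: W.
  by rewrite -sqrrN opprB; apply: W => //; exact: ltW.
move=> /andP[x0 x1] /andP[y0 y1].
rewrite -sqrrN opprB (le_trans (prim_sqr_diff H x0 xy y1))//.
apply: (@le_trans _ _ (1 * intg x y (fun s => g s ^+ 2))).
  rewrite ler_wpM2r ?int_sqr_ge0//; lra.
rewrite mul1r; apply: int_mono => //; first exact: L2on_sqr (prim_L2 H).
by move=> ? _; exact: sqr_ge0.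
Qed.

(** Average over [y] in [[0, 1]] the bound of [f x ^+ 2] by
    [2 * f y ^+ 2 + 2 * (f x - f y) ^+ 2]. *)
Lemma trace_L2 (f g : R -> R) (x : R) : prim 0 1 f g -> 0 <= x <= 1 ->
  f x ^+ 2 <= 2 * 'I01 (fun s => f s ^+ 2) + 2 * 'I01 (fun s => g s ^+ 2).
Proof.
move=> H x01; have lf := prim_L2on H.
have -> : f x ^+ 2 = 'I01 (fun=> f x ^+ 2) by rewrite int_cst// subr0 mulr1.
have -> : 2 * 'I01 (fun s => g s ^+ 2) = 'I01 (fun=> 2 * 'I01 (fun s => g s ^+ 2)).
  by rewrite int_cst// subr0 mulr1.
rewrite -intZ ?L2on_sqr// -intD; [|exact/L1onZ/L2on_sqr|exact: L1on_cst].
apply: le_int; first exact: L1on_cst.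
  by apply: L1onD; [exact/L1onZ/L2on_sqr|exact: L1on_cst].
move=> y y01; have := trace_sqr H x01 y01.
by have := sqr_ge0 (f x - 2 * f y); nra.
Qed.

Lemma L2_trace0 (f g : R -> R) : prim 0 1 f g ->
  'I01 (fun s => f s ^+ 2) <= 2 * f 0 ^+ 2 + 2 * 'I01 (fun s => g s ^+ 2).
Proof.
move=> H; have lf := prim_L2on H.
have -> : 2 * f 0 ^+ 2 + 2 * 'I01 (fun s => g s ^+ 2) =
   'I01 (fun=> 2 * f 0 ^+ 2 + 2 * 'I01 (fun s => g s ^+ 2)).
  by rewrite int_cst// subr0 mulr1.
apply: le_int; [exact: L2on_sqr|exact: L1on_cst|].
move=> y y01; have := trace_sqr H y01 (_ : 0 <= 0 <= 1).
rewrite lexx ler01 => /(_ isT); have := sqr_ge0 (f y - 2 * f 0); nra.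
Qed.

(** Equality at every point, not just almost everywhere, because [trace_L2] controls each value of
    the continuous representative. *)
Lemma H1norm0 (g h : fct) : H1 g -> H1 h -> H1normsq (g - h) = 0 -> eqH1 g h.
Proof.
move=> Hg Hh; have [k Hk] : H1 (g - h) by rewrite addrC -scaleN1r; exact: H1_lin.
rewrite (H1normsqE Hk) => E x x01.
have := trace_L2 Hk x01.
move: E; rewrite !L2normsqE => E; rewrite -mulrDr E mulr0 => h0.
by apply/eqP; rewrite -subr_eq0 -sqrf_eq0 eq_le sqr_ge0 andbT; exact: h0.
Qed.

Lemma L2norm0 (g h : fct) : L2 g -> L2 h -> L2normsq (g - h) = 0 -> eqL2 g h.
Proof.
move=> lg lh E.
have l : L2on 0 1 (g - h : fct) by exact: (L2onB lg lh).
have := L2on_sqr l; set k := fun x => _ => lk.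
have ik : (\int[mu]_(x in `[0%R, 1%R]) `|(k x)%:E| = 0)%E.
  under eq_integral do rewrite gee0_abs ?lee_fin ?sqr_ge0//.
  rewrite -[LHS]fineK; last exact: integrable_fin_num.
  by congr (_%:E); exact: E.
have [+ _] := ae_eq_integral_abs mu (measurable_itv _) (measurable_int _ lk).
move=> /(_ ik); apply: (@filterS _ _ (ae_filter_ringOfSetsType mu)) => x /= H x01.
have := H; rewrite in_itv/= => /(_ x01) [] /eqP.
by rewrite sqrf_eq0 subr_eq0 => /eqP.
Qed.

Lemma L2norm_ae0 (g h : fct) : L2 g -> L2 h -> eqL2 g h -> L2normsq (g - h) = 0.
Proof.
move=> lg lh E; have l : L2on 0 1 (g - h : fct) by exact: (L2onB lg lh).
rewrite /L2normsq /Rintegral (ae_eq_integral (cst 0)) ?integral0//.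
- exact: (measurable_int mu (L2on_sqr l)).
- apply: (@filterS _ _ (ae_filter_ringOfSetsType mu) _ _ _ E) => x /= hx.
  rewrite in_itv/= => /hx h0.
  by rewrite [X in X ^+ 2](_ : _ = g x - h x)// h0 subrr expr0n.
Qed.

Lemma H1norm_eq0 (g h : fct) : H1 g -> H1 h -> eqH1 g h -> H1normsq (g - h) = 0.
Proof.
move=> Hg Hh E.
have H0 : prim 0 1 (g - h : fct) (0 : fct).
  apply: (@eq_prim _ _ _ (fun=> 0) (fun=> 0)) (prim_cst 0 1 0) => // x x01.
  by rewrite [RHS](_ : _ = g x - h x)// E// subrr.
rewrite (H1normsqE H0) !L2normsqE.
rewrite (@eq_int _ 0 1 _ (fun=> 0)); last first.
  by move=> x x01; rewrite [X in X ^+ 2](_ : _ = g x - h x)// E// subrr expr0n.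
rewrite [X in _ + X](@eq_int _ 0 1 _ (fun=> 0)); last by move=> x _; rewrite expr0n.
by rewrite int_cst// mul0r addr0.
Qed.

Lemma H1normsq_ge0 (f : fct) : 0 <= H1normsq f.
Proof. by rewrite addr_ge0// L2normsq_ge0. Qed.

Lemma sum8_eq0 (x1 x2 x3 x4 x5 x6 x7 x8 : R) :
  0 <= x1 -> 0 <= x2 -> 0 <= x3 -> 0 <= x4 -> 0 <= x5 -> 0 <= x6 -> 0 <= x7 -> 0 <= x8 ->
  x1 + x2 + x3 + x4 + x5 + x6 + x7 + x8 <= 0 ->
  [/\ x1 = 0 /\ x2 = 0, x3 = 0, x4 = 0 /\ x5 = 0, x6 = 0 /\ x7 = 0 & x8 = 0].
Proof. by move=> *; split; try split; lra. Qed.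

Lemma normX0_eqX (U V : state) : inX U -> inX V -> normX (U - V) = 0 -> eqX U V.
Proof.
case: U => [[[[[[[e e'] Y] z] z'] w] w'] Z]; case: V => [[[[[[[f f'] fY] fz] fz'] fw] fw'] fZ].
move=> [[a1 a2] a3 [[a4 _] a5] [a6 a7] a8] [[b1 b2] b3 [[b4 _] b5] [b6 b7] b8].
rewrite /normX /= => /eqP; rewrite sqrtr_eq0 => H.
have := sum8_eq0 (H1normsq_ge0 _) (L2normsq_ge0 _) (H1normsq_ge0 _) (H1normsq_ge0 _)
  (L2normsq_ge0 _) (H1normsq_ge0 _) (L2normsq_ge0 _) (H1normsq_ge0 _) H.
move=> [[n1 n2] n3 [n4 n5] [n6 n7] n8].
split.
- by split; [exact: (H1norm0 a1 b1 n1)|exact: (L2norm0 a2 b2 n2)].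
- exact: (H1norm0 a3 b3 n3).
- by split; [exact: (H1norm0 a4 b4 n4)|exact: (L2norm0 a5 b5 n5)].
- by split; [exact: (H1norm0 a6 b6 n6)|exact: (L2norm0 a7 b7 n7)].
- exact: (H1norm0 a8 b8 n8).
Qed.

Lemma eqX_normX0 (U V : state) : inX U -> inX V -> eqX U V -> normX (U - V) = 0.
Proof.
case: U => [[[[[[[e e'] Y] z] z'] w] w'] Z]; case: V => [[[[[[[f f'] fY] fz] fz'] fw] fw'] fZ].
move=> [[a1 a2] a3 [[a4 _] a5] [a6 a7] a8] [[b1 b2] b3 [[b4 _] b5] [b6 b7] b8].
move=> [[e1 e2] e3 [e4 e5] [e6 e7] e8].
rewrite /normX /= (H1norm_eq0 a1 b1 e1) (L2norm_ae0 a2 b2 e2) (H1norm_eq0 a3 b3 e3)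
 (H1norm_eq0 a4 b4 e4) (L2norm_ae0 a5 b5 e5) (H1norm_eq0 a6 b6 e6)
 (L2norm_ae0 a7 b7 e7) (H1norm_eq0 a8 b8 e8) !addr0 sqrtr0//.
Qed.

End state_space.

(** * The Lyapunov form *)

Section lyapunov_scalars.
Context {R : realType}.
Implicit Types (a b c d e s p n : R).

Lemma sqr_le_double a b c : (a - b) ^+ 2 <= c -> b ^+ 2 <= 2 * a ^+ 2 + 2 * c.
Proof. by have := sqr_ge0 (2 * a - b); nra. Qed.

(** In the application [s] and [p] are the traces at 0 of the wave and of its velocity, [E] is the
    energy, [I] the cross term with weight [1 - x], and [n] an integral of the velocity. The first
    estimate is coercivity, the second dissipation: [- b * p ^+ 2] is the boundary damping, the
    terms in [d] come from the multiplier, those in [e] from the trace functional. [a'] is [a] for v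
    and [a + 1] for z. *)
Lemma damping_scalars a b : 0 < a -> 0 < b -> exists d e k K : R,
  [/\ 0 < d, 0 < k, 0 < K,
   forall E I n s, n ^+ 2 <= E -> `|2 * I| <= E ->
     k * (E + s ^+ 2) <= E - 2 * d * I + a * s ^+ 2 + 2 * e * (s * (n + b * s)) /\
     E - 2 * d * I + a * s ^+ 2 + 2 * e * (s * (n + b * s)) <= K * (E + s ^+ 2) &
   forall a' E n s p, a <= a' -> n ^+ 2 <= E ->
     - b * p ^+ 2 + d / 2 * (p ^+ 2 + (a * s + b * p) ^+ 2) - d / 2 * E
       + e * (- a' * s ^+ 2 + (n + b * s) * p)
     <= - k * (p ^+ 2 + E + s ^+ 2)].
Proof.
move=> a0 b0.
(* The first bound lets the boundary damping absorb every term in [p ^+ 2]; the second keeps the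
   cross terms below the energy. *)
pose d := Num.min (b / (2 * (1 + 3 * b ^+ 2 + 4 * a ^+ 2))) ((8 * (1 + 2 * a + 2 * b))^-1).
have d0 : 0 < d.
  by rewrite lt_min divr_gt0 ?invr_gt0//=; nra.
have d1 : d * (2 * (1 + 3 * b ^+ 2 + 4 * a ^+ 2)) <= b.
  by rewrite -ler_pdivlMr ?ge_min ?lexx//; nra.
have d2 : d * (8 * (1 + 2 * a + 2 * b)) <= 1.
  by rewrite -ler_pdivlMr ?div1r ?ge_min ?lexx ?orbT//; nra.
clearbody d.
pose k := Num.min (1 / 2) (Num.min (a / 2) (Num.min (b / 2) (Num.min (d / 4) (d * a ^+ 2 / 2)))).
have k0 : 0 < k by rewrite !lt_min !divr_gt0// mulr_gt0// exprn_gt0.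
have [k1 k2 k3 k4 k5] : [/\ k <= 1 / 2, k <= a / 2, k <= b / 2, k <= d / 4 & k <= d * a ^+ 2 / 2].
  by split; rewrite !ge_min lexx ?orbT.
clearbody k.
(* With [e = 2 * a * d] the trace functional yields [- 2 d a^2 s^2], twice what
   [d / 2 * (a * s + b * p) ^+ 2] can produce in [s ^+ 2] after the square is split. *)
exists d, (2 * a * d), k, (2 + 2 * a); split => //; first lra.
- move=> E I n s nE; rewrite ler_norml => /andP[I1 I2].
  have E0 : 0 <= E by rewrite (le_trans (sqr_ge0 n)).
  have s2 := sqr_ge0 s.
  have h1 := sqr_ge0 (s + n); have h2 := sqr_ge0 (s - n).
  have ad0 : 0 < a * d by rewrite mulr_gt0.
  have q1 : `|2 * (s * n)| <= s ^+ 2 + E by rewrite ler_norml; apply/andP; split; nra.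
  move: q1; rewrite ler_norml => /andP[q1 q2].
  set m := s * n in q1 q2.
  have -> : 2 * (2 * a * d) * (s * (n + b * s)) = 2 * (a * d) * (2 * m) + 4 * b * (a * d) * s ^+ 2 by rewrite /m; ring.
  have r1 : (a * d) * (2 * m) <= a * d * (s ^+ 2 + E) by rewrite ler_pM2l.
  have r2 : (a * d) * - (s ^+ 2 + E) <= a * d * (2 * m) by rewrite ler_pM2l.
  have r3 : d * (2 * I) <= d * E by rewrite ler_pM2l.
  have r4 : d * - E <= d * (2 * I) by rewrite ler_pM2l.
  have bd0 : 0 < b * d by rewrite mulr_gt0.
  have t1 : 4 * b * (a * d) <= a / 2 by nra.
  have t1' : 0 <= 4 * b * (a * d) by nra.
  have t2 : d + 2 * (a * d) <= 1 / 4 by nra.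
  have t3 : 2 * (a * d) <= a / 4 by nra.
  have u1 : 4 * b * (a * d) * s ^+ 2 <= a / 2 * s ^+ 2 by rewrite ler_wpM2r.
  have u1' : 0 <= 4 * b * (a * d) * s ^+ 2 by rewrite mulr_ge0.
  have u2 : (d + 2 * (a * d)) * E <= 1 / 4 * E by rewrite ler_wpM2r.
  have u3 : 2 * (a * d) * s ^+ 2 <= a / 4 * s ^+ 2 by rewrite ler_wpM2r.
  have u4 : k * E <= 1 / 2 * E by rewrite ler_wpM2r.
  have u5 : k * s ^+ 2 <= a / 2 * s ^+ 2 by rewrite ler_wpM2r.
  have u6 : 0 <= a * E by rewrite mulr_ge0// ltW.
  split; lra.
- move=> a' E n s p aa nE.
  have E0 : 0 <= E by rewrite (le_trans (sqr_ge0 n)).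
  have h1 : 0 <= d * (a * s - b * p) ^+ 2 by rewrite mulr_ge0 ?sqr_ge0// ltW.
  have h2 : 0 <= d * (n / 2 - 2 * a * p) ^+ 2 by rewrite mulr_ge0 ?sqr_ge0// ltW.
  have h3 : 0 <= d * (a * s - 2 * b * p) ^+ 2 by rewrite mulr_ge0 ?sqr_ge0// ltW.
  have h4 : 0 <= (a' - a) * (a * d * s ^+ 2).
    by rewrite mulr_ge0 ?subr_ge0// mulr_ge0 ?sqr_ge0// mulr_ge0// ltW.
  have h5 : d * (2 * (1 + 3 * b ^+ 2 + 4 * a ^+ 2)) * p ^+ 2 <= b * p ^+ 2.
    by rewrite ler_wpM2r ?sqr_ge0.
  have h6 : d * n ^+ 2 <= d * E by rewrite ler_pM2l.
  have u1 : k * p ^+ 2 <= b / 2 * p ^+ 2 by rewrite ler_wpM2r ?sqr_ge0.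
  have u2 : k * E <= d / 4 * E by rewrite ler_wpM2r.
  have u3 : k * s ^+ 2 <= d * a ^+ 2 / 2 * s ^+ 2 by rewrite ler_wpM2r ?sqr_ge0.
  have h7 : 0 <= d * p ^+ 2 by rewrite mulr_ge0 ?sqr_ge0// ltW.
  lra.
Qed.

(** Here the potential sits at the other end: [t] is the trace at 1, and the trace [s] at 0 is
    reached through [(t - s) ^+ 2 <= E]. The forcing [h] of the boundary condition at 0 survives as
    [K * h ^+ 2], to be absorbed by the upstream waves. *)
Lemma robin_scalars b c : 0 < b -> 0 < c -> exists d e k K : R,
  [/\ 0 < d, 0 < k, 0 < K,
   forall E I n s t, n ^+ 2 <= E -> `|2 * I| <= E -> (t - s) ^+ 2 <= E ->
     k * (E + s ^+ 2) <= E - 2 * d * I + c * t ^+ 2 + 2 * e * (s * (n + b * s)) /\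
     E - 2 * d * I + c * t ^+ 2 + 2 * e * (s * (n + b * s)) <= K * (E + s ^+ 2) &
   forall E n s p t h, n ^+ 2 <= E -> (t - s) ^+ 2 <= E ->
     - (b * p + h) * p + d / 2 * (p ^+ 2 + (b * p + h) ^+ 2) - d / 2 * E
       + e * (s * (- c * t - h) + (n + b * s) * p)
     <= - k * (p ^+ 2 + E + s ^+ 2) + K * h ^+ 2].
Proof.
move=> b0 c0.
(* With [e = d * th] the trace terms feed back at most [d * th * (c + 1 / 2) * E = d / 4 * E], half
   of what the multiplier dissipates. *)
pose th := (4 * c + 2)^-1.
have th0 : 0 < th by rewrite invr_gt0; lra.
have thE : th * (4 * c + 2) = 1 by rewrite mulVf// gt_eqF//; lra.
have th2 : th <= 1 / 2 by nra.
(* Since [s ^+ 2 <= 2 * t ^+ 2 + 2 * E], this [g] lets [c * t ^+ 2] control [g / 2 * s ^+ 2] at the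
   price of at most a quarter of the energy. *)
pose g := Num.min c (1 / 4).
have g0 : 0 < g by rewrite lt_min c0/= divr_gt0.
have [g1 g2] : g <= c /\ g <= 1 / 4 by split; rewrite ge_min lexx ?orbT.
pose d := Num.min (b / (4 * (1 + b ^+ 2 + th * (1 + b ^+ 2 / c)))) (Num.min (1 / 4) (g / (8 * (1 + b)))).
have bc0 : 0 < b ^+ 2 / c by rewrite divr_gt0// exprn_gt0.
have b20 : 0 < b ^+ 2 by rewrite exprn_gt0.
have D10 : 0 < 4 * (1 + b ^+ 2 + th * (1 + b ^+ 2 / c)).
  by rewrite mulr_gt0// !addr_gt0 ?mulr_gt0 ?addr_gt0.
have d0 : 0 < d.
  by rewrite !lt_min !divr_gt0//; lra.
have d1 : d * (4 * (1 + b ^+ 2 + th * (1 + b ^+ 2 / c))) <= b.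
  by rewrite -ler_pdivlMr// ge_min lexx.
have d2 : d <= 1 / 4 by rewrite !ge_min lexx ?orbT.
have d3 : d * (8 * (1 + b)) <= g.
  by rewrite -ler_pdivlMr ?ge_min ?lexx ?orbT//; lra.
clearbody d g.
pose k := Num.min (1 / 8) (Num.min (g / 4) (Num.min (b / 4) (Num.min (d / 4) (d * th * c / 4)))).
have k0 : 0 < k by rewrite !lt_min !divr_gt0// !mulr_gt0.
have [k1 k2 k3 k4 k5] : [/\ k <= 1 / 8, k <= g / 4, k <= b / 4, k <= d / 4 & k <= d * th * c / 4].
  by split; rewrite !ge_min lexx ?orbT.
clearbody k.
pose K := 4 + 4 * c + b^-1 + c^-1.
have bV : 0 < b^-1 by rewrite invr_gt0.
have cV : 0 < c^-1 by rewrite invr_gt0.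
have K0 : 0 < K by rewrite !addr_gt0// mulr_gt0.
have dt0 : 0 < d * th by rewrite mulr_gt0.
exists d, (d * th), k, K; split => //.
- move=> E I n s t nE; rewrite ler_norml => /andP[I1 I2] tE.
  have E0 : 0 <= E by rewrite (le_trans (sqr_ge0 n)).
  have s2 := sqr_ge0 s.
  have h1 := sqr_ge0 (s + n); have h2 := sqr_ge0 (s - n).
  have q1 : `|2 * (s * n)| <= s ^+ 2 + E by rewrite ler_norml; apply/andP; split; nra.
  move: q1; rewrite ler_norml => /andP[q1 q2].
  set m := s * n in q1 q2.
  have -> : 2 * (d * th) * (s * (n + b * s)) = (d * th) * (2 * m) + 2 * (b * (d * th)) * s ^+ 2 by rewrite /m; ring.
  have dth : d * th <= d / 2 by nra.
  have r1 : (d * th) * (2 * m) <= d * th * (s ^+ 2 + E) by rewrite ler_pM2l.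
  have r2 : (d * th) * - (s ^+ 2 + E) <= d * th * (2 * m) by rewrite ler_pM2l.
  have r5 : d * th * (s ^+ 2 + E) <= d / 2 * (s ^+ 2 + E) by rewrite ler_wpM2r// addr_ge0.
  have r3 : d * (2 * I) <= d * E by rewrite ler_pM2l.
  have r4 : d * - E <= d * (2 * I) by rewrite ler_pM2l.
  have bd : b * d <= g / 8 by clear -d0 d3; nra.
  have dg : d <= g / 8 by clear -d0 b0 d3; nra.
  have bdt : 2 * (b * (d * th)) <= g / 8 by have := ler_wpM2l (ltW b0) dth; clear -bd; lra.
  have bdt0 : 0 <= 2 * (b * (d * th)) by rewrite !mulr_ge0// ltW.
  have u1 : 2 * (b * (d * th)) * s ^+ 2 <= g / 8 * s ^+ 2 by rewrite ler_wpM2r.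
  have u2 : 0 <= 2 * (b * (d * th)) * s ^+ 2 by rewrite mulr_ge0.
  have u3 : d * s ^+ 2 <= g / 8 * s ^+ 2 by rewrite ler_wpM2r.
  have u4 : d * E <= 1 / 4 * E by rewrite ler_wpM2r.
  have t1 : g * t ^+ 2 <= c * t ^+ 2 by rewrite ler_wpM2r ?sqr_ge0.
  have t2 : s ^+ 2 <= 2 * t ^+ 2 + 2 * E by move: tE; exact: sqr_le_double.
  have t2' : t ^+ 2 <= 2 * s ^+ 2 + 2 * E by apply: sqr_le_double; rewrite -sqrrN opprB.
  have t3 : g * s ^+ 2 <= g * (2 * t ^+ 2 + 2 * E) by rewrite ler_pM2l.
  have t4 : g * E <= 1 / 4 * E by rewrite ler_wpM2r.
  have t5 : c * t ^+ 2 <= c * (2 * s ^+ 2 + 2 * E) by rewrite ler_pM2l.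
  have v1 : k * E <= 1 / 8 * E by rewrite ler_wpM2r.
  have v2 : k * s ^+ 2 <= g / 4 * s ^+ 2 by rewrite ler_wpM2r.
  have w1 : 0 <= (b^-1 + c^-1) * (E + s ^+ 2) by rewrite mulr_ge0 ?addr_ge0// ltW.
  have w2 : 0 <= c * E by rewrite mulr_ge0// ltW.
  have w3 : 0 <= c * s ^+ 2 by rewrite mulr_ge0// ltW.
  have w4 : g / 8 * s ^+ 2 <= 1 / 32 * s ^+ 2 by rewrite ler_wpM2r//; clear -g2; lra.
  rewrite /K; clear -r1 r2 r3 r4 r5 u1 u2 u3 u4 t1 t2 t3 t4 t5 v1 v2 w1 w2 w3 w4 q1 q2 I1 I2 s2 E0 t2'.
  by split; lra.
- move=> E n s p t h nE tE.
  have E0 : 0 <= E by rewrite (le_trans (sqr_ge0 n)).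
  have dc := mulr_gt0 dt0 c0.
  have h1 : - h * p <= b / 4 * p ^+ 2 + b^-1 * h ^+ 2.
    rewrite -subr_ge0 (_ : _ - _ = b * (p / 2 + b^-1 * h) ^+ 2); last by field; rewrite gt_eqF.
    by rewrite mulr_ge0 ?sqr_ge0// ltW.
  have h2 : 0 <= d * (b * p - h) ^+ 2 by rewrite mulr_ge0 ?sqr_ge0// ltW.
  have h3 : s * (- c * t - h) <= - (c / 2) * s ^+ 2 + c * E + c^-1 * h ^+ 2.
    have a1 : c * (t - s) ^+ 2 <= c * E by rewrite ler_pM2l.
    have a2 : 0 <= c * (t - s + s / 2) ^+ 2 by rewrite mulr_ge0 ?sqr_ge0// ltW.
    have a3 : - s * h <= c / 4 * s ^+ 2 + c^-1 * h ^+ 2.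
      rewrite -subr_ge0 (_ : _ - _ = c * (s / 2 + c^-1 * h) ^+ 2); last by field; rewrite gt_eqF.
      by rewrite mulr_ge0 ?sqr_ge0// ltW.
    lra.
  have h4 : (n + b * s) * p <= E / 2 + p ^+ 2 / 2 + c / 4 * s ^+ 2 + b ^+ 2 / c * p ^+ 2.
    have a1 := sqr_ge0 (n - p).
    have a2 : b * s * p <= c / 4 * s ^+ 2 + b ^+ 2 / c * p ^+ 2.
      rewrite -subr_ge0 (_ : _ - _ = c * (s / 2 - b / c * p) ^+ 2); last by field; rewrite gt_eqF.
      by rewrite mulr_ge0 ?sqr_ge0// ltW.
    lra.
  have h5 := ler_wpM2l (ltW dt0) (lerD h3 h4).
  have h6 : d * (4 * (1 + b ^+ 2 + th * (1 + b ^+ 2 / c))) * p ^+ 2 <= b * p ^+ 2.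
    by rewrite ler_wpM2r ?sqr_ge0.
  have h7 : d * (th * (4 * c + 2)) * E = d * E by rewrite thE mulr1.
  have u1 : k * p ^+ 2 <= b / 4 * p ^+ 2 by rewrite ler_wpM2r ?sqr_ge0.
  have u2 : k * E <= d / 4 * E by rewrite ler_wpM2r.
  have u3 : k * s ^+ 2 <= d * th * c / 4 * s ^+ 2 by rewrite ler_wpM2r ?sqr_ge0.
  have dp : 0 <= d * p ^+ 2 by rewrite mulr_ge0 ?sqr_ge0// ltW.
  have hh : d * h ^+ 2 <= 1 / 4 * h ^+ 2 by rewrite ler_wpM2r ?sqr_ge0.
  have dt1 : d * th <= 1 by nra.
  have hc : d * th * (c^-1 * h ^+ 2) <= 1 * (c^-1 * h ^+ 2).
    by rewrite ler_wpM2r// mulr_ge0 ?sqr_ge0// ltW.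
  have ch : 0 <= c * h ^+ 2 by rewrite mulr_ge0 ?sqr_ge0// ltW.
  have h20 := sqr_ge0 h.
  have dtp : 0 <= d * th * p ^+ 2 by rewrite mulr_ge0 ?sqr_ge0// ltW.
  have dbp : 0 <= d * th * (b ^+ 2 / c) * p ^+ 2.
    by rewrite mulr_ge0 ?sqr_ge0// ltW// mulr_gt0.
  have dbp2 : 0 <= d * b ^+ 2 * p ^+ 2.
    by rewrite mulr_ge0 ?sqr_ge0// ltW// mulr_gt0.
  rewrite /K; move: h5 h6 hc dbp; set B := b ^+ 2 / c; set C := c^-1; set F := b^-1 in h1 *.
  move=> h5 h6 hc dbp; lra.
Qed.

End lyapunov_scalars.

(** * Symmetric forms and multiplier identities *)

Section forms.
Context {R : realType}.
Notation state := (state R).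
Notation fct := (fct R).
Notation X := (@inX R).
Notation "''I01' f" := (intg 0 1 f) (at level 10, f at level 8).
Implicit Types (U V W : state).

Definition sbil (B : state -> state -> R) :=
  (forall U V, X U -> X V -> B U V = B V U) /\
  (forall k U V W, X U -> X V -> X W -> B (k *: U + V) W = k * B U W + B V W).

Lemma sbilD B1 B2 : sbil B1 -> sbil B2 -> sbil (fun U V => B1 U V + B2 U V).
Proof.
move=> [s1 l1] [s2 l2]; split=> [U V XU XV|k U V W XU XV XW].
  by rewrite s1// s2.
by rewrite l1// l2//; ring.
Qed.

Lemma sbilZ c B : sbil B -> sbil (fun U V => c * B U V).
Proof.
move=> [s l]; split=> [U V XU XV|k U V W XU XV XW]; first by rewrite s.
by rewrite l//; ring.
Qed.

Definition linf (f : state -> R) :=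
  forall k U V, X U -> X V -> f (k *: U + V) = k * f U + f V.

(** Linearity is required only under integrals, because the chosen representative [deriv_of] is
    additive only almost everywhere. *)
Definition linL2 (A : state -> R -> R) :=
  (forall U, X U -> L2on 0 1 (A U)) /\
  forall k U V h, X U -> X V -> L2on 0 1 h ->
   'I01 (fun x => A (k *: U + V) x * h x) =
   k * 'I01 (fun x => A U x * h x) + 'I01 (fun x => A V x * h x).

Lemma linL2D A B : linL2 A -> linL2 B -> linL2 (fun U x => A U x + B U x).
Proof.
move=> [a1 a2] [b1 b2]; split=> [U XU|k U V h XU XV lh].
  by apply: L2onD; [exact: a1|exact: b1].
have XKV : X (k *: U + V) by exact: (inX_linsub.2 k U V XU XV).
have E W : X W -> 'I01 (fun x => (A W x + B W x) * h x) =
    'I01 (fun x => A W x * h x) + 'I01 (fun x => B W x * h x).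
  move=> XW; have l1 := L2on_mul (a1 _ XW) lh; have l2 := L2on_mul (b1 _ XW) lh.
  by rewrite -intD//; apply: eq_int => x _; rewrite mulrDl.
by rewrite !E// a2// b2//; ring.
Qed.

Lemma linL2N A : linL2 A -> linL2 (fun U x => - A U x).
Proof.
move=> [a1 a2]; split=> [U XU|k U V h XU XV lh]; first exact/L2onN/a1.
have XKV : X (k *: U + V) by exact: (inX_linsub.2 k U V XU XV).
have E W : X W -> 'I01 (fun x => - A W x * h x) = - 'I01 (fun x => A W x * h x).
  move=> XW; have l1 := L2on_mul (a1 _ XW) lh.
  by rewrite -intN//; apply: eq_int => x _; rewrite mulNr.
by rewrite !E// a2//; ring.
Qed.

Lemma linf_int A h : linL2 A -> L2on 0 1 h -> linf (fun U => 'I01 (fun x => A U x * h x)).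
Proof. by move=> [_ a2] lh k U V XU XV; rewrite a2. Qed.

Lemma linfD f g : linf f -> linf g -> linf (fun U => f U + g U).
Proof. by move=> lf lg k U V XU XV; rewrite lf// lg//; ring. Qed.

Lemma linfZ c f : linf f -> linf (fun U => c * f U).
Proof. by move=> lf k U V XU XV; rewrite lf//; ring. Qed.

Definition cont01 (om : R -> R) := {within `[(0:R), 1], continuous om}.

Definition q (om : R -> R) (A B : state -> R -> R) U V :=
  'I01 (fun x => om x * (A U x * B V x)).

Lemma sbil_q om A B : cont01 om -> linL2 A -> linL2 B ->
  sbil (fun U V => q om A B U V + q om B A U V).
Proof.
move=> co lA lB; split=> [U V XU XV|k U V W XU XV XW].
  by rewrite addrC; congr (_ + _); apply: eq_int => x _; ring.
have E A' B' : linL2 A' -> linL2 B' -> q om A' B' (k *: U + V) W =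
    k * q om A' B' U W + q om A' B' V W.
  move=> [a1 a2] [b1 b2].
  have E W' : q om A' B' W' W = 'I01 (fun x => A' W' x * (om x * B' W x)).
    by apply: eq_int => x _; ring.
  by rewrite !E a2//; apply: L2on_mulc => //; exact: b1.
by rewrite !E//; ring.
Qed.

Lemma sbil_qq om A : cont01 om -> linL2 A -> sbil (q om A A).
Proof.
move=> co lA; have [s l] := sbilZ (1 / 2) (sbil_q co lA lA).
have E U V : q om A A U V = 1 / 2 * (q om A A U V + q om A A U V) by field.
split=> [U V XU XV|k U V W XU XV XW]; first by rewrite E s// -E.
by rewrite E l// -!E.
Qed.

Lemma sbil_linf f g : linf f -> linf g -> sbil (fun U V => f U * g V + g U * f V).
Proof.
move=> lf lg; split=> [U V XU XV|k U V W XU XV XW]; first by ring.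
by rewrite lf// lg//; ring.
Qed.

Lemma sbil_linff f : linf f -> sbil (fun U V => f U * f V).
Proof.
move=> lf; split=> [U V XU XV|k U V W XU XV XW]; first by ring.
by rewrite lf//; ring.
Qed.

Definition ceps U : fct := let: (e, e', Y, z, z', w, w', Z) := U in e.
Definition ceps' U : fct := let: (e, e', Y, z, z', w, w', Z) := U in e'.
Definition cY U : fct := let: (e, e', Y, z, z', w, w', Z) := U in Y.
Definition cz U : fct := let: (e, e', Y, z, z', w, w', Z) := U in z.
Definition cz' U : fct := let: (e, e', Y, z, z', w, w', Z) := U in z'.
Definition cw U : fct := let: (e, e', Y, z, z', w, w', Z) := U in w.
Definition cw' U : fct := let: (e, e', Y, z, z', w, w', Z) := U in w'.
Definition cZ U : fct := let: (e, e', Y, z, z', w, w', Z) := U in Z.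

Definition clin (c : state -> fct) := forall k U V, c (k *: U + V) = k *: c U + c V.

Lemma clins : [/\ clin ceps /\ clin ceps', clin cY, clin cz /\ clin cz', clin cw /\ clin cw' & clin cZ].
Proof.
split; try split; move=> k [[[[[[[e e'] Y] z] z'] w] w'] Z]
  [[[[[[[f f'] fY] fz] fz'] fw] fw'] fZ]; by rewrite state_lin.
Qed.

Lemma inXP U : X U -> [/\ H1 (ceps U) /\ L2 (ceps' U), H1 (cY U), H1R (cz U) /\ L2 (cz' U),
   H1 (cw U) /\ L2 (cw' U) & H1 (cZ U)].
Proof. by case: U => [[[[[[[e e'] Y] z] z'] w] w'] Z]. Qed.

Lemma linL2_comp c : clin c -> (forall U, X U -> L2 (c U)) -> linL2 (c : state -> R -> R).
Proof.
move=> lc L; split => // k U V h XU XV lh; rewrite lc.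
exact: (l2ip_lin k (L _ XU) (L _ XV) lh).
Qed.

Lemma linL2_deriv c : clin c -> (forall U, X U -> H1 (c U)) ->
  linL2 (fun U => deriv_of (c U) : R -> R).
Proof.
move=> lc L; split=> [U XU|k U V h XU XV lh]; first exact/deriv_of_L2/L.
by rewrite lc; exact: (deriv_of_lin k (L _ XU) (L _ XV) lh).
Qed.

Lemma linf_trace c (x : R) : clin c -> linf (fun U => c U x).
Proof. by move=> lc k U V _ _; rewrite lc. Qed.

(* [f] and [g] represent the same element of L^2(0,1). *)
Definition eqm (f g : R -> R) := [/\ L2on 0 1 f, L2on 0 1 g &
  forall h, L2on 0 1 h -> 'I01 (fun x => f x * h x) = 'I01 (fun x => g x * h x)].

Lemma eqm_refl f : L2on 0 1 f -> eqm f f. Proof. by []. Qed.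

Lemma eqmD f g f1 g1 : eqm f f1 -> eqm g g1 ->
  eqm (fun x => f x + g x) (fun x => f1 x + g1 x).
Proof.
move=> [a1 a2 a3] [b1 b2 b3]; split; [exact: L2onD|exact: L2onD|].
move=> h lh.
have E u v : L2on 0 1 u -> L2on 0 1 v -> 'I01 (fun x => (u x + v x) * h x) =
    'I01 (fun x => u x * h x) + 'I01 (fun x => v x * h x).
  move=> lu lv; rewrite -intD ?L2on_mul//; by apply: eq_int => x _; rewrite mulrDl.
by rewrite !E// a3// b3.
Qed.

Lemma eqmN f f1 : eqm f f1 -> eqm (fun x => - f x) (fun x => - f1 x).
Proof.
move=> [a1 a2 a3]; split; [exact: L2onN|exact: L2onN|].
move=> h lh.
have E u : L2on 0 1 u -> 'I01 (fun x => - u x * h x) = - 'I01 (fun x => u x * h x).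
  move=> lu; rewrite -intN ?L2on_mul//; by apply: eq_int => x _; rewrite mulNr.
by rewrite !E// a3.
Qed.

Lemma eqm_deriv (f g : fct) : prim 0 1 (f : R -> R) g -> eqm (deriv_of f) g.
Proof.
move=> H; split; [|exact: prim_L2 H|by move=> h lh; exact: int_deriv_of].
by apply: deriv_of_L2; exists g.
Qed.

Lemma eqm_ae (f g : fct) : L2 f -> L2 g -> eqL2 f g -> eqm f g.
Proof.
move=> lf lg E; split => // h lh.
by apply: int_eq_mod => //; exact: (L2norm_ae0 lf lg E).
Qed.

Lemma eqm_mul om f g f1 g1 : cont01 om -> eqm f f1 -> eqm g g1 ->
  'I01 (fun x => om x * (f x * g x)) = 'I01 (fun x => om x * (f1 x * g1 x)).
Proof.
move=> co [a1 a2 a3] [b1 b2 b3].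
transitivity ('I01 (fun x => f x * (om x * g x))); first by apply: eq_int => x _; ring.
rewrite a3; last exact: L2on_mulc.
transitivity ('I01 (fun x => g x * (om x * f1 x))); first by apply: eq_int => x _; ring.
rewrite b3; last exact: L2on_mulc.
by apply: eq_int => x _; ring.
Qed.

Lemma q_eqm om A B U V f g : cont01 om ->
  eqm (A U) f -> eqm (B V) g -> q om A B U V = 'I01 (fun x => om x * (f x * g x)).
Proof. by move=> co ef eg; exact: eqm_mul. Qed.

Lemma cont_cst1 (k : R) : cont01 (fun=> k).
Proof. by rewrite /cont01 => x; exact: cvg_cst. Qed.

Arguments cont_cst1 : clear implicits.

Lemma prim_affine (k : R) : prim 0 1 (fun x => k - x) (fun=> - 1 : R).
Proof.
apply: (eq_prim _ _ (primB (prim_cst 0 1 k) (prim_id 0 1))) => // x _.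
by rewrite sub0r.
Qed.

Lemma cont_affine (k : R) : cont01 (fun x => k - x).
Proof. exact: prim_cont (prim_affine k). Qed.

Arguments cont_affine : clear implicits.

(** Integration by parts against the square of [y]; the slope -1 of the weight leaves half of its
    integral, the source of all interior decay. *)
Lemma int_weight (k : R) (y y1 : R -> R) : prim 0 1 y y1 ->
  'I01 (fun x => (k - x) * (y x * y1 x)) =
  ((k - 1) * y 1 ^+ 2 - k * y 0 ^+ 2) / 2 + 'I01 (fun x => y x ^+ 2) / 2.
Proof.
move=> H; have := prim_ibp ler01 (prim_affine k) (primM H H).
have lyy : L1on 0 1 (fun x => (k - x) * (y x * y1 x)).
  have := L2on_mul (L2on_mulc (cont_affine k) (prim_L2on H)) (prim_L2 H).
  by apply: eq_L1on => x _; rewrite mulrA.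
rewrite (@eq_int _ 0 1 (fun x => (k - x) * (y x * y1 x + y1 x * y x))
   (fun x => 2 * ((k - x) * (y x * y1 x)))); last by move=> x _; ring.
rewrite (@eq_int _ 0 1 (fun x => - 1 * (y x * y x)) (fun x => - y x ^+ 2)); last first.
  by move=> x _; ring.
rewrite intZ// intN ?L2on_sqr//; last exact: prim_L2on H.
set I := 'I01 _; set J := 'I01 _ => E; lra.
Qed.

(** Polarised Lyapunov functional of a wave with velocity [A] and space derivative [B]: the energy,
    the multiplier term of weight [1 - x], a boundary potential in the trace [t], and the product of
    the trace [s] at 0 with a functional [n] whose time derivative dissipates [s]. *)
Definition wform (A B : state -> R -> R) (t s n : state -> R) (d kp e : R) U V :=
  q (fun=> 1) A A U V + q (fun=> 1) B B U V
  + (- d) * (q (fun x => 1 - x) A B U V + q (fun x => 1 - x) B A U V)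
  + kp * (t U * t V) + e * (s U * n V + n U * s V).

(** The weight [2 - x] stays between 1 and 2 on [[0, 1]] and decreases along the flow, so transport
    dissipates this form except for the inflow at 0. *)
Definition tform (A B : state -> R -> R) U V :=
  q (fun x => 2 - x) A A U V + q (fun x => 2 - x) B B U V.

Lemma wform_sbil A B t s n d kp e : linL2 A -> linL2 B -> linf t -> linf s -> linf n ->
  sbil (wform A B t s n d kp e).
Proof.
move=> lA lB lt ls ln; do !apply: sbilD; try apply: sbilZ.
- exact: sbil_qq (cont_cst1 _) lA.
- exact: sbil_qq (cont_cst1 _) lB.
- exact: sbil_q (cont_affine _) lA lB.
- exact: sbil_linff.
- exact: sbil_linf.
Qed.

Lemma tform_sbil A B : linL2 A -> linL2 B -> sbil (tform A B).
Proof.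
by move=> lA lB; apply: sbilD; [exact: sbil_qq (cont_affine _) lA|exact: sbil_qq (cont_affine _) lB].
Qed.

(** [V] plays the time derivative of [U]: [A V] is the space derivative of [B U], and [B V] that of
    [A U]. The energy then integrates to boundary terms, and the weight [1 - x] adds none at 1. *)
Lemma wform_gen A B t s n d kp e U V (x x1 y y1 : R -> R) :
  eqm (A U) y -> eqm (B U) x -> eqm (A V) x1 -> eqm (B V) y1 ->
  prim 0 1 x x1 -> prim 0 1 y y1 ->
  wform A B t s n d kp e U V = y 1 * x 1 - y 0 * x 0
   + d / 2 * (y 0 ^+ 2 + x 0 ^+ 2)
   - d / 2 * ('I01 (fun r => y r ^+ 2) + 'I01 (fun r => x r ^+ 2))
   + kp * (t U * t V) + e * (s U * n V + n U * s V).
Proof.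
move=> AU BU AV BV px py; rewrite /wform.
rewrite (q_eqm (cont_cst1 1) AU AV) (q_eqm (cont_cst1 1) BU BV).
rewrite (q_eqm (cont_affine 1) AU BV) (q_eqm (cont_affine 1) BU AV).
rewrite (int_weight 1 py) (int_weight 1 px) -(prim_ibp ler01 py px).
rewrite (@eq_int _ 0 1 (fun r => 1 * (y r * x1 r)) (fun r => y r * x1 r)); last by move=> r _; rewrite mul1r.
rewrite (@eq_int _ 0 1 (fun r => 1 * (x r * y1 r)) (fun r => y1 r * x r)); last by move=> r _; rewrite mul1r mulrC.
by field.
Qed.

Lemma wform_diag A B t s n d kp e U (x y : R -> R) :
  eqm (A U) y -> eqm (B U) x ->
  wform A B t s n d kp e U U =
  'I01 (fun r => y r ^+ 2) + 'I01 (fun r => x r ^+ 2)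
   - 2 * d * 'I01 (fun r => (1 - r) * (y r * x r))
   + kp * t U ^+ 2 + 2 * e * (s U * n U).
Proof.
move=> AU BU; rewrite /wform.
rewrite (q_eqm (cont_cst1 1) AU AU) (q_eqm (cont_cst1 1) BU BU).
rewrite (q_eqm (cont_affine 1) AU BU) (q_eqm (cont_affine 1) BU AU).
rewrite (@eq_int _ 0 1 (fun r => 1 * (y r * y r)) (fun r => y r ^+ 2)); last by move=> r _; rewrite mul1r.
rewrite (@eq_int _ 0 1 (fun r => 1 * (x r * x r)) (fun r => x r ^+ 2)); last by move=> r _; rewrite mul1r.
rewrite (@eq_int _ 0 1 (fun r => (1 - r) * (x r * y r)) (fun r => (1 - r) * (y r * x r))); last by move=> r _; rewrite [x r * _]mulrC.
by ring.
Qed.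

Lemma int_cross (x y : R -> R) : L2on 0 1 x -> L2on 0 1 y ->
  `|2 * 'I01 (fun r => (1 - r) * (y r * x r))| <=
  'I01 (fun r => y r ^+ 2) + 'I01 (fun r => x r ^+ 2).
Proof.
move=> lx ly.
have l : L1on 0 1 (fun r => (1 - r) * (y r * x r)).
  have := L2on_mul (L2on_mulc (cont_affine 1) ly) lx.
  by apply: eq_L1on => r _; rewrite mulrA.
rewrite -intZ// -intD ?L2on_sqr// (le_trans (norm_int (L1onZ 2 l)))//.
apply: le_int; [exact/L1on_norm/L1onZ|by apply: L1onD; exact: L2on_sqr|].
move=> r /andP[r0 r1]; rewrite ler_norml.
have h1 := sqr_ge0 (y r - x r); have h2 := sqr_ge0 (y r + x r).
have h3 := sqr_ge0 (y r); have h4 := sqr_ge0 (x r).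
have r0' : 0 <= 1 - r by lra.
have b1 := mulr_ge0 r0' h1; have b2 := mulr_ge0 r0' h2.
have b3 := mulr_ge0 r0 h3; have b4 := mulr_ge0 r0 h4.
by apply/andP; split; lra.
Qed.

Lemma int_unit_sqr (om y : R -> R) : cont01 om ->
  (forall r : R, 0 <= r <= 1 -> om r ^+ 2 <= 1) -> L2on 0 1 y ->
  'I01 (fun r => y r * om r) ^+ 2 <= 'I01 (fun r => y r ^+ 2).
Proof.
move=> co om1 ly; have lo := L2on_cont co.
rewrite (le_trans (int_CS ly lo))// ler_piMr ?int_sqr_ge0//.
apply: (@le_trans _ _ ('I01 (fun=> 1 : R))).
  by apply: le_int; [exact: L2on_sqr|exact: L1on_cst|].
by rewrite int_cst// subr0 mulr1.
Qed.

Lemma tform_gen A B U V (y y1 y2 : R -> R) :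
  eqm (A U) y -> eqm (B U) y1 -> eqm (A V) (fun r => - y1 r) ->
  eqm (B V) (fun r => - y2 r) -> prim 0 1 y y1 -> prim 0 1 y1 y2 ->
  tform A B U V <= y 0 ^+ 2 + y1 0 ^+ 2
   - ('I01 (fun r => y r ^+ 2) + 'I01 (fun r => y1 r ^+ 2)) / 2.
Proof.
move=> AU BU AV BV p1 p2; rewrite /tform.
rewrite (q_eqm (cont_affine 2) AU AV) (q_eqm (cont_affine 2) BU BV).
have E (f f1 : R -> R) : prim 0 1 f f1 -> 'I01 (fun r => (2 - r) * (f r * - f1 r)) =
    - 'I01 (fun r => (2 - r) * (f r * f1 r)).
  move=> H; rewrite -intN; first by apply: eq_int => r _; ring.
  have := L2on_mul (L2on_mulc (cont_affine 2) (prim_L2on H)) (prim_L2 H).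
  by apply: eq_L1on => r _; rewrite mulrA.
rewrite !E// (int_weight 2 p1) (int_weight 2 p2).
by have := sqr_ge0 (y 1); have := sqr_ge0 (y1 1); lra.
Qed.

Lemma tform_diag A B U (y y1 : R -> R) : eqm (A U) y -> eqm (B U) y1 ->
  'I01 (fun r => y r ^+ 2) + 'I01 (fun r => y1 r ^+ 2) <= tform A B U U /\
  tform A B U U <= 2 * ('I01 (fun r => y r ^+ 2) + 'I01 (fun r => y1 r ^+ 2)).
Proof.
move=> AU BU; rewrite /tform.
rewrite (q_eqm (cont_affine 2) AU AU) (q_eqm (cont_affine 2) BU BU).
have E (f : R -> R) : L2on 0 1 f ->
    'I01 (fun r => f r ^+ 2) <= 'I01 (fun r => (2 - r) * (f r * f r)) /\
    'I01 (fun r => (2 - r) * (f r * f r)) <= 2 * 'I01 (fun r => f r ^+ 2).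
  move=> lf; have l : L1on 0 1 (fun r => (2 - r) * (f r * f r)).
    have := L2on_mul (L2on_mulc (cont_affine 2) lf) lf.
    by apply: eq_L1on => r _; rewrite mulrA.
  split; [|rewrite -intZ ?L2on_sqr//]; apply: le_int => //; try exact: L2on_sqr.
  - by move=> r /andP[r0 r1]; have := sqr_ge0 (f r); nra.
  - exact/L1onZ/L2on_sqr.
  - by move=> r /andP[r0 r1]; have := sqr_ge0 (f r); nra.
have [_ ly _] := AU; have [_ ly1 _] := BU.
have [a1 a2] := E _ ly; have [b1 b2] := E _ ly1; split; lra.
Qed.

End forms.

(** * Cascade variables and trace functionals *)

Section lyapunov.
Context {R : realType}.
Notation state := (state R).
Notation fct := (fct R).
Notation X := (@inX R).
Notation "''I01' f" := (intg 0 1 f) (at level 10, f at level 8).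
Implicit Types (U V W : state).

Lemma itv01_0 : (0 : R) <= (0 : R) <= (1 : R).
Proof. by rewrite lexx ler01. Qed.

Lemma itv01_1 : (0 : R) <= (1 : R) <= (1 : R).
Proof. by rewrite lexx ler01. Qed.

(** The velocity of v, with [Y_t] replaced by [- Y_x]. *)
Definition Av U (x : R) : R := ceps' U x + cz' U x + - deriv_of (cY U) x.
Definition Bv U (x : R) : R := deriv_of (ceps U) x + deriv_of (cY U) x + deriv_of (cz U) x.
Definition Az U (x : R) : R := cz' U x.
Definition Bz U (x : R) : R := deriv_of (cz U) x.
Definition Aw U (x : R) : R := cw' U x.
Definition Bw U (x : R) : R := deriv_of (cw U) x.
Definition sv U : R := ceps U 0 + cY U 0 + cz U 0.
Definition sz U : R := cz U 0.
Definition sw U : R := cw U 0.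
Definition tw U : R := cw U 1.
(** Adding [b] times the trace cancels the damping part of the flux at 0: along the flow [nv] has
    derivative [- a * sv], [nz] has [- (a + 1) * sz], and [nw] has [- c3 * tw] minus the forcing.
    The weight [1 - x] in [nz] removes the uncontrolled flux of z at 1. *)
Definition nv b U : R := 'I01 (fun x => Av U x * 1) + b * sv U.
Definition nz b U : R := 'I01 (fun x => Az U x * (1 - x)) + b * sz U.
Definition nw b U : R := 'I01 (fun x => Aw U x * 1) + b * sw U.
Definition AY U (x : R) : R := cY U x.
Definition BY U (x : R) : R := deriv_of (cY U) x.
Definition AZ U (x : R) : R := cZ U x.
Definition BZ U (x : R) : R := deriv_of (cZ U) x.

Definition sqn (f : R -> R) := 'I01 (fun x => f x ^+ 2).

Definition Gv U := sqn (Av U) + sqn (Bv U) + sv U ^+ 2.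
Definition Gz U := sqn (Az U) + sqn (Bz U) + sz U ^+ 2.
Definition Gw U := sqn (Aw U) + sqn (Bw U) + sw U ^+ 2.
Definition GY U := sqn (AY U) + sqn (BY U).
Definition GZ U := sqn (AZ U) + sqn (BZ U).
Definition G U := Gv U + Gz U + Gw U + GY U + GZ U.

Lemma linL2_all : [/\ linL2 Av /\ linL2 Bv, linL2 Az /\ linL2 Bz, linL2 Aw /\ linL2 Bw,
   linL2 AY /\ linL2 BY & linL2 AZ /\ linL2 BZ].
Proof.
have [[l1 l2] l3 [l4 l5] [l6 l7] l8] := @clins R.
have I1 : forall U, X U -> H1 (ceps U) by move=> U /inXP[[]].
have I2 : forall U, X U -> L2 (ceps' U) by move=> U /inXP[[]].
have I3 : forall U, X U -> H1 (cY U) by move=> U /inXP[].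
have I4 : forall U, X U -> H1 (cz U) by move=> U /inXP[_ _ [[]]].
have I5 : forall U, X U -> L2 (cz' U) by move=> U /inXP[_ _ []].
have I6 : forall U, X U -> H1 (cw U) by move=> U /inXP[_ _ _ []].
have I7 : forall U, X U -> L2 (cw' U) by move=> U /inXP[_ _ _ []].
have I8 : forall U, X U -> H1 (cZ U) by move=> U /inXP[].
have c2 := linL2_comp l2 I2; have c5 := linL2_comp l5 I5; have c7 := linL2_comp l7 I7.
have c3 : linL2 AY by apply: (linL2_comp l3) => U /I3/H1_L2.
have c8 : linL2 AZ by apply: (linL2_comp l8) => U /I8/H1_L2.
have d1 := linL2_deriv l1 I1; have d3 := linL2_deriv l3 I3; have d4 := linL2_deriv l4 I4.
have d6 := linL2_deriv l6 I6; have d8 := linL2_deriv l8 I8.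
have v1 := linL2D (linL2D c2 c5) (linL2N d3); have v2 := linL2D (linL2D d1 d3) d4.
exact: (And5 (conj v1 v2) (conj c5 d4) (conj c7 d6) (conj c3 d3) (conj c8 d8)).
Qed.

Lemma linf_all b : [/\ linf sv, linf sz, linf sw & linf tw] /\
  [/\ linf (nv b), linf (nz b) & linf (nw b)].
Proof.
have [[l1 l2] l3 [l4 l5] [l6 l7] l8] := @clins R.
have [[a1 _] [a2 _] [a3 _] _ _] := linL2_all.
have s1 : linf sv by apply: linfD; [apply: linfD|]; exact: linf_trace.
have s2 : linf sz by exact: linf_trace.
have s3 : linf sw by exact: linf_trace.
have s4 : linf tw by exact: linf_trace.
do !split=> //; apply: linfD; try exact: linfZ.
- by apply: linf_int => //; exact: L2on_cst.
- by apply: linf_int => //; exact: L2on_cont (@cont_affine R 1).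
- by apply: linf_int => //; exact: L2on_cst.
Qed.

Lemma bXE U : bX U U = sqn (ceps U) + sqn (deriv_of (ceps U)) + sqn (ceps' U)
  + GY U + (sqn (cz U) + sqn (Bz U)) + sqn (Az U) + (sqn (cw U) + sqn (Bw U))
  + sqn (Aw U) + GZ U.
Proof.
by case: U => [[[[[[[e e'] Y] z] z'] w] w'] Z]; rewrite /bX /h1ip !l2ip_sqr.
Qed.

Lemma sqn_ge0 f : 0 <= sqn f. Proof. exact: int_sqr_ge0. Qed.

Lemma sqnN f : sqn (fun x => - f x) = sqn f.
Proof. by apply: eq_int => x _; rewrite sqrrN. Qed.

(** Arithmetic kept apart so that only variables occur; 50 is a crude common constant. *)
Lemma G_bX_scalars (A B D1 D3 D4 D6 D8 S1 S2 S3 S4 S5 S6 S7 S8 Q1 Q2 Q3 Q4 Q5 : R) :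
  [/\ 0 <= A, 0 <= B, 0 <= Q1, 0 <= Q4 & 0 <= Q5] ->
  [/\ 0 <= D1, 0 <= D3, 0 <= D4, 0 <= D6 & 0 <= D8] ->
  [/\ 0 <= S1, 0 <= S2, 0 <= S3 & 0 <= S4] -> [/\ 0 <= S5, 0 <= S6, 0 <= S7 & 0 <= S8] ->
  Q1 <= 3 * (Q2 + Q3 + Q4) -> Q2 <= 3 * (Q1 + Q3 + Q4) ->
  Q2 <= 2 * S1 + 2 * D1 -> Q3 <= 2 * S3 + 2 * D3 -> Q4 <= 2 * S4 + 2 * D4 ->
  Q5 <= 2 * S6 + 2 * D6 -> S1 <= 2 * Q2 + 2 * D1 -> S4 <= 2 * Q4 + 2 * D4 ->
  S6 <= 2 * Q5 + 2 * D6 -> A <= 3 * (S2 + S5 + D3) -> B <= 3 * (D1 + D3 + D4) ->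
  S2 <= 3 * (A + S5 + D3) -> D1 <= 3 * (B + D3 + D4) ->
  A + B + Q1 + (S5 + D4 + Q4) + (S7 + D6 + Q5) + (S3 + D3) + (S8 + D8) <=
  50 * (S1 + D1 + S2 + (S3 + D3) + (S4 + D4) + S5 + (S6 + D6) + S7 + (S8 + D8)) /\
  S1 + D1 + S2 + (S3 + D3) + (S4 + D4) + S5 + (S6 + D6) + S7 + (S8 + D8) <=
  50 * (A + B + Q1 + (S5 + D4 + Q4) + (S7 + D6 + Q5) + (S3 + D3) + (S8 + D8)).
Proof. by move=> [? ? ? ? ?] [? ? ? ? ?] [? ? ? ?] [? ? ? ?] *; split; lra. Qed.

(** The change from eps to v is triangular, so the squared norms of either are bounded by those of
    the other together with Y and z. The L^2 norms of eps, z and w, absent from [G], come back from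
    the traces at 0 by [L2_trace0]. *)
Lemma G_bX U : X U -> G U <= 50 * bX U U /\ bX U U <= 50 * G U.
Proof.
move=> XU; have [[h1 h2] h3 [[h4 _] h5] [h6 h7] h8] := inXP XU.
have d1 := deriv_ofP h1; have d3 := deriv_ofP h3; have d4 := deriv_ofP h4; have d6 := deriv_ofP h6.
have [[la lb] _ _ _ _] := linL2_all.
have lAv := la.1 _ XU; have lBv := lb.1 _ XU.
have lN (f : R -> R) : L2on 0 1 f -> L2on 0 1 (fun x => - f x) by exact: L2onN.
have O := itv01_0.
have N (f : R -> R) : 'I01 (fun x => (- f x) ^+ 2) = sqn f by exact: sqnN.
have t1 : ceps U 0 ^+ 2 <= 2 * sqn (ceps U) + 2 * sqn (deriv_of (ceps U)) by exact: trace_L2 d1 O.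
have t3 : cY U 0 ^+ 2 <= 2 * sqn (cY U) + 2 * sqn (deriv_of (cY U)) by exact: trace_L2 d3 O.
have t4 : cz U 0 ^+ 2 <= 2 * sqn (cz U) + 2 * sqn (deriv_of (cz U)) by exact: trace_L2 d4 O.
have t6 : cw U 0 ^+ 2 <= 2 * sqn (cw U) + 2 * sqn (deriv_of (cw U)) by exact: trace_L2 d6 O.
have u1 : sqn (ceps U) <= 2 * ceps U 0 ^+ 2 + 2 * sqn (deriv_of (ceps U)) by exact: L2_trace0 d1.
have u4 : sqn (cz U) <= 2 * cz U 0 ^+ 2 + 2 * sqn (deriv_of (cz U)) by exact: L2_trace0 d4.
have u6 : sqn (cw U) <= 2 * cw U 0 ^+ 2 + 2 * sqn (deriv_of (cw U)) by exact: L2_trace0 d6.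
have a1 : sqn (Av U) <= 3 * (sqn (ceps' U) + sqn (cz' U) + sqn (deriv_of (cY U))).
  by rewrite -[sqn (deriv_of (cY U))]N; exact: int_sqr3 h2 h5 (lN _ (prim_L2 d3)).
have a2 : sqn (Bv U) <= 3 * (sqn (deriv_of (ceps U)) + sqn (deriv_of (cY U)) + sqn (deriv_of (cz U))).
  exact: int_sqr3 (prim_L2 d1) (prim_L2 d3) (prim_L2 d4).
have b1 : sqn (ceps' U) <= 3 * (sqn (Av U) + sqn (cz' U) + sqn (deriv_of (cY U))).
  have := int_sqr3 lAv (lN _ h5) (prim_L2 d3); rewrite N; apply: le_trans.
  by rewrite le_eqVlt; apply/orP; left; apply/eqP; apply: eq_int => x _; rewrite /Av; congr (_ ^+ 2); ring.
have b2 : sqn (deriv_of (ceps U)) <= 3 * (sqn (Bv U) + sqn (deriv_of (cY U)) + sqn (deriv_of (cz U))).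
  have := int_sqr3 lBv (lN _ (prim_L2 d3)) (lN _ (prim_L2 d4)); rewrite !N; apply: le_trans.
  by rewrite le_eqVlt; apply/orP; left; apply/eqP; apply: eq_int => x _; rewrite /Bv; congr (_ ^+ 2); ring.
rewrite bXE /G /Gv /Gz /Gw /GY /GZ.
have s1 : sv U ^+ 2 <= 3 * (ceps U 0 ^+ 2 + cY U 0 ^+ 2 + cz U 0 ^+ 2) by exact: sqr3_le.
have s2 : ceps U 0 ^+ 2 <= 3 * (sv U ^+ 2 + cY U 0 ^+ 2 + cz U 0 ^+ 2).
  have := sqr3_le (sv U) (- cY U 0) (- cz U 0); rewrite !sqrrN; apply: le_trans.
  by rewrite le_eqVlt; apply/orP; left; apply/eqP; rewrite /sv; congr (_ ^+ 2); ring.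
have sv0 := sqr_ge0 (sv U).
by apply: (G_bX_scalars _ _ _ _ s1 s2 t1 t3 t4 t6 u1 u4 u6 a1 a2 b1 b2);
  split; rewrite ?sqn_ge0 ?sqr_ge0.
Qed.

(** [y] and [x] are the velocity and the space derivative. The hypothesis [y 1 * x 1 = 0] covers the
    free end of v and the clamped end of z together. *)
Lemma damp_form A B s n (a b d e k : R) U V (x x1 y y1 : R -> R) (a' N : R) :
  (forall a' E n s p, a <= a' -> n ^+ 2 <= E ->
     - b * p ^+ 2 + d / 2 * (p ^+ 2 + (a * s + b * p) ^+ 2) - d / 2 * E
       + e * (- a' * s ^+ 2 + (n + b * s) * p)
     <= - k * (p ^+ 2 + E + s ^+ 2)) ->
  eqm (A U) y -> eqm (B U) x -> eqm (A V) x1 -> eqm (B V) y1 ->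
  prim 0 1 x x1 -> prim 0 1 y y1 ->
  y 1 * x 1 = 0 -> x 0 = a * s U + b * y 0 -> s V = y 0 ->
  n U = N + b * s U -> N ^+ 2 <= sqn y -> n V = - a' * s U -> a <= a' ->
  wform A B s s n d a e U V <=
   - k * (y 0 ^+ 2 + (sqn y + sqn x) + s U ^+ 2).
Proof.
move=> H AU BU AV BV px py yx x0 sV nU N2 nV aa.
rewrite (wform_gen _ _ _ _ _ _ AU BU AV BV px py) yx x0 sV nU nV.
have N2' : N ^+ 2 <= sqn y + sqn x by rewrite (le_trans N2)// lerDl sqn_ge0.
apply: le_trans (H a' _ N (s U) (y 0) aa N2').
rewrite -!/(sqn _) [sqn (fun r => y r)](_ : _ = sqn y)// [sqn (fun r => x r)](_ : _ = sqn x)//.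
lra.
Qed.

Lemma robin_form A B t s n (b c d e k K h : R) U V (x x1 y y1 : R -> R) (N : R) :
  (forall E n s p t h, n ^+ 2 <= E -> (t - s) ^+ 2 <= E ->
     - (b * p + h) * p + d / 2 * (p ^+ 2 + (b * p + h) ^+ 2) - d / 2 * E
       + e * (s * (- c * t - h) + (n + b * s) * p)
     <= - k * (p ^+ 2 + E + s ^+ 2) + K * h ^+ 2) ->
  eqm (A U) y -> eqm (B U) x -> eqm (A V) x1 -> eqm (B V) y1 ->
  prim 0 1 x x1 -> prim 0 1 y y1 ->
  x 1 = - c * t U -> x 0 = b * y 0 + h -> s V = y 0 -> t V = y 1 ->
  n U = N + b * s U -> N ^+ 2 <= sqn y -> (t U - s U) ^+ 2 <= sqn x ->
  n V = - c * t U - h ->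
  wform A B t s n d c e U V <=
   - k * (y 0 ^+ 2 + (sqn y + sqn x) + s U ^+ 2) + K * h ^+ 2.
Proof.
move=> H AU BU AV BV px py xx1 x0 sV tV nU N2 ts nV.
rewrite (wform_gen _ _ _ _ _ _ AU BU AV BV px py) xx1 x0 sV tV nU nV.
have N2' : N ^+ 2 <= sqn y + sqn x by rewrite (le_trans N2)// lerDl sqn_ge0.
have ts' : (t U - s U) ^+ 2 <= sqn y + sqn x by rewrite (le_trans ts)// lerDr sqn_ge0.
apply: le_trans (H _ N (s U) (y 0) (t U) h N2' ts').
rewrite -!/(sqn _) [sqn (fun r => y r)](_ : _ = sqn y)// [sqn (fun r => x r)](_ : _ = sqn x)//.
lra.
Qed.

End lyapunov.

(** * The Lyapunov form of the whole system *)

Section lyapunov_system.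
Context {R : realType}.
Notation state := (state R).
Notation fct := (fct R).
Notation X := (@inX R).
Notation "''I01' f" := (intg 0 1 f) (at level 10, f at level 8).
Implicit Types (U V W : state).

Lemma eqm_congr (f f1 g g1 : R -> R) : (forall x, 0 <= x <= 1 -> f x = f1 x) ->
  (forall x, 0 <= x <= 1 -> g x = g1 x) -> eqm f1 g1 -> eqm f g.
Proof.
move=> ff gg [a1 a2 a3]; split.
- by apply: eq_L2on a1 => x /ff.
- by apply: eq_L2on a2 => x /gg.
move=> h lh; rewrite (@eq_int _ 0 1 _ (fun x => f1 x * h x)); last by move=> x /ff ->.
by rewrite a3//; apply: eq_int => x /gg ->.
Qed.

(* The boundary values of the time derivative [A V] satisfy the compatibility
   conditions because [V] moves inside the domain of the generator. *)
Definition compat (c0 c2 : R) W :=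
  cY W 0 = - c0 * ceps W 0 /\ cZ W 0 = - (c2 / (1 - c2)) * cw W 0.

(** The inflow of Z is paid by w through [M]; the inflow of Y and the forcing of w are paid by v and
    z through [L], as [T] collects the cost of eps(0) expressed by v and z. The surplus 1 in each
    weight and the factor 1/2 from transport leave half of every energy. *)
Lemma dissipation_sum (L M k1 k2 K2 r c0 c1 ka T fv fz fw ty tz pv ev s1 pz ez s2 pw ew s3 e p nY nZ : R) :
  [/\ 0 <= L, 0 <= M, 0 <= r & 0 <= M * K2 * c1 ^+ 2] ->
  [/\ 0 <= ev, 0 <= ez & 0 <= ew] -> [/\ 0 <= s1, 0 <= s2, 0 <= s3 & 0 <= pv] -> [/\ 0 <= pz, 0 <= pw, 0 <= nY & 0 <= nZ] ->
  L * k1 = T + 1 -> M * k2 = ka ^+ 2 + 1 -> T = 2 * r * (M * K2 * c1 ^+ 2 + c0 ^+ 2) ->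
  fv <= - k1 * (pv + ev + s1) -> fz <= - k1 * (pz + ez + s2) ->
  fw <= - k2 * (pw + ew + s3) + K2 * (c1 ^+ 2 * e) ->
  ty <= c0 ^+ 2 * e + c0 ^+ 2 * p - nY / 2 ->
  tz <= ka ^+ 2 * s3 + ka ^+ 2 * pw - nZ / 2 ->
  e <= 2 * r * (s1 + s2) -> p <= 2 * r * (pv + pz) ->
  L * (fv + fz) + M * fw + ty + tz <= - (1 / 2) * (ev + s1 + (ez + s2) + (ew + s3) + nY + nZ).
Proof.
move=> [L0 M0 r0 h0] [ev0 ez0 ew0] [s10 s20 s30 pv0] [pz0 pw0 nY0 nZ0] LE ME TE hv hz hw hy hZ he hp.
have a1 := ler_wpM2l L0 hv; have a2 := ler_wpM2l L0 hz; have a3 := ler_wpM2l M0 hw.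
have E1 : L * (- k1 * (pv + ev + s1)) = - (T + 1) * (pv + ev + s1) by rewrite -LE; ring.
have E2 : L * (- k1 * (pz + ez + s2)) = - (T + 1) * (pz + ez + s2) by rewrite -LE; ring.
have E3 : M * (- k2 * (pw + ew + s3) + K2 * (c1 ^+ 2 * e)) =
   - (ka ^+ 2 + 1) * (pw + ew + s3) + M * K2 * c1 ^+ 2 * e by rewrite -ME; ring.
rewrite E1 in a1; rewrite E2 in a2; rewrite E3 in a3.
have c02 := sqr_ge0 c0; have ka2 := sqr_ge0 ka.
have b1 : (M * K2 * c1 ^+ 2 + c0 ^+ 2) * e <= T * (s1 + s2).
  rewrite TE (le_trans (ler_wpM2l (addr_ge0 h0 c02) he))//.
  by rewrite le_eqVlt; apply/orP; left; apply/eqP; ring.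
have b2 : c0 ^+ 2 * p <= T * (pv + pz).
  rewrite (le_trans (ler_wpM2l c02 hp))// TE.
  have := mulr_ge0 (mulr_ge0 h0 r0) (addr_ge0 pv0 pz0); lra.
have T0 : 0 <= T by rewrite TE !mulr_ge0// addr_ge0.
have c1' := mulr_ge0 T0 ev0; have c2' := mulr_ge0 T0 ez0; have c3' := mulr_ge0 ka2 ew0.
lra.
Qed.

Lemma lyapunov_form (q c0 c1 c2 c3 : R) :
  0 < c1 / (1 - c0) -> 0 < (c0 - q) / (1 - c0) -> 0 < (c2 - q) / (1 - c2) -> 0 < c3 ->
  exists (B : state -> state -> R) (m c C : R),
  [/\ sip X B, 0 < m, 0 < c, 0 < C &
   (forall U, X U -> c * bX U U <= B U U <= C * bX U U) /\
   forall V W, X W -> genA q c0 c1 c2 c3 V W -> compat c0 c2 W ->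
     B V W <= - m * B V V].
Proof.
move=> h1 h2 h3 h4.
(* The inverse of 0 is 0, so a positive quotient excludes a zero denominator. *)
have c00 : 1 - c0 != 0 by apply/eqP => E; move: h1; rewrite E invr0 mulr0 ltxx.
have c20 : 1 - c2 != 0 by apply/eqP => E; move: h3; rewrite E invr0 mulr0 ltxx.
have a1E : c1 / (1 - c0) * (1 - c0) = c1 by rewrite divfK.
have b1E : (c0 - q) / (1 - c0) * (1 - c0) = c0 - q by rewrite divfK.
move: h1 h2 h3 a1E b1E.
move aE : (c1 / (1 - c0)) => a; move bE : ((c0 - q) / (1 - c0)) => b.
move b2E : ((c2 - q) / (1 - c2)) => b2 a0 b0 b20 a1E b1E.
move kE : (c2 / (1 - c2)) => ka.
have [d1 [e1 [k1 [K1 [d10 k10 K10 pos1 dis1]]]]] := damping_scalars a0 b0.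
have [d2 [e2 [k2 [K2 [d20 k20 K20 pos2 dis2]]]]] := robin_scalars b20 h4.
pose r := (1 - c0) ^- 2.
have r0 : 0 <= r by rewrite invr_ge0 sqr_ge0.
(* The transport forms have weight 1; [M] is chosen against the inflow of Z, and [L] afterwards,
   since the forcing of w enters with weight [M]. *)
pose M := (ka ^+ 2 + 1) / k2.
have M0 : 0 < M by rewrite divr_gt0// ltr_wpDl// sqr_ge0.
pose L := (2 * r * (M * K2 * c1 ^+ 2 + c0 ^+ 2) + 1) / k1.
have L0 : 0 < L.
  rewrite divr_gt0// ltr_wpDl// mulr_ge0 ?mulr_ge0// addr_ge0 ?sqr_ge0//.
  by rewrite mulr_ge0 ?sqr_ge0// mulr_ge0// ltW.
pose Fv := wform (@Av R) (@Bv R) (@sv R) (@sv R) (nv b) d1 a e1.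
pose Fz := wform (@Az R) (@Bz R) (@sz R) (@sz R) (nz b) d1 a e1.
pose Fw := wform (@Aw R) (@Bw R) (@tw R) (@sw R) (nw b2) d2 c3 e2.
pose TY := tform (@AY R) (@BY R).
pose TZ := tform (@AZ R) (@BZ R).
pose B U V := L * (Fv U V + Fz U V) + M * Fw U V + TY U V + TZ U V.
have [[lAv lBv] [lAz lBz] [lAw lBw] [lAY lBY] [lAZ lBZ]] := @linL2_all R.
have [[lsv lsz lsw ltw] [lnv lnz _]] := @linf_all R b.
have [_ [_ _ lnw]] := @linf_all R b2.
have sB : sbil B.
  apply: sbilD; last exact: tform_sbil.
  apply: sbilD; last exact: tform_sbil.
  apply: sbilD; apply: sbilZ; last exact: wform_sbil.
  by apply: sbilD; exact: wform_sbil.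
have NN (f om : R -> R) : cont01 om -> (forall s, 0 <= s <= 1 -> om s ^+ 2 <= 1) ->
    L2on 0 1 f -> 'I01 (fun x => f x * om x) ^+ 2 <= sqn f.
  by move=> *; exact: int_unit_sqr.
have c1c : cont01 (fun=> 1 : R) by exact: cont_cst1.
have o1 (s : R) : 0 <= s <= 1 -> (fun=> 1 : R) s ^+ 2 <= 1 by move=> _; rewrite expr1n.
have c1x : cont01 (fun x => 1 - x : R) by exact: cont_affine.
have o2 (s : R) : 0 <= s <= 1 -> (fun x => 1 - x : R) s ^+ 2 <= 1.
  by move=> /andP[s0 s1] /=; nra.
pose P := L * K1 + M * K2 + 2.
pose p := Num.min (L * k1) (Num.min (M * k2) 1).
have Lk1 := mulr_gt0 L0 k10; have Mk2 := mulr_gt0 M0 k20.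
have LK1 := mulr_gt0 L0 K10; have MK2 := mulr_gt0 M0 K20.
have P0 : 0 < P by rewrite !addr_gt0.
have p0 : 0 < p by rewrite !lt_min Lk1 Mk2 ltr01.
have BG U : X U -> p * G U <= B U U /\ B U U <= P * G U.
  move=> XU.
  have mAv := lAv.1 _ XU; have mBv := lBv.1 _ XU.
  have mAz := lAz.1 _ XU; have mBz := lBz.1 _ XU.
  have mAw := lAw.1 _ XU; have mBw := lBw.1 _ XU.
  have N1 := NN _ _ c1c o1 mAv; have N2 := NN _ _ c1x o2 mAz; have N3 := NN _ _ c1c o1 mAw.
  have gv : k1 * Gv U <= Fv U U /\ Fv U U <= K1 * Gv U.
    rewrite /Fv (wform_diag _ _ _ _ _ _ (eqm_refl mAv) (eqm_refl mBv)).
    apply: pos1; last exact: int_cross.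
    by rewrite (le_trans N1)// lerDl sqn_ge0.
  have gz : k1 * Gz U <= Fz U U /\ Fz U U <= K1 * Gz U.
    rewrite /Fz (wform_diag _ _ _ _ _ _ (eqm_refl mAz) (eqm_refl mBz)).
    apply: pos1; last exact: int_cross.
    by rewrite (le_trans N2)// lerDl sqn_ge0.
  have gw : k2 * Gw U <= Fw U U /\ Fw U U <= K2 * Gw U.
    rewrite /Fw (wform_diag _ _ _ _ _ _ (eqm_refl mAw) (eqm_refl mBw)).
    apply: pos2; [|exact: int_cross|].
      by rewrite (le_trans N3)// lerDl sqn_ge0.
    have [_ _ _ [hw _] _] := inXP XU.
    rewrite (le_trans (trace_sqr (deriv_ofP hw) _ _)) ?lexx ?ler01//.
    by rewrite lerDr sqn_ge0.
  have gY : GY U <= TY U U /\ TY U U <= 2 * GY U.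
    by exact: (tform_diag (eqm_refl (lAY.1 _ XU)) (eqm_refl (lBY.1 _ XU))).
  have gZ : GZ U <= TZ U U /\ TZ U U <= 2 * GZ U.
    by exact: (tform_diag (eqm_refl (lAZ.1 _ XU)) (eqm_refl (lBZ.1 _ XU))).
  have Gv0 : 0 <= Gv U by rewrite !addr_ge0 ?sqn_ge0 ?sqr_ge0.
  have Gz0 : 0 <= Gz U by rewrite !addr_ge0 ?sqn_ge0 ?sqr_ge0.
  have Gw0 : 0 <= Gw U by rewrite !addr_ge0 ?sqn_ge0 ?sqr_ge0.
  have GY0 : 0 <= GY U by rewrite !addr_ge0 ?sqn_ge0.
  have GZ0 : 0 <= GZ U by rewrite !addr_ge0 ?sqn_ge0.
  have [p1 p2 p3] : [/\ p <= L * k1, p <= M * k2 & p <= 1].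
    by split; rewrite !ge_min lexx ?orbT.
  have q1 := ler_wpM2r Gv0 p1; have q2 := ler_wpM2r Gz0 p1.
  have q3 := ler_wpM2r Gw0 p2; have q4 := ler_wpM2r GY0 p3; have q5 := ler_wpM2r GZ0 p3.
  move: gv gz gw gY gZ => [v1 v2] [z1 z2] [w1 w2] [Y1 Y2] [Z1 Z2].
  have Lv1 := ler_wpM2l (ltW L0) v1; have Lv2 := ler_wpM2l (ltW L0) v2.
  have Lz1 := ler_wpM2l (ltW L0) z1; have Lz2 := ler_wpM2l (ltW L0) z2.
  have Mw1 := ler_wpM2l (ltW M0) w1; have Mw2 := ler_wpM2l (ltW M0) w2.
  have s1 := mulr_ge0 (ltW LK1) Gw0; have s2 := mulr_ge0 (ltW LK1) GY0; have s3 := mulr_ge0 (ltW LK1) GZ0.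
  have s4 := mulr_ge0 (ltW MK2) Gv0; have s5 := mulr_ge0 (ltW MK2) Gz0.
  have s6 := mulr_ge0 (ltW MK2) GY0; have s7 := mulr_ge0 (ltW MK2) GZ0.
  rewrite /B /P /G.
  move: (Fv U U) (Fz U U) (Fw U U) (TY U U) (TZ U U) Lv1 Lv2 Lz1 Lz2 Mw1 Mw2 Y1 Y2 Z1 Z2 q1 q2 q3 q4 q5
    s1 s2 s3 s4 s5 s6 s7 Gv0 Gz0 Gw0 GY0 GZ0.
  clearbody p L M; move: (Gv U) (Gz U) (Gw U) (GY U) (GZ U) => g1 g2 g3 g4 g5.
  clear -R.
  by move=> y1 y2 y3 y4 y5 *; split; lra.
have BE U : X U -> p / 50 * bX U U <= B U U <= P * 50 * bX U U.
  move=> XU; have [g1 g2] := BG _ XU; have [g3 g4] := G_bX XU.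
  apply/andP; split.
    by rewrite (le_trans _ g1)// -mulrA ler_pM2l// mulrC ler_pdivrMr// mulrC.
  by rewrite (le_trans g2)// -mulrA ler_pM2l.
exists B, (1 / (2 * P)), (p / 50), (P * 50); split.
- have [s l] := sB; split => // U XU.
  have /andP[+ _] := BE _ XU; apply: le_trans.
  by rewrite mulr_ge0// ?divr_ge0 ?(ltW p0)// (sip_ge0 (@bX_sip R)).
- by rewrite divr_gt0// mulr_gt0.
- by rewrite divr_gt0.
- by rewrite mulr_gt0.
split=> // V W XW.
case: V => [[[[[[[e e'] Y] z] z'] w] w'] Z] gA; move: (gA).
set V := (e, e', Y, z, z', w, w', Z) : state.
move=> [ex [exx [Yx [zx [zxx [wx [wxx [Zx]]]]]]]].
rewrite aE bE b2E kE.
move=> [[pe pz pw pY pZ] [pex pzx pwx] [[bz0 bz1] [be0 be1] bY0 [bw0 bw1] bZ0] [XV XA] EW].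
case: W XW EW gA => [[[[[[[We We'] WY] Wz] Wz'] Ww_] Ww'] WZ] XW EW gA.
rewrite /compat /= => -[]; rewrite kE => cY0 cZ0.
set W := (We, We', WY, Wz, Wz', Ww_, Ww', WZ) : state.
have [[E1 E2] E3 [E4 E5] [E6 E7] E8] := EW.
have [[He' Hexx] HnYx [[Hz' z'1] Hzxx] [Hw' Hwxx] HnZx] := XA.
have [[WH1 WH2] WH3 [[WH4 _] WH5] [WH6 WH7] WH8] := XW.
have [e'x pe'] := He'; have [z'x pz'] := Hz'; have [w'x pw'] := Hw'.
have [nYxx pnYx] := HnYx; have [nZxx pnZx] := HnZx.
have tocong (F F1 f : fct) : eqH1 F F1 -> prim 0 1 (F1 : R -> R) f -> prim 0 1 (F : R -> R) f.
  by move=> EF; apply: eq_prim => // x /EF.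
have pWe := tocong _ _ _ E1 pe'; have pWz := tocong _ _ _ E4 pz'.
have pWw := tocong _ _ _ E6 pw'; have pWY := tocong _ _ _ E3 pnYx.
have pWZ := tocong _ _ _ E8 pnZx.
have pYx : prim 0 1 (Yx : R -> R) (fun x => - nYxx x).
  by apply: (eq_prim _ _ (primN pnYx)) => // x _; exact: opprK.
have pZx : prim 0 1 (Zx : R -> R) (fun x => - nZxx x).
  by apply: (eq_prim _ _ (primN pnZx)) => // x _; exact: opprK.
have I0 := @itv01_0 R; have I1 := @itv01_1 R.
have WeE : We 0 = e' 0 by exact: E1.
have WYE : WY 0 = - Yx 0 by exact: E3.
have WzE : Wz 0 = z' 0 by exact: E4.
have WwE : Ww_ 0 = w' 0 by exact: E6.
have WwE1 : Ww_ 1 = w' 1 by exact: E6.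
have WZE : WZ 0 = - Zx 0 by exact: E8.
have le' := prim_L2on pe'; have lz' := prim_L2on pz'; have lw' := prim_L2on pw'.
have dY := eqm_deriv pY; have dz := eqm_deriv pz; have de := eqm_deriv pe; have dw := eqm_deriv pw.
have dWY := eqm_deriv pWY; have dWz := eqm_deriv pWz; have dWe := eqm_deriv pWe; have dWw := eqm_deriv pWw.
have dZ := eqm_deriv pZ; have dWZ := eqm_deriv pWZ.
have mWe' := eqm_ae WH2 Hexx E2; have mWz' := eqm_ae WH5 Hzxx E5; have mWw' := eqm_ae WH7 Hwxx E7.
pose yv x := e' x + z' x + - Yx x; pose yv1 x := e'x x + z'x x + nYxx x.
pose xv x := ex x + Yx x + zx x; pose xv1 x := exx x + - nYxx x + zxx x.
have mAvV : eqm (Av V) yv by apply: eqmD (eqmD (eqm_refl le') (eqm_refl lz')) (eqmN dY).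
have mBvV : eqm (Bv V) xv by apply: eqmD (eqmD de dY) dz.
have mAvW : eqm (Av W) xv1.
  apply: (eqm_congr _ _ (eqmD (eqmD mWe' mWz') (eqmN dWY))) => x _ //.
  by rewrite /xv1; ring.
have mBvW : eqm (Bv W) yv1.
  apply: (eqm_congr _ _ (eqmD (eqmD dWe dWY) dWz)) => x _ //.
  by rewrite /yv1; ring.
have pxv : prim 0 1 xv xv1 by exact: primD (primD pex pYx) pzx.
have pyv : prim 0 1 yv yv1.
  apply: (eq_prim _ _ (primD (primD pe' pz') pnYx)) => // x _.
(* Compatibility of [W], read through [Y_t = - Y_x], is the only access to this inflow value. *)
have Yx0 : Yx 0 = c0 * e' 0.
  by apply/eqP; rewrite -eqr_opp -WYE cY0 WeE mulNr.
have svV : sv V = (1 - c0) * e 0 + z 0 by rewrite /sv /= bY0; ring.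
have yv0 : yv 0 = (1 - c0) * e' 0 + z' 0 by rewrite /yv Yx0; ring.
(* The damping [- q eps_t] plus [Y_x = c0 eps_t] gives [(c0 - q) eps_t = b (1 - c0) eps_t], and
   [c1 = a (1 - c0)]: hence v inherits the boundary condition of z. *)
have xv0 : xv 0 = a * sv V + b * yv 0.
  rewrite /xv be0 bz0 Yx0 svV yv0.
  transitivity (a * (1 - c0) * e 0 + a * z 0 + (b * (1 - c0) * e' 0 + b * z' 0)); last by ring.
  by rewrite a1E b1E; ring.
have xv1' : xv 1 = 0 by rewrite /xv be1; ring.
have svW : sv W = yv 0 by rewrite /sv /= WeE WYE WzE /yv; ring.
have I1x (f g : R -> R) : eqm f g -> 'I01 (fun x => f x * 1) = 'I01 g.
  move=> [_ _ H]; rewrite H; last exact: L2on_cst.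
  by apply: eq_int => x _; rewrite mulr1.
have nvW : nv b W = - a * sv V.
  rewrite /nv (I1x _ _ mAvW) -(prim_diff pxv) ?lexx ?ler01// xv1' xv0 svW; ring.
have myv : L2on 0 1 yv by exact: prim_L2on pyv.
have nvV : nv b V = 'I01 (fun x => yv x * 1) + b * sv V.
  rewrite /nv; congr (_ + _); have [_ _ ->] := mAvV; first by [].
  exact: L2on_cst.
have yxv : yv 1 * xv 1 = 0 by rewrite xv1' mulr0.
have dissv := damp_form dis1 mAvV mBvV mAvW mBvW pxv pyv yxv xv0 svW nvV
  (NN _ _ c1c o1 myv) nvW (lexx a).
have mAzW : eqm (Az W) zxx by exact: mWz'.
have mBzW : eqm (Bz W) z'x by exact: dWz.
have mAzV : eqm (Az V) z' by exact: eqm_refl.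
have mBzV : eqm (Bz V) zx by exact: dz.
(* Integrating by parts against [1 - x], the condition [z(1) = 0] leaves an extra [- z(0)], hence
   [a + 1] instead of [a]. *)
have nzW : nz b W = - (a + 1) * sz V.
  rewrite /nz /sz /= WzE; have [_ _ ->] := mAzW; last exact: L2on_cont c1x.
  have := prim_ibp ler01 (prim_affine 1) pzx.
  rewrite (@eq_int _ 0 1 (fun x => -1 * zx x) (fun x => - zx x)); last by move=> x _; ring.
  rewrite intN; last exact: L2on_L1 (prim_L2 pz).
  rewrite -(prim_diff pz) ?lexx ?ler01// bz1 bz0 subrr mul0r subr0 mul1r.
  rewrite (@eq_int _ 0 1 (fun x => (1 - x) * zxx x) (fun x => zxx x * (1 - x))); last by move=> x _; ring.
  by move=> E; clear -E; lra.
have yxz : z' 1 * zx 1 = 0 by rewrite z'1 mul0r.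
have aa1 : a <= a + 1 by rewrite lerDl.
have dissz := damp_form dis1 mAzV mBzV mAzW mBzW pzx pz' yxz bz0 WzE (erefl (nz b V))
  (NN _ _ c1x o2 lz') nzW aa1.
have mAwW : eqm (Aw W) wxx by exact: mWw'.
have mBwW : eqm (Bw W) w'x by exact: dWw.
have mAwV : eqm (Aw V) w' by exact: eqm_refl.
have mBwV : eqm (Bw V) wx by exact: dw.
have nwW : nw b2 W = - c3 * tw V - c1 * e 0.
  rewrite /nw (I1x _ _ mAwW) -(prim_diff pwx) ?lexx ?ler01// /sw /tw /= WwE bw0 bw1; ring.
have tsw : (tw V - sw V) ^+ 2 <= sqn wx.
  by apply: (trace_sqr pw); rewrite ?lexx ?ler01.
have dissw := robin_form dis2 mAwV mBwV mAwW mBwW pwx pw' bw1 bw0 WwE WwE1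
  (erefl (nw b2 V)) (NN _ _ c1c o1 lw') tsw nwW.
have mAYV : eqm (AY V) Y by exact: eqm_refl (prim_L2on pY).
have mAZV : eqm (AZ V) Z by exact: eqm_refl (prim_L2on pZ).
have mAYW : eqm (AY W) (fun x => - Yx x).
  apply: (eqm_congr _ _ (eqm_refl (L2onN (prim_L2 pY)))) => x hx //; exact: E3.
have mAZW : eqm (AZ W) (fun x => - Zx x).
  apply: (eqm_congr _ _ (eqm_refl (L2onN (prim_L2 pZ)))) => x hx //; exact: E8.
have mBYW : eqm (BY W) (fun x => - (- nYxx x)).
  by apply: (eqm_congr _ _ dWY) => x hx //; rewrite opprK.
have mBZW : eqm (BZ W) (fun x => - (- nZxx x)).
  by apply: (eqm_congr _ _ dWZ) => x hx //; rewrite opprK.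
have dissY := tform_gen mAYV (dY : eqm (BY V) Yx) mAYW mBYW pY pYx.
have dissZ := tform_gen mAZV (dZ : eqm (BZ V) Zx) mAZW mBZW pZ pZx.
have Zx0 : Zx 0 = ka * w' 0.
  by apply/eqP; rewrite -eqr_opp -WZE cZ0 WwE mulNr.
have sqE (f g : R -> R) : eqm f g -> sqn f = sqn g.
  move=> [lf lg H]; rewrite /sqn.
  transitivity ('I01 (fun x => f x * g x)).
    transitivity ('I01 (fun x => f x * f x)); first by apply: eq_int => x _; rewrite expr2.
    by rewrite H//; apply: eq_int => x _; rewrite mulrC.
  by rewrite H//; apply: eq_int => x _; rewrite expr2.
have GE : G V = sqn yv + sqn xv + sv V ^+ 2 + (sqn z' + sqn zx + sz V ^+ 2)
    + (sqn w' + sqn wx + sw V ^+ 2) + (sqn Y + sqn Yx) + (sqn Z + sqn Zx).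
  rewrite /G /Gv /Gz /Gw /GY /GZ (sqE _ _ mAvV) (sqE _ _ mBvV) (sqE _ _ mAzV) (sqE _ _ mBzV).
  rewrite (sqE _ _ mAwV) (sqE _ _ mBwV) (sqE _ _ mAYV) (sqE _ _ mAZV).
  by rewrite (sqE _ _ (dY : eqm (BY V) Yx)) (sqE _ _ (dZ : eqm (BZ V) Zx)).
have LE : L * k1 = 2 * r * (M * K2 * c1 ^+ 2 + c0 ^+ 2) + 1 by rewrite divfK// gt_eqF.
have ME : M * k2 = ka ^+ 2 + 1 by rewrite divfK// gt_eqF.
have rE : r * (1 - c0) ^+ 2 = 1 by rewrite mulVf// sqrf_eq0.
have sub2 (x y u : R) : (1 - c0) * u = x - y -> u ^+ 2 <= 2 * r * (x ^+ 2 + y ^+ 2).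
  move=> E; have -> : u ^+ 2 = r * ((1 - c0) * u) ^+ 2 by rewrite exprMn mulrA rE mul1r.
  rewrite E [2 * r]mulrC -mulrA ler_wpM2l//.
  rewrite -subr_ge0 (_ : _ - _ = (x + y) ^+ 2) ?sqr_ge0//; ring.
have he : e 0 ^+ 2 <= 2 * r * (sv V ^+ 2 + sz V ^+ 2).
  by apply: sub2; rewrite svV /sz /=; ring.
have hp : e' 0 ^+ 2 <= 2 * r * (yv 0 ^+ 2 + z' 0 ^+ 2).
  by apply: sub2; rewrite yv0; ring.
have hY : TY V W <= c0 ^+ 2 * e 0 ^+ 2 + c0 ^+ 2 * e' 0 ^+ 2 - (sqn Y + sqn Yx) / 2.
  apply: (le_trans dissY); rewrite bY0 Yx0.
  by rewrite le_eqVlt; apply/orP; left; apply/eqP; rewrite /sqn; ring.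
have hZ : TZ V W <= ka ^+ 2 * sw V ^+ 2 + ka ^+ 2 * w' 0 ^+ 2 - (sqn Z + sqn Zx) / 2.
  apply: (le_trans dissZ); rewrite bZ0 Zx0 /sw /=.
  by rewrite le_eqVlt; apply/orP; left; apply/eqP; rewrite /sqn; ring.
have hw : Fw V W <= - k2 * (w' 0 ^+ 2 + (sqn w' + sqn wx) + sw V ^+ 2) + K2 * (c1 ^+ 2 * e 0 ^+ 2).
  by rewrite -exprMn.
have MKc : 0 <= M * K2 * c1 ^+ 2 by rewrite mulr_ge0 ?sqr_ge0// ltW.
have main := dissipation_sum (And4 (ltW L0) (ltW M0) r0 MKc)
  (And3 (addr_ge0 (sqn_ge0 _) (sqn_ge0 _)) (addr_ge0 (sqn_ge0 _) (sqn_ge0 _)) (addr_ge0 (sqn_ge0 _) (sqn_ge0 _)))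
  (And4 (sqr_ge0 _) (sqr_ge0 _) (sqr_ge0 _) (sqr_ge0 _))
  (And4 (sqr_ge0 _) (sqr_ge0 _) (addr_ge0 (sqn_ge0 _) (sqn_ge0 _)) (addr_ge0 (sqn_ge0 _) (sqn_ge0 _)))
  LE ME erefl dissv dissz hw hY hZ he hp.
apply: (le_trans main); rewrite -GE.
have [_ BP] := BG _ XV.
have {}BP : P^-1 * B V V <= G V by rewrite ler_pdivrMl.
have -> : - (1 / (2 * P)) * B V V = - (1 / 2) * (P^-1 * B V V).
  by field; rewrite gt_eqF.
by rewrite !mulNr lerN2 ler_pM2l// divr_gt0.
Qed.

End lyapunov_system.

(** * Decay and uniqueness *)

Arguments normX : simpl never.
Arguments bX : simpl never.
Arguments inX : simpl never.

Section generator_linear.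
Context {R : realType}.
Notation mu := (@lebesgue_measure R).
Notation state := (state R).
Notation fct := (fct R).
Implicit Types (U V W : state).

Lemma eqH1_lin k (f f1 g g1 : fct) : eqH1 f f1 -> eqH1 g g1 ->
  eqH1 (k *: f + g) (k *: f1 + g1).
Proof. by move=> Ef Eg x x01; rewrite !fct_linE Ef// Eg. Qed.

Lemma eqL2_lin k (f f1 g g1 : fct) : eqL2 f f1 -> eqL2 g g1 ->
  eqL2 (k *: f + g) (k *: f1 + g1).
Proof.
move=> Ef Eg; apply: (@filterS2 _ _ (ae_filter_ringOfSetsType mu) _ _ _ _ Ef Eg) => x hf hg x01.
by rewrite !fct_linE hf// hg.
Qed.

Lemma eqX_lin k U U1 V V1 : eqX U U1 -> eqX V V1 -> eqX (k *: U + V) (k *: U1 + V1).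
Proof.
case: U => [[[[[[[e e'] Y] z] z'] w] w'] Z]; case: U1 => [[[[[[[e1 e1'] Y1] z1] z1'] w1] w1'] Z1].
case: V => [[[[[[[f f'] fY] fz] fz'] fw] fw'] fZ]; case: V1 => [[[[[[[f1 f1'] fY1] fz1] fz1'] fw1] fw1'] fZ1].
rewrite !state_lin.
move=> [[a1 a2] a3 [a4 a5] [a6 a7] a8] [[b1 b2] b3 [b4 b5] [b6 b7] b8].
have c1 := eqH1_lin k a1 b1; have c2 := eqL2_lin k a2 b2.
have c3 := eqH1_lin k a3 b3; have c4 := eqH1_lin k a4 b4.
have c5 := eqL2_lin k a5 b5; have c6 := eqH1_lin k a6 b6.
have c7 := eqL2_lin k a7 b7; have c8 := eqH1_lin k a8 b8.
by split.
Qed.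

Lemma genA_lin q c0 c1 c2 c3 k (V1 V2 W1 W2 : state) :
  genA q c0 c1 c2 c3 V1 W1 -> genA q c0 c1 c2 c3 V2 W2 ->
  genA q c0 c1 c2 c3 (k *: V1 + V2) (k *: W1 + W2).
Proof.
case: V1 => [[[[[[[e e'] Y] z] z'] w] w'] Z]; case: V2 => [[[[[[[f f'] fY] fz] fz'] fw] fw'] fZ].
move=> [ex [exx [Yx [zx [zxx [wx [wxx [Zx]]]]]]]].
move=> [[pe pz pw pY pZ] [pex pzx pwx] [[bz0 bz1] [be0 be1] bY0 [bw0 bw1] bZ0] [XV XA] EW].
move=> [fx [fxx [fYx [fzx [fzxx [fwx [fwxx [fZx]]]]]]]].
move=> [[qe qz qw qY qZ] [qex qzx qwx] [[dz0 dz1] [de0 de1] dY0 [dw0 dw1] dZ0] [fXV fXA] fEW].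
have XS := inX_linsub.2 k _ _ XV fXV; have XAS := inX_linsub.2 k _ _ XA fXA.
have ES := eqX_lin k EW fEW.
rewrite state_lin in XS *; rewrite !state_lin in XAS ES.
rewrite !scalerN -!opprD in XAS ES.
exists (k *: ex + fx), (k *: exx + fxx), (k *: Yx + fYx), (k *: zx + fzx), (k *: zxx + fzxx),
  (k *: wx + fwx), (k *: wxx + fwxx), (k *: Zx + fZx).
split; last exact: ES.
- by split; apply: prim_lin.
- by split; apply: prim_lin.
- rewrite !fct_linE bz0 bz1 be0 be1 bY0 bw0 bw1 bZ0 dz0 dz1 de0 de1 dY0 dw0 dw1 dZ0.
  by split; try split; ring.
- by split.
Qed.

End generator_linear.

Lemma sum13_ge {R : realFieldType} (a1 a2 a3 a4 a5 a6 a7 a8 a9 a10 a11 a12 a13 s : R) :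
  0 <= a1 -> 0 <= a2 -> 0 <= a3 -> 0 <= a4 -> 0 <= a5 -> 0 <= a6 -> 0 <= a7 -> 0 <= a8 ->
  0 <= a9 -> 0 <= a10 -> 0 <= a11 -> 0 <= a12 -> 0 <= a13 ->
  s = a1 + a2 + a3 + (a4 + a5) + (a6 + a7) + a8 + (a9 + a10) + a11 + (a12 + a13) ->
  [/\ a1 + a2 <= s, a4 + a5 <= s, a9 + a10 <= s & a12 + a13 <= s].
Proof. by move=> *; split; lra. Qed.

Section mild.
Context {R : realType}.
Notation state := (state R).
Notation X := (@inX R).
Notation b := (@bX R).
Variables q c0 c1 c2 c3 : R.
Implicit Types (U V W : state).
Notation mildA := (mildlike X b (genA q c0 c1 c2 c3)).

Lemma continuous_path_cpath (U : R -> state) : continuous_path U -> cpath X b U.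
Proof.
move=> [XU cU]; split => // t0 e t00 e0.
have /cvgrPdist_lt/(_ _ e0) := cU t0 t00.
move=> [d /= d0 Hd]; exists d => // t t0' td.
have := Hd t; rewrite /= distrC => /(_ td); rewrite in_itv/= andbT => /(_ t0').
by rewrite normXB sub0r normrN ger0_norm// nrm_ge0.
Qed.

Lemma is_integralE (U : R -> state) (t : R) V : is_integral U t V <-> integral_of X b U t V.
Proof.
rewrite /is_integral; have -> : (fun n => normX (\sum_(k < n) (t / n%:R) *: U (k%:R * t / n%:R) - V)) =
    (fun n => nrm b (lriemann U t V n)).
  by apply/funext => n; rewrite state_lriemann; exact: normXE.
by [].
Qed.

Lemma mild_mildlike U0 (U : R -> state) : mild_solution q c0 c1 c2 c3 U0 U -> mildA U.
Proof.
move=> [cU _ iU]; split; first exact: continuous_path_cpath.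
move=> t t0; have [V [iV gV]] := iU t t0; exists V.
by rewrite state_lsub in gV; exact: (conj ((is_integralE _ _ _).1 iV) gV).
Qed.

Lemma mild_solution_eq0 (U0 : state) (U1 U2 : R -> state) : X U0 ->
  mild_solution q c0 c1 c2 c3 U0 U1 -> mild_solution q c0 c1 c2 c3 U0 U2 ->
  nrm b (lsub (U1 0) (U2 0)) = 0.
Proof.
move=> X0 [k1 e1 _] [k2 e2 _].
have x1 := k1.1 0 (lexx _); have x2 := k2.1 0 (lexx _).
have n1 := eqX_normX0 x1 X0 e1; have n2 := eqX_normX0 x2 X0 e2.
rewrite normXB in n1; rewrite normXB in n2.
exact: (nrm_eq0_sub (@inX_linsub R) (@bX_sip R) x1 x2 X0 n1 n2).
Qed.

Lemma bX_traces U : X U ->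
  [/\ `|ceps U 0| <= 2 * nrm b U, `|cY U 0| <= 2 * nrm b U, `|cw U 0| <= 2 * nrm b U
    & `|cZ U 0| <= 2 * nrm b U].
Proof.
move=> XU; have [[h1 _] h3 [[h4 _] _] [h6 _] h8] := inXP XU.
have hb := @bX_sip R.
have K (f : fct R) (y : R) : H1 f -> sqn f + sqn (deriv_of f) <= y -> f 0 ^+ 2 <= 2 * y.
  move=> /deriv_ofP Hf Hy; rewrite (le_trans (trace_L2 Hf (@itv01_0 R)))// -mulrDr ler_pM2l//.
have F (f : fct R) : H1 f -> sqn f + sqn (deriv_of f) <= b U U -> `|f 0| <= 2 * nrm b U.
  move=> Hf Hy; apply: norm_le_sqr; first by rewrite mulr_ge0 ?nrm_ge0.
  rewrite exprMn (nrm_sqr hb XU) (le_trans (K _ _ Hf Hy))// ler_wpM2r ?(sip_ge0 hb XU)//.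
  by rewrite expr2; lra.
have qq := @sqn_ge0 R.
have E := bXE U.
rewrite /GY /GZ -[Az U]/(cz' U : R -> R) -[Bz U]/(deriv_of (cz U) : R -> R) -[Aw U]/(cw' U : R -> R) in E.
rewrite -[Bw U]/(deriv_of (cw U) : R -> R) -[AY U]/(cY U : R -> R) -[BY U]/(deriv_of (cY U) : R -> R) in E.
rewrite -[AZ U]/(cZ U : R -> R) -[BZ U]/(deriv_of (cZ U) : R -> R) in E.
have P := sum13_ge (qq (ceps U)) (qq (deriv_of (ceps U))) (qq (ceps' U)) (qq (cY U))
  (qq (deriv_of (cY U))) (qq (cz U)) (qq (deriv_of (cz U))) (qq (cz' U)) (qq (cw U))
  (qq (deriv_of (cw U))) (qq (cw' U)) (qq (cZ U)) (qq (deriv_of (cZ U))) E.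
case: P => p1 p2 p3 p4.
by split; [exact: (F _ h1 p1)|exact: (F _ h3 p2)|exact: (F _ h6 p3)|exact: (F _ h8 p4)].
Qed.

Lemma genAB V1 V2 W1 W2 : genA q c0 c1 c2 c3 V1 W1 -> genA q c0 c1 c2 c3 V2 W2 ->
  genA q c0 c1 c2 c3 (lsub V1 V2) (lsub W1 W2).
Proof.
have E (U V : state) : -1 *: V + U = lsub U V.
  case: U => [[[[[[[e e'] Y] z] z'] w] w'] Z]; case: V => [[[[[[[f f'] fY] fz] fz'] fw] fw'] fZ].
  have F (g h : fct R) : -1 *: h + g = g - h by rewrite scaleN1r addrC.
  by rewrite state_lin lsub_tuple !F.
by move=> g1 g2; have := genA_lin (-1) g2 g1; rewrite !E.
Qed.

(** Defects of the compatibility conditions, which trace bounds make bounded functionals as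
    [mildlike_decay] requires. *)
Definition compatY U : R := cY U 0 + c0 * ceps U 0.
Definition compatZ U : R := cZ U 0 + c2 / (1 - c2) * cw U 0.

Lemma compat_linfun :
  [/\ linform X compatY, linform X compatZ &
   exists2 K : R, 0 <= K & forall U, X U -> `|compatY U| <= K * nrm b U /\ `|compatZ U| <= K * nrm b U].
Proof.
have [[l1 l2] l3 [l4 l5] [l6 l7] l8] := @clins R.
split.
- by move=> k U V _ _; rewrite /compatY l3 l1 !fct_linE; ring.
- by move=> k U V _ _; rewrite /compatZ l8 l6 !fct_linE; ring.
exists (2 + 2 * `|c0| + 2 * `|c2 / (1 - c2)|); first by rewrite !addr_ge0 ?mulr_ge0.
move=> U XU; have [h1 h2 h3 h4] := bX_traces XU.
have n0 := nrm_ge0 b U.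
split; rewrite (le_trans (ler_normD _ _))// normrM.
- have := ler_wpM2l (normr_ge0 c0) h1; have := mulr_ge0 (normr_ge0 (c2 / (1 - c2))) n0.
  move: (nrm b U) (`|c0|) (`|c2 / (1 - c2)|) (`|ceps U 0|) (`|cY U 0|) h2 => N x y z w; lra.
- have := ler_wpM2l (normr_ge0 (c2 / (1 - c2))) h3; have := mulr_ge0 (normr_ge0 c0) n0.
  move: (nrm b U) (`|c0|) (`|c2 / (1 - c2)|) (`|cw U 0|) (`|cZ U 0|) h4 => N x y z w; lra.
Qed.

Lemma genA_compat V W : genA q c0 c1 c2 c3 V W -> compatY V = 0 /\ compatZ V = 0.
Proof.
case: V => [[[[[[[e e'] Y] z] z'] w] w'] Z].
move=> [ex [exx [Yx [zx [zxx [wx [wxx [Zx]]]]]]]].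
move=> [_ _ [_ _ bY0 _ bZ0] _ _].
by rewrite /compatY /compatZ /= bY0 bZ0; split; ring.
Qed.

Lemma mild_decay : 0 < c1 / (1 - c0) -> 0 < (c0 - q) / (1 - c0) ->
  0 < (c2 - q) / (1 - c2) -> 0 < c3 ->
  exists M m : R, [/\ 0 < M, 0 < m & forall U : R -> state, mildA U -> forall t : R, 0 <= t ->
    nrm b (U t) <= M * expR (- m * t) * nrm b (U 0)].
Proof.
move=> h1 h2 h3 h4.
have [B [m [c [C [sB m0 c_0 C0 [BE diss]]]]]] := lyapunov_form h1 h2 h3 h4.
have [lY lZ [K K0 HK]] := compat_linfun.
have := @mildlike_decay R _ X b _ (@inX_linsub R) (@bX_sip R) genAB B m c C K
  [:: compatY; compatZ] sB m0 c_0 C0 K0 BE _ _ _.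
case.
- by move=> f /= [<-|[<-|//]]; split => // u Xu; have [] := HK u Xu.
- by move=> V W f /genA_compat[? ?] /= [<-|[<-|//]].
- move=> V W XW gA cW; apply: diss => //.
  have y0 := cW compatY (or_introl erefl).
  have z0 := cW compatZ (or_intror (or_introl erefl)).
  split; [move: y0; rewrite /compatY|move: z0; rewrite /compatZ] => E; apply/eqP;
    by rewrite -subr_eq0 mulNr opprK E.
- by move=> M M0 HM; exists M, m; split.
Qed.

Lemma mild_unique U0 (U1 U2 : R -> state) :
  0 < c1 / (1 - c0) -> 0 < (c0 - q) / (1 - c0) -> 0 < (c2 - q) / (1 - c2) -> 0 < c3 ->
  X U0 -> mild_solution q c0 c1 c2 c3 U0 U1 -> mild_solution q c0 c1 c2 c3 U0 U2 ->
  forall t : R, 0 <= t -> eqX (U1 t) (U2 t).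
Proof.
move=> h1 h2 h3 h4 X0 m1 m2 t t0.
have [M [m [_ _ HM]]] := mild_decay h1 h2 h3 h4.
have n1 := mild_mildlike m1; have n2 := mild_mildlike m2.
have := HM (fun s => lsub (U1 s) (U2 s))
  (mildlikeB (@inX_linsub R) (@bX_sip R) genAB n1 n2) t t0.
rewrite (mild_solution_eq0 X0 m1 m2) mulr0 => H.
apply: normX0_eqX; [exact: n1.1.1|exact: n2.1.1|].
by rewrite normXB; apply/eqP; rewrite eq_le H nrm_ge0.
Qed.

End mild.

(** * Translations in L^2 *)

Section affine_change.
Context {R : realType}.
Notation mu := (@lebesgue_measure R).
Implicit Types (a b c d t x y : R) (f g F G : R -> R).

(** Shifts and the reflection both qualify, so one change of variables serves waves travelling in
    either direction. *)
Definition mpres (phi : measurableTypeR R -> measurableTypeR R) :=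
  measurable_fun setT phi /\
  forall A, measurable A -> pushforward mu phi A = mu A.

Lemma mpresN : mpres (-%R : R -> R).
Proof. by split; [exact: oppr_measurable|exact: lebesgue_measureN]. Qed.

(** The translated measure agrees with Lebesgue measure on half-open intervals, hence everywhere by
    uniqueness. *)
Lemma mpres_shift t : mpres (fun x => t + x : R).
Proof.
have mphi : measurable_fun setT (fun x => t + x : R).
  by apply: measurable_funD.
split => // A mA.
pose phi : measurableTypeR R -> measurableTypeR R := fun x => t + x : R.
pose mphi_mixin := isMeasurableFun.Build _ _ (measurableTypeR R) (measurableTypeR R) phi mphi.
pose mphi_pack : {mfun measurableTypeR R >-> measurableTypeR R} := HB.pack phi mphi_mixin.
apply/esym/(@lebesgue_measure_unique R (pushforward mu mphi_pack)) => // _ [[a b]] _ <-.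
rewrite /= /pushforward (_ : _ @^-1` _ = `]a - t, b - t]%classic); last first.
  by apply/seteqP; split => x /=; rewrite !in_itv/= ltrBlDl lerBrDl.
by rewrite !lebesgue_measure_itv/= !lte_fin ltrD2r -!EFinB opprB addrA subrK.
Qed.

Section comp.
Variables (phi : R -> R) (a b c d : R).
Hypotheses (hphi : mpres phi) (pre : forall x, (a <= x <= b) = (c <= phi x <= d)).

Let preE : phi @^-1` `[c, d] = `[a, b]%classic.
Proof. by apply/seteqP; split => x /=; rewrite !in_itv/= pre. Qed.

Let int_comp_ge0 (f : R -> \bar R) : measurable_fun `[c, d] f -> (forall x, 0 <= f x)%E ->
  (\int[mu]_(x in `[a, b]) f (phi x) = \int[mu]_(x in `[c, d]) f x)%E.
Proof.
move=> mf f0; rewrite -preE -(@ge0_integral_pushforward _ _ _ _ _ _ hphi.1)//=.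
apply: eq_measure_integral; first exact: hphi.1.
by move=> ? A mA _; exact: hphi.2.
Qed.

Lemma meas_comp (f : R -> R) : measurable_fun `[c, d] f ->
  measurable_fun `[a, b] (fun x => f (phi x)).
Proof.
move=> mf; apply: (@measurable_comp _ _ _ (measurableTypeR R) (measurableTypeR R) (measurableTypeR R) `[c, d] f _ phi) => //.
  by move=> _ [x/= xab <-]; move: xab; rewrite !in_itv/= pre.
exact: measurable_funTS hphi.1.
Qed.

Lemma L1on_comp f : L1on c d f -> L1on a b (fun x => f (phi x)).
Proof.
move=> lf; have mf := L1on_meas lf.
apply/integrableP; split; first by apply/measurable_EFinP; exact: meas_comp mf.
case/integrableP : lf => mf' lf.
rewrite (int_comp_ge0 (f := fun x => `|(f x)%:E|%E))//.
exact: measurableT_comp.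
Qed.

Lemma L2on_comp f : L2on c d f -> L2on a b (fun x => f (phi x)).
Proof.
by move=> [mf lf]; split; [exact: meas_comp|exact: (L1on_comp lf)].
Qed.

Lemma int_comp f : L1on c d f -> intg a b (fun x => f (phi x)) = intg c d f.
Proof.
move=> lf; have mf : measurable_fun `[c, d] (EFin \o f).
  by apply/measurable_EFinP; exact: (L1on_meas lf).
rewrite /intg /Rintegral; congr fine.
rewrite integralE [RHS]integralE; congr (_ - _)%E.
  rewrite -(int_comp_ge0 (measurable_funepos mf)); last exact: funepos_ge0.
  by apply: eq_integral => x _; rewrite !funeposE.
rewrite -(int_comp_ge0 (measurable_funeneg mf)); last exact: funeneg_ge0.
by apply: eq_integral => x _; rewrite !funenegE.
Qed.

End comp.

Lemma L2on_shift a b t f : L2on (t + a) (t + b) f -> L2on a b (fun x => f (t + x)).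
Proof. by apply: L2on_comp; [exact: mpres_shift|move=> x; rewrite !lerD2l]. Qed.

Lemma int_shift a b t f : L1on (t + a) (t + b) f ->
  intg a b (fun x => f (t + x)) = intg (t + a) (t + b) f.
Proof. by apply: int_comp; [exact: mpres_shift|move=> x; rewrite !lerD2l]. Qed.

Lemma L2on_opp a b f : L2on (- b) (- a) f -> L2on a b (fun x => f (- x)).
Proof. by apply: L2on_comp; [exact: mpresN|move=> x; rewrite !lerN2 andbC]. Qed.

Lemma int_opp a b f : L1on (- b) (- a) f ->
  intg a b (fun x => f (- x)) = intg (- b) (- a) f.
Proof. by apply: int_comp; [exact: mpresN|move=> x; rewrite !lerN2 andbC]. Qed.

Lemma prim_shift a b t F f : prim (t + a) (t + b) F f ->
  prim a b (fun x => F (t + x)) (fun x => f (t + x)).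
Proof.
move=> Ff; apply: primI; first exact: L2on_shift (prim_L2 Ff).
move=> x y ax xy yb.
rewrite (prim_diff Ff) ?lerD2l//; apply/esym/int_shift.
by apply: L2on_L1; apply: L2on_sub (prim_L2 Ff) _ _; rewrite lerD2l.
Qed.

Lemma prim_opp a b F f : prim (- b) (- a) F f ->
  prim a b (fun x => F (- x)) (fun x => - f (- x)).
Proof.
move=> Ff; have l2 := prim_L2 Ff.
apply: primI; first exact/L2onN/L2on_opp.
move=> x y ax xy yb.
have l1 : L1on (- y) (- x) f.
  by apply: L2on_L1; apply: L2on_sub l2 _ _; rewrite lerN2.
rewrite intN; last first.
  by apply: L2on_L1; apply: L2on_opp; apply: L2on_sub l2 _ _; rewrite lerN2.
by rewrite int_opp// -(prim_diff Ff) ?lerN2// opprB.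
Qed.

End affine_change.

(** * Continuous approximation and continuity of translations *)

Section density.
Context {R : realType}.
Notation mu := (@lebesgue_measure R).
Implicit Types (a b c d e t x y N : R) (f g F G : R -> R).

(** Truncation to [[-N, N]], written with absolute values to make continuity and the Lipschitz bound
    immediate. *)
Definition clip N y : R := (`|y + N| - `|y - N|) / 2.

Lemma clip_bound N y : 0 <= N -> `|clip N y| <= N.
Proof.
rewrite /clip => N0; have [h1|h1] := ger0P (y + N); have [h2|h2] := ger0P (y - N);
  rewrite ler_norml; apply/andP; split; lra.
Qed.

Lemma clip_lip N y z : `|clip N y - clip N z| <= `|y - z|.
Proof.
have h1 : `|(`|y + N| - `|z + N|)| <= `|y - z|.
  by rewrite (le_trans (ler_dist_dist _ _))// opprD addrACA subrr addr0.
have h2 : `|(`|y - N| - `|z - N|)| <= `|y - z|.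
  by rewrite (le_trans (ler_dist_dist _ _))// opprB addrA subrK.
move: h1 h2; rewrite /clip !ler_norml => /andP[? ?] /andP[? ?].
by apply/andP; split; lra.
Qed.

Lemma clip_id N y : `|y| <= N -> clip N y = y.
Proof.
rewrite ler_norml /clip => /andP[h1 h2].
by rewrite ger0_norm ?ler0_norm; lra.
Qed.

Lemma clip_continuous N : continuous (clip N).
Proof.
move=> y; apply: cvgMl; apply: cvgB; apply: cvg_norm;
  [apply: cvgD|apply: cvgB]; by [exact: cvg_id|exact: cvg_cst].
Qed.

Lemma clip_meas a b N f : measurable_fun (`[a, b] : set R) f ->
  measurable_fun `[a, b] (fun x => clip N (f x)).
Proof.
move=> mf; apply: measurableT_comp => //.
exact: continuous_measurable_fun (@clip_continuous N).
Qed.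

Lemma clip_res N y : 0 <= N -> (y - clip N y) ^+ 2 <= y ^+ 2.
Proof.
rewrite /clip => N0; have [h1|h1] := ger0P (y + N); have [h2|h2] := ger0P (y - N); nra.
Qed.

(** Dominated convergence with bound [f ^ 2]; at each point the residual is eventually 0. *)
Lemma clip_cvg a b f e : L2on a b f -> 0 < e ->
  exists2 N, 0 <= N & intg a b (fun x => (f x - clip N (f x)) ^+ 2) <= e.
Proof.
move=> lf e0.
have mD (n : nat) : measurable_fun (`[a, b] : set R) (fun x => (f x - clip n%:R (f x)) ^+ 2).
  apply: measurable_funX; apply: measurable_funB; first exact: L2on_meas lf.
  exact: clip_meas (L2on_meas lf).
pose D (n : nat) (x : measurableTypeR R) := ((f x - clip n%:R (f x)) ^+ 2)%:E.
have D0 : \forall x \ae mu, `[a, b]%classic x -> D n x @[n --> \oo] --> cst (0%E : \bar R) x.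
  apply: aeW => x _; apply: cvg_near_cst; near=> n.
  rewrite /D clip_id ?subrr ?expr0n//.
  near: n; exact: nbhs_infty_ger.
have D1 n : measurable_fun (`[a, b] : set R) (D n).
  exact: (proj2 (measurable_EFinP _ _) (mD n)).
have D2 : \forall x \ae mu, forall n, `[a, b]%classic x -> (`|D n x| <= (f x ^+ 2)%:E)%E.
  apply: aeW => x n _.
  by rewrite gee0_abs ?lee_fin ?sqr_ge0// clip_res.
have [_ _] := @dominated_convergence _ _ R mu _ (measurable_itv _) D _ _ D1 (measurable_cst _) D0 (L2on_sqr lf) D2.
rewrite integral0 => /fine_cvgP[_].
move=> /cvgrPdist_le /(_ e e0) [n _ /(_ n (leqnn n))].
rewrite /= sub0r normrN => h; exists n%:R => //.
exact: le_trans (ler_norm _) h.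
Unshelve. all: by end_near.
Qed.

(** Truncation upgrades L^1 approximation to L^2: for functions bounded by [N] the squared
    difference is at most [2 * N] times the absolute one. Truncating the approximant keeps it
    continuous and, [clip] being 1-Lipschitz, brings it no farther from the truncated [f]. *)
Lemma L2_dense a b f e : L2on a b f -> 0 < e ->
  exists2 g : R -> R, continuous g & intg a b (fun x => (f x - g x) ^+ 2) <= e.
Proof.
move=> lf e0.
have e2 : 0 < e / 4 by rewrite divr_gt0.
have [N N0 hN] := clip_cvg lf e2.
pose fN x := clip N (f x).
have bfN x : `|fN x| <= N by exact: clip_bound.
have lfN : L2on a b fN.
  exact: (le_L2on (clip_meas N (L2on_meas lf)) (fun x _ => bfN x) (L2on_cst a b N)).
have Efin : (mu `[a, b] < +oo)%E.
  by rewrite /= lebesgue_measure_itv/=; case: ifP => _; rewrite ?ltry.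
have [g_ [cg lg]] := approximation_continuous_integrable (measurable_itv _) Efin (L2on_L1 lfN).
move=> /fine_cvgP[_] /cvgrPdist_le.
(* Then [2 * N * d <= e / 4]; with the [e / 4] of the truncation, and the factor 2 from splitting
   the square, the total is [e]. *)
pose d := e / (8 * (N + 1)).
have d0 : 0 < d by rewrite divr_gt0// mulr_gt0//; lra.
move=> /(_ d d0) [n _ /(_ n (leqnn n))].
rewrite /= sub0r normrN => /(le_trans (ler_norm _)) h.
pose g := g_ n; pose gN x := clip N (g x).
have {}h : intg a b (fun x => `|fN x - g x|) <= d by exact: h.
have {}lg : L1on a b g by exact: lg.
have cgN : continuous gN.
  by move=> x; apply: (@continuous_comp _ _ _ g (clip N)); [exact: (cg n)|exact: clip_continuous].
exists gN => //.
have lgN : L2on a b gN by apply: L2on_cont; exact: continuous_subspaceT.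
have l1 := L1on_norm (L1onB (L2on_L1 lfN) lg).
have h2 : intg a b (fun x => (fN x - gN x) ^+ 2) <= 2 * N * d.
  rewrite (le_trans (le_int (L2on_sqr (L2onB lfN lgN)) (L1onZ (2 * N) l1) _))//.
    move=> x _.
    have h1 : `|fN x - gN x| <= 2 * N.
      by rewrite (le_trans (ler_normB _ _))// mulr_natl mulr2n lerD// clip_bound.
    rewrite -[leLHS]real_normK ?num_real// expr2.
    by rewrite ler_pM// -{1}(clip_id (bfN x)) clip_lip.
  by rewrite intZ// ler_wpM2l// mulr_ge0.
have h3 : 2 * N * d <= e / 4.
  rewrite /d mulrA ler_pdivrMr; last by lra.
  nra.
apply: (@le_trans _ _ (2 * intg a b (fun x => (f x - fN x) ^+ 2) +
  2 * intg a b (fun x => (fN x - gN x) ^+ 2))); last by lra.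
have L1 := L1onZ 2 (L2on_sqr (L2onB lf lfN)).
have L2 := L1onZ 2 (L2on_sqr (L2onB lfN lgN)).
rewrite -intZ ?L2on_sqr//; last exact: L2onB.
rewrite -[X in _ + X]intZ; last exact: L2on_sqr (L2onB lfN lgN).
rewrite -intD//; apply: le_int; [exact: L2on_sqr (L2onB lf lgN)|exact: L1onD|].
move=> x _; have := sqr_ge0 ((f x - fN x) - (fN x - gN x)); nra.
Qed.

Lemma cont_unif a b g e : continuous g -> 0 < e -> exists2 d : R, 0 < d &
  forall x y : R, a <= x -> x <= y -> y <= b -> y - x < d -> `|g y - g x| <= e.
Proof.
move=> cg e0; pose U t := (g (a + t) : R^o).
have cU : cpath (fun _ : R^o => True) rsip U.
  split => // t0 e' _ e'0.
  have /cvgrPdist_lt/(_ e' e'0)[d /= d0 Hd] := cg (a + t0).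
  exists d => // t _ tt0; rewrite rnrm distrC; apply: Hd => /=.
  by rewrite opprD addrACA subrr add0r distrC.
have [d d0 Hd] := cpath_unif (rlinsub (R:=R)) (rsip_sip (R:=R)) (b - a) cU e0.
exists d => // x y ax xy yb yxd.
have := Hd (x - a) (y - a); rewrite rnrm /U !(addrC a) !subrK; apply.
- by rewrite subr_ge0.
- by rewrite lerD2r.
- by rewrite lerD2r.
- by rewrite opprB addrA subrK.
Qed.

Lemma prim_of a b f : L2on a b f -> prim a b (fun x => intg a x f) f.
Proof. by move=> lf; split => // x _; rewrite int_pt add0r. Qed.

(** With [G] the primitive of [f ^ 2], the pointwise bound [h * (G (h + y) - G y)] integrates to [h]
    times a difference of shifted integrals of [G], which reduces to a piece of length [h]. No
    exchange of integrals is needed. *)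
Lemma prim_incr2 a b F f h : prim a (b + 1) F f -> 0 <= h <= 1 -> a <= b ->
  intg a b (fun y => (F (h + y) - F y) ^+ 2) <=
  h ^+ 2 * intg a (b + 1) (fun y => f y ^+ 2).
Proof.
move=> Ff /andP[h0 h1] ab.
have lf := prim_L2 Ff.
pose G x := intg a x (fun y => f y ^+ 2).
have ghb : b + h <= b + 1 by rewrite lerD2l.
have Gm x y : a <= x -> x <= y -> y <= b + 1 -> G x <= G y.
  move=> ax xy yb; apply: (int_mono (L1on_sub (L2on_sqr lf) _ _)) => // z _.
  exact: sqr_ge0.
have lG : L1on a (b + 1) G.
  have ab1 : a <= b + 1 by rewrite (le_trans ab)// lerDl.
  apply: L1on_cont => x.
  exact: (parameterized_integral_continuous ab1 (L2on_sqr lf)).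
have lGs : L1on (h + a) (h + b) G.
  by apply: L1on_sub lG _ _; rewrite ?lerDr// addrC.
have lGh : L1on a b (fun y => G (h + y)).
  by apply: (L1on_comp (mpres_shift h)) lGs => x; rewrite !lerD2l.
have lFh : L2on a b (fun y => F (h + y)).
  apply: L2on_shift; apply: L2on_sub (prim_L2on Ff) _ _; first by rewrite lerDr.
  by rewrite addrC.
have bb1 : b <= b + 1 by rewrite lerDl.
have lG' : L1on a b G by exact: L1on_sub lG _ _.
have lF : L2on a b F by exact: L2on_sub (prim_L2on Ff) _ _.
apply: (@le_trans _ _ (h * (intg a b (fun y => G (h + y)) - intg a b G))).
  rewrite -intB// -intZ; last exact: L1onB.
  apply: le_int; [exact: L2on_sqr (L2onB lFh lF)|exact/L1onZ/L1onB|].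
  move=> y /andP[ay yb].
  have yhy : y <= h + y by rewrite lerDr.
  have hyb : h + y <= b + 1 by rewrite (addrC b) lerD.
  have := prim_sqr_diff Ff ay yhy hyb; rewrite addrK => /le_trans; apply.
  rewrite ler_wpM2l// lerBrDl /G (int_cat ay yhy)//.
  by apply: L1on_sub (L2on_sqr lf) _ _.
rewrite (int_shift lGs) expr2 -mulrA ler_wpM2l//.
have lG2 : L1on a (h + b) G by apply: L1on_sub lG _ _; rewrite // addrC.
have e1 := int_cat (f := G) (a := a) (c := h + a) (b := h + b).
have e2 := int_cat (f := G) (a := a) (c := b) (b := h + b).
move: e1 e2 => /(_ _ _ lG2) e1 /(_ ab _ lG2) e2.
have g0 : 0 <= intg a (h + a) G.
  by apply: int_ge0 => x /andP[ax _]; apply: int_ge0 => y _; exact: sqr_ge0.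
have g1 : intg b (h + b) G <= h * G (b + 1).
  have bhb : b <= h + b by rewrite lerDr.
  have -> : h * G (b + 1) = intg b (h + b) (fun _ => G (b + 1)).
    by rewrite int_cst// addrK mulrC.
  apply: le_int; [|exact: L1on_cst|].
    by apply: L1on_sub lG2 _ _.
  move=> x /andP[bx xb]; apply: Gm; [exact: le_trans bx| |exact: lexx].
  by rewrite (le_trans xb)// addrC.
move: e1 e2; rewrite lerDr lerD2l lerDr h0 ab => /(_ isT isT) e1 /(_ isT) e2.
rewrite -/(G (b + 1)).
by lra.
Qed.

Lemma int_sum3 a b u v w A B C : L2on a b u -> L2on a b v -> L2on a b w ->
  intg a b (fun y => u y ^+ 2) <= A -> intg a b (fun y => v y ^+ 2) <= B ->
  intg a b (fun y => w y ^+ 2) <= C ->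
  intg a b (fun y => (u y + v y + w y) ^+ 2) <= 3 * (A + B + C).
Proof.
move=> lu lv lw hA hB hC; apply: le_trans (int_sqr3 lu lv lw) _.
by rewrite ler_pM2l// !lerD.
Qed.

(** Both estimates compare [f] with a continuous [g]; in the second, [prim_incr2] controls the
    increment of [F] minus the primitive of [g]. Each of the three squared terms costs [e / 9],
    since [int_sum3] has the factor 3. The extra unit of length leaves room for shifts [h <= 1]. *)
Lemma translation_L2 a b f F e : prim a (b + 1) F f -> a <= b -> 0 < e ->
  exists2 d : R, 0 < d <= 1 & forall h, 0 <= h <= d ->
    intg a b (fun y => (f (h + y) - f y) ^+ 2) <= e /\ 
    intg a b (fun y => (F (h + y) - F y - h * f y) ^+ 2) <= e * h ^+ 2.
Proof.
move=> Ff ab e0.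
have lf := prim_L2 Ff.
have e1 : 0 < e / 9 by rewrite divr_gt0.
have [g cg hg] := L2_dense lf e1.
pose eta := Num.min 1 (e / (9 * (b - a + 1))).
have ba : 0 <= b - a by rewrite subr_ge0.
have eta0 : 0 < eta.
  by rewrite lt_min ltr01 divr_gt0// mulr_gt0//; lra.
have eta1 : eta <= 1 by rewrite ge_min lexx.
have eta2 : eta ^+ 2 * (b - a) <= e / 9.
  have : eta <= e / (9 * (b - a + 1)) by rewrite ge_min lexx orbT.
  rewrite ler_pdivlMr; last by lra.
  nra.
have [d d0 Hd] := cont_unif a (b + 1) cg eta0.
exists (Num.min 1 (d / 2)).
  by rewrite lt_min ltr01 divr_gt0//= ge_min lexx.
move=> h /andP[h0]; rewrite le_min => /andP[h1 hd].
have hdl : h < d by rewrite (le_lt_trans hd)// ltr_pdivrMr// ltr_pMr// ltr1n.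
have bb1 : b <= b + 1 by rewrite lerDl.
have hb : h + b <= b + 1 by rewrite addrC lerD2l.
have ha : a <= h + a by rewrite lerDr.
have lg : L2on a (b + 1) g by apply: L2on_cont; exact: continuous_subspaceT.
have le := L2onB lf lg.
have sh u : L2on a (b + 1) u -> L2on a b (fun y => u (h + y)).
  by move=> lu; apply: L2on_shift; exact: L2on_sub lu _ _.
have re u : L2on a (b + 1) u -> L2on a b u by move=> lu; exact: L2on_sub lu _ _.
have i1 : intg a b (fun y => (f y - g y) ^+ 2) <= e / 9.
  apply: le_trans hg; apply: int_mono => //; first exact: L2on_sqr le.
  by move=> x _; exact: sqr_ge0.
split.
- have i2 : intg a b (fun y => (f (h + y) - g (h + y)) ^+ 2) <= e / 9.
    apply: le_trans hg.
    rewrite (@int_shift _ a b h (fun y => (f y - g y) ^+ 2)); last first.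
      by apply: L1on_sub (L2on_sqr le) _ _.
    apply: int_mono => //; [exact: L2on_sqr le|by move=> x _; exact: sqr_ge0|].
    by rewrite lerD2l.
  have i3 : intg a b (fun y => (g (h + y) - g y) ^+ 2) <= e / 9.
    apply: le_trans eta2; rewrite -int_cst//.
    apply: le_int; [exact: L2on_sqr (L2onB (sh _ lg) (re _ lg))|exact: L1on_cst|].
    move=> y /andP[ay yb]; rewrite -[leLHS]real_normK ?num_real//.
    rewrite lerXn2r ?nnegrE ?(ltW eta0)//; apply: Hd => //; last by rewrite addrK.
      by rewrite lerDr.
    by rewrite addrC lerD.
  have i1' : intg a b (fun y => (- (f y - g y)) ^+ 2) <= e / 9.
    by apply: le_trans i1; rewrite le_eqVlt; apply/orP; left; apply/eqP; apply: eq_int => x _; rewrite sqrrN.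
  have := int_sum3 (sh _ le) (re _ (L2onN le)) (L2onB (sh _ lg) (re _ lg)) i2 i1' i3.
  move=> /(le_trans _) H; apply: le_trans (H _ _) _; last first.
  + by rewrite le_eqVlt; apply/orP; left; apply/eqP; field.
  + by rewrite le_eqVlt; apply/orP; left; apply/eqP; apply: eq_int => x _; congr (_ ^+ 2); ring.
- pose P x := intg a x g.
  have Pg : prim a (b + 1) P g by exact: prim_of.
  have Ee := primB Ff Pg.
  have hh : 0 <= h <= 1 by rewrite h0.
  have i2 : intg a b (fun y => ((F (h + y) - P (h + y)) - (F y - P y)) ^+ 2) <= e / 9 * h ^+ 2.
    apply: le_trans (prim_incr2 Ee hh ab) _.
    by rewrite mulrC ler_wpM2r// sqr_ge0.
  have i3 : intg a b (fun y => (- h * (f y - g y)) ^+ 2) <= e / 9 * h ^+ 2.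
    apply: (@le_trans _ _ (h ^+ 2 * intg a b (fun y => (f y - g y) ^+ 2))).
      rewrite -intZ; last by exact: L2on_sqr (re _ le).
      rewrite le_eqVlt; apply/orP; left; apply/eqP; apply: eq_int => x _.
      by rewrite exprMn sqrrN.
    by rewrite mulrC ler_wpM2r// sqr_ge0.
  have i4 : intg a b (fun y => (P (h + y) - P y - h * g y) ^+ 2) <= e / 9 * h ^+ 2.
    apply: (@le_trans _ _ (eta ^+ 2 * (b - a) * h ^+ 2)); last by rewrite ler_wpM2r// sqr_ge0.
    rewrite mulrAC -int_cst//.
    apply: le_int; [|exact: L1on_cst|].
      apply: L2on_sqr; apply: L2onB (L2onB (sh _ (prim_L2on Pg)) (re _ (prim_L2on Pg))) _.
      by apply: L2onZ; exact: re.
    move=> y /andP[ay yb].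
    have yh : y <= h + y by rewrite lerDr.
    have hyb : h + y <= b + 1 by rewrite addrC lerD.
    have lgy : L1on y (h + y) g by apply: L2on_L1; apply: L2on_sub lg _ _.
    rewrite (prim_diff Pg)//.
    have -> : h * g y = intg y (h + y) (fun _ => g y) by rewrite int_cst// addrK mulrC.
    rewrite -intB//; last exact: L1on_cst.
    rewrite -exprMn -[leLHS]real_normK ?num_real// lerXn2r ?nnegrE ?mulr_ge0// ?(ltW eta0)//.
    have lgb := L1onB lgy (L1on_cst y (h + y) (g y)).
    apply: le_trans (norm_int lgb) _.
    have -> : eta * h = intg y (h + y) (fun _ => eta) by rewrite int_cst// addrK.
    apply: le_int; [exact: L1on_norm|exact: L1on_cst|].
    move=> z /andP[yz zh]; apply: Hd => //; first exact: le_trans hyb.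
    by rewrite (le_lt_trans _ hdl)// lerBlDr.
  have := int_sum3 _ _ _ i2 i3 i4.
  move=> H; apply: le_trans (le_trans _ (H _ _ _)) _.
  + rewrite le_eqVlt; apply/orP; left; apply/eqP; apply: eq_int => x _.
    by congr (_ ^+ 2); ring.
  + by apply: L2onB; [exact: sh (prim_L2on Ee)|exact: re (prim_L2on Ee)].
  + by apply: L2onZ; exact: re.
  + apply: L2onB (L2onB (sh _ (prim_L2on Pg)) (re _ (prim_L2on Pg))) _.
    by apply: L2onZ; exact: re.
  + by lra.
Qed.

End density.

(** * Travelling waves *)

Section paths.
Context {R : realType}.
Notation state := (state R).
Notation fct := (fct R).
Implicit Types (s r t T k d e x y : R).

Definition loc2 (f : R -> R) := forall a b : R, L2on a b f.

Definition primR (F f : R -> R) := forall a b : R, prim a b F f.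

(* [V t] is the integral of [u] over [0, t] in L^2(0,1): the last bound makes
   its Riemann sums converge. *)
Definition pathL2 (u V : R -> fct) :=
  [/\ forall t, 0 <= t -> L2 (u t) /\ L2 (V t),
      V 0 = 0 &
      forall T e, 0 < e -> exists2 d, 0 < d & forall s r,
        0 <= s -> s <= r -> r <= T -> r - s < d ->
        L2normsq (u r - u s) <= e /\
        L2normsq (V r - V s - (r - s) *: u s) <= e * (r - s) ^+ 2].

Definition pathH1 (u V : R -> fct) := exists ux Vx : R -> fct,
  [/\ forall t, 0 <= t -> H1_deriv (u t) (ux t) /\ H1_deriv (V t) (Vx t),
      pathL2 u V & pathL2 ux Vx].

Lemma L2normsq_lin k (f g : fct) : L2 f -> L2 g ->
  L2normsq (k *: f + g) <= 2 * k ^+ 2 * L2normsq f + 2 * L2normsq g.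
Proof.
move=> /L2E lf /L2E lg; rewrite !L2normsqE.
have l1 := L2on_sqr lf; have l2 := L2on_sqr lg.
rewrite -!intZ// -intD; [|exact: L1onZ|exact: L1onZ].
apply: le_int; first exact: L2on_sqr (L2onD (L2onZ k lf) lg).
  by apply: L1onD; exact: L1onZ.
move=> x _ /=; rewrite fct_linE.
by move: (f x : R) (g x : R) => a c; have := sqr_ge0 (k * a - c); nra.
Qed.

Lemma lin_incr (E : lmodType R) k h (a b c d p q : E) :
  k *: a + b - (k *: c + d) - h *: (k *: p + q) =
  k *: (a - c - h *: p) + (b - d - h *: q).
Proof.
by rewrite !scalerBr scalerDr !scalerA (mulrC k h) !opprD (addrACA (k *: a)) [LHS]addrACA.
Qed.

Lemma pathL2_lin k (u V v W : R -> fct) : pathL2 u V -> pathL2 v W ->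
  pathL2 (fun t => k *: u t + v t) (fun t => k *: V t + W t).
Proof.
move=> [lu V0 hu] [lv W0 hv]; split.
- move=> t t0; have [a1 a2] := lu t t0; have [b1 b2] := lv t t0.
  by split; exact: L2on_lin.
- by rewrite V0 W0 scaler0 addr0.
move=> T e e0.
have p0 : 0 < 2 * k ^+ 2 + 2 by have := sqr_ge0 k; lra.
have e1 : 0 < e / (2 * k ^+ 2 + 2) by rewrite divr_gt0.
have [d1 d10 h1] := hu T _ e1; have [d2 d20 h2] := hv T _ e1.
exists (Num.min d1 d2); first by rewrite lt_min d10.
move=> s r s0 sr rT; rewrite lt_min => /andP[r1 r2].
have r0 := le_trans s0 sr.
have [lus lVs] := lu s s0; have [lur lVr] := lu r r0.
have [lvs lWs] := lv s s0; have [lvr lWr] := lv r r0.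
have {h1}[h1 h1'] := h1 s r s0 sr rT r1; have {h2}[h2 h2'] := h2 s r s0 sr rT r2.
have sum (m1 m2 E : R) : m1 <= E / (2 * k ^+ 2 + 2) -> m2 <= E / (2 * k ^+ 2 + 2) ->
    2 * k ^+ 2 * m1 + 2 * m2 <= E.
  rewrite !ler_pdivlMr// => k1 k2; have := sqr_ge0 k.
  suff : (2 * k ^+ 2 * m1 + 2 * m2) * (2 * k ^+ 2 + 2) <= E * (2 * k ^+ 2 + 2).
    by rewrite ler_pM2r.
  have := sqr_ge0 k; nra.
split.
- have -> : k *: u r + v r - (k *: u s + v s) = k *: (u r - u s) + (v r - v s).
    by rewrite scalerBr opprD addrACA.
  apply: le_trans (L2normsq_lin _ _ _) (sum _ _ _ h1 h2); exact: L2onB.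
- have -> : k *: V r + W r - (k *: V s + W s) - (r - s) *: (k *: u s + v s) =
      k *: (V r - V s - (r - s) *: u s) + (W r - W s - (r - s) *: v s).
    exact: lin_incr.
  apply: le_trans (L2normsq_lin _ _ _) (sum _ _ _ _ _); try by rewrite mulrAC.
    by apply: L2onB; [exact: L2onB|exact: L2onZ].
  by apply: L2onB; [exact: L2onB|exact: L2onZ].
Qed.

Lemma pathH1_lin k (u V v W : R -> fct) : pathH1 u V -> pathH1 v W ->
  pathH1 (fun t => k *: u t + v t) (fun t => k *: V t + W t).
Proof.
move=> [ux [Vx [d1 p1 q1]]] [vx [Wx [d2 p2 q2]]].
exists (fun t => k *: ux t + vx t), (fun t => k *: Vx t + Wx t); split.
- move=> t t0; have [a1 a2] := d1 t t0; have [b1 b2] := d2 t t0.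
  by split; exact: prim_lin.
- exact: pathL2_lin.
- exact: pathL2_lin.
Qed.

Lemma eq_pathL2 (u V v W : R -> fct) : pathL2 u V ->
  (forall t x, u t x = v t x) -> (forall t x, V t x = W t x) -> pathL2 v W.
Proof.
move=> H uv VW; have -> : v = u by apply/funext => t; apply/funext => x.
by have -> : W = V by apply/funext => t; apply/funext => x.
Qed.

Lemma eq_pathH1 (u V v W : R -> fct) : pathH1 u V ->
  (forall t x, u t x = v t x) -> (forall t x, V t x = W t x) -> pathH1 v W.
Proof.
move=> H uv VW; have -> : v = u by apply/funext => t; apply/funext => x.
by have -> : W = V by apply/funext => t; apply/funext => x.
Qed.

(** At each time [s] up to [T], the profile read on [[0, 1]] is a window of one fixed interval, so a
    single use of [translation_L2] gives a radius uniform in [s]. *)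
Lemma pathL2_wave (th : R -> R) (A : R) (f F : R -> R) : mpres th ->
  (forall x, (0 <= x <= 1) = (A <= th x <= A + 1)) -> primR F f ->
  pathL2 (fun t x => f (t + th x)) (fun t x => F (t + th x) - F (th x)).
Proof.
move=> hth thA Ff.
have lf : loc2 f by move=> a c; exact: prim_L2 (Ff a c).
have lF : loc2 F by move=> a c; exact: prim_L2on (Ff a c).
have lsh (g : R -> R) t a c : loc2 g -> L2on a c (fun y => g (t + y)).
  by move=> lg; apply: L2on_shift; exact: lg.
have lth (g : R -> R) t : loc2 g -> L2on 0 1 (fun x => g (t + th x)).
  by move=> lg; exact: (L2on_comp hth thA (lsh g t _ _ lg)).
split.
- move=> t _; split; first exact: lth.
  by apply: (L2onB (lth F t lF)); exact: (L2on_comp hth thA (lF _ _)).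
- by apply/funext => x /=; rewrite add0r subrr.
move=> T e e0.
have [T0|T0] := ltP T 0.
  by exists 1 => // s r s0 sr rT; have := le_trans (le_trans s0 sr) rT; rewrite leNgt T0.
have T1 : A <= T + (A + 1) by rewrite addrCA lerDl addr_ge0.
have [d /andP[d0 d1] Hd] := translation_L2 (Ff A (T + (A + 1) + 1)) T1 e0.
exists d => // s r s0 sr rT rs.
have hh : 0 <= r - s <= d by rewrite subr_ge0 sr ltW.
have [h1 h2] := Hd _ hh.
have sA : A <= s + A by rewrite lerDr.
have sT : s + (A + 1) <= T + (A + 1) by rewrite lerD2r (le_trans sr).
have tr (g : R -> R) E : L2on A (T + (A + 1)) g ->
    intg A (T + (A + 1)) (fun y => g y ^+ 2) <= E -> intg 0 1 (fun x => g (s + th x) ^+ 2) <= E.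
  move=> lg; apply: le_trans.
  have lgs : L1on (s + A) (s + (A + 1)) (fun y => g y ^+ 2) by exact: L1on_sub (L2on_sqr lg) _ _.
  have lgt : L1on A (A + 1) (fun y => g (s + y) ^+ 2).
    by apply: (L1on_comp (mpres_shift s) _ lgs) => x; rewrite !lerD2l.
  rewrite (int_comp hth thA lgt) (int_shift lgs).
  apply: int_mono => //; [exact: L2on_sqr lg|by move=> x _; exact: sqr_ge0|].
  by rewrite lerD2l lerDl.
have Er x : r + x = r - s + (s + x) by rewrite addrA subrK.
split.
- rewrite L2normsqE (le_trans _ (tr _ _ (L2onB (lsh f (r - s) _ _ lf) (lf _ _)) h1))//.
  by rewrite (@eq_int _ 0 1 _ (fun x => (f (r - s + (s + th x)) - f (s + th x)) ^+ 2))// => x _; rewrite -Er.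
- rewrite L2normsqE (le_trans _ (tr _ _
    (L2onB (L2onB (lsh F (r - s) _ _ lF) (lF _ _)) (L2onZ (r - s) (lf _ _))) h2))//.
  rewrite (@eq_int _ 0 1 _ (fun x =>
    (F (r - s + (s + th x)) - F (s + th x) - (r - s) * f (s + th x)) ^+ 2))// => x _.
  by rewrite -Er; congr (_ ^+ 2); rewrite /= [in LHS]opprB addrA subrK.
Qed.

Lemma pathL2_fwd (f F : R -> R) : primR F f ->
  pathL2 (fun t x => f (t + x)) (fun t x => F (t + x) - F x).
Proof.
by apply: (pathL2_wave (th := fun x => x) (A := 0)) => [|x]; [split|rewrite add0r].
Qed.

Lemma pathL2_bwd (f F : R -> R) : primR F f ->
  pathL2 (fun t x => f (t - x)) (fun t x => F (t - x) - F (- x)).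
Proof.
apply: (pathL2_wave (th := -%R) (A := -1)); first exact: mpresN.
by move=> x; rewrite addNr lerN2 oppr_le0 andbC.
Qed.

Lemma loc2_shift (f : R -> R) t : loc2 f -> loc2 (fun x => f (t + x)).
Proof. by move=> lf a b; exact: (L2on_shift (lf _ _)). Qed.

Lemma pathH1_fwd (f F G : R -> R) : primR F f -> primR G F ->
  pathH1 (fun t x => F (t + x)) (fun t x => G (t + x) - G x).
Proof.
move=> Ff GF.
exists (fun t x => f (t + x)), (fun t x => F (t + x) - F x); split.
- move=> t _; split; first exact: (prim_shift (Ff _ _)).
  exact: (primB (prim_shift (GF _ _)) (GF _ _)).
- exact: pathL2_fwd.
- exact: pathL2_fwd.
Qed.

Lemma pathH1_bwd (f F G : R -> R) : primR F f -> primR G F ->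
  pathH1 (fun t x => F (t - x)) (fun t x => G (t - x) - G (- x)).
Proof.
move=> Ff GF.
have pop (H h : R -> R) t : primR H h -> prim 0 1 (fun x => H (t - x)) (fun x => - h (t - x)).
  move=> Hh; apply: (@prim_opp _ 0 1 (fun x => H (t + x)) (fun x => h (t + x))).
  exact: (prim_shift (Hh _ _)).
have E (k h : R -> R) t : (fun x => - h x : R^o) = (-1 : R) *: (h : fct) + 0.
  by apply/funext => x; rewrite fct_linE mulN1r addr0.
exists (fun t x => - f (t - x)), (fun t x => - F (t - x) + F (- x)); split.
- move=> t _; split; first exact: pop.
  have := primB (pop G F t GF) (prim_opp (GF (- 1) (- 0))).
  by apply: eq_prim => x _ //; rewrite opprK.
- exact: pathL2_bwd.
(* Adding the zero path lets [pathL2_lin] act as negation. *)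
- have z : pathL2 (fun _ => 0) (fun _ => 0).
    split; [by move=> t _; split; exact: (L2on_cst 0 1 0)|by []|].
    move=> T e e0; exists 1 => // s r _ _ _ _.
    have -> : L2normsq (0 - 0 : fct) = 0.
      by rewrite subr0 L2normsqE -[RHS](mul0r (1 - 0)) -int_cst//; apply: eq_int => x _; rewrite expr0n.
    have -> : L2normsq (0 - 0 - (r - s) *: 0 : fct) = 0.
      by rewrite scaler0 !subr0 L2normsqE -[RHS](mul0r (1 - 0)) -int_cst//; apply: eq_int => x _; rewrite expr0n.
    by rewrite (ltW e0) mulr_ge0 ?sqr_ge0// ltW.
  apply: (eq_pathL2 (pathL2_lin (-1) (pathL2_bwd Ff) z)) => t x; rewrite fct_linE mulN1r addr0//.
  by rewrite opprB addrC.
Qed.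

End paths.

(** * Paths of states and their integrals *)

Section state_path.
Context {R : realType}.
Notation state := (state R).
Notation fct := (fct R).
Notation X := (@inX R).
Notation b := (@bX R).
Implicit Types (s r t T k d e x y : R).

(** 13 counts the eight components and the five space derivatives. *)
Lemma normX_le (e e' Y z z' w w' Z ex Yx zx wx Zx : fct) d :
  [/\ H1_deriv e ex, H1_deriv Y Yx, H1_deriv z zx, H1_deriv w wx & H1_deriv Z Zx] ->
  [/\ L2normsq e <= d, L2normsq e' <= d, L2normsq Y <= d, L2normsq z <= d & L2normsq z' <= d] ->
  [/\ L2normsq w <= d, L2normsq w' <= d & L2normsq Z <= d] ->
  [/\ L2normsq ex <= d, L2normsq Yx <= d, L2normsq zx <= d, L2normsq wx <= d & L2normsq Zx <= d] ->
  normX ((e, e', Y, z, z', w, w', Z) : state) <= Num.sqrt (13 * d).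
Proof.
move=> [p1 p2 p3 p4 p5] [a1 a2 a3 a4 a5] [a6 a7 a8] [b1 b2 b3 b4 b5].
rewrite /normX; apply: ler_wsqrtr.
by rewrite (H1normsqE p1) (H1normsqE p2) (H1normsqE p3) (H1normsqE p4) (H1normsqE p5); lra.
Qed.

Section components.
Variables (e e' Y z z' w w' Z Ve Ve' VY Vz Vz' Vw Vw' VZ : R -> fct).
Hypotheses (pe : pathH1 e Ve) (pe' : pathL2 e' Ve') (pY : pathH1 Y VY)
  (pz : pathH1 z Vz) (pz' : pathL2 z' Vz') (pw : pathH1 w Vw) (pw' : pathL2 w' Vw')
  (pZ : pathH1 Z VZ).
Hypotheses (z1 : forall t, 0 <= t -> z t 1 = 0) (Vz1 : forall t, 0 <= t -> Vz t 1 = 0).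

Definition stpath t : state := (e t, e' t, Y t, z t, z' t, w t, w' t, Z t).
Definition stint t : state := (Ve t, Ve' t, VY t, Vz t, Vz' t, Vw t, Vw' t, VZ t).

Lemma stpath_inX t : 0 <= t -> X (stpath t) /\ X (stint t).
Proof.
move=> t0.
have H (u V : R -> fct) : pathH1 u V -> H1 (u t) /\ H1 (V t).
  by move=> [ux [Vx [D _ _]]]; have [? ?] := D t t0; split; eexists; eassumption.
have L (u V : R -> fct) : pathL2 u V -> L2 (u t) /\ L2 (V t).
  by move=> [D _ _]; exact: D.
have [? ?] := H _ _ pe; have [? ?] := H _ _ pY; have [? ?] := H _ _ pz.
have [? ?] := H _ _ pw; have [? ?] := H _ _ pZ.
have [? ?] := L _ _ pe'; have [? ?] := L _ _ pz'; have [? ?] := L _ _ pw'.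
by split; split => //; split => //; split => //; [exact: z1|exact: Vz1].
Qed.

Lemma stint0 : stint 0 = 0.
Proof.
have H (u V : R -> fct) : pathH1 u V -> V 0 = 0 by move=> [ux [Vx [_ [_ D _] _]]].
have L (u V : R -> fct) : pathL2 u V -> V 0 = 0 by case.
by rewrite /stint (H _ _ pe) (L _ _ pe') (H _ _ pY) (H _ _ pz) (L _ _ pz') (H _ _ pw)
   (L _ _ pw') (H _ _ pZ).
Qed.

Lemma stpath_incr T (eta : R) : 0 < eta -> exists2 d, 0 < d &
  forall s r, 0 <= s -> s <= r -> r <= T -> r - s < d ->
  nrm b (lsub (stpath r) (stpath s)) <= eta /\
  nrm b (lincr (r - s) (stint r) (stint s) (stpath s)) <= eta * (r - s).
Proof.
move=> eta0.
pose E := eta ^+ 2 / 13.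
have E0 : 0 < E by rewrite divr_gt0// exprn_gt0.
have [ex [Vex [De [_ _ /(_ T _ E0)[d1 d10 h1]] [_ _ /(_ T _ E0)[d2 d20 h2]]]]] := pe.
have [_ _ /(_ T _ E0)[d3 d30 h3]] := pe'.
have [Yx [VYx [DY [_ _ /(_ T _ E0)[d4 d40 h4]] [_ _ /(_ T _ E0)[d5 d50 h5]]]]] := pY.
have [zx [Vzx [Dz [_ _ /(_ T _ E0)[d6 d60 h6]] [_ _ /(_ T _ E0)[d7 d70 h7]]]]] := pz.
have [_ _ /(_ T _ E0)[d8 d80 h8]] := pz'.
have [wx [Vwx [Dw [_ _ /(_ T _ E0)[d9 d90 h9]] [_ _ /(_ T _ E0)[da da0 ha]]]]] := pw.
have [_ _ /(_ T _ E0)[db db0 hb]] := pw'.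
have [Zx [VZx [DZ [_ _ /(_ T _ E0)[dc dc0 hc]] [_ _ /(_ T _ E0)[dd dd0 hd]]]]] := pZ.
exists (Num.min d1 (Num.min d2 (Num.min d3 (Num.min d4 (Num.min d5 (Num.min d6
  (Num.min d7 (Num.min d8 (Num.min d9 (Num.min da (Num.min db (Num.min dc dd)))))))))))).
  by rewrite !lt_min d10 d20 d30 d40 d50 d60 d70 d80 d90 da0 db0 dc0 dd0.
move=> s r s0 sr rT.
rewrite !lt_min => /and5P[r1 r2 r3 r4 /and5P[r5 r6 r7 r8 /and5P[r9 ra rb rc rd]]].
have r0 : 0 <= r := le_trans s0 sr.
have [k1 l1] := h1 _ _ s0 sr rT r1; have [k2 l2] := h2 _ _ s0 sr rT r2.
have [k3 l3] := h3 _ _ s0 sr rT r3; have [k4 l4] := h4 _ _ s0 sr rT r4.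
have [k5 l5] := h5 _ _ s0 sr rT r5; have [k6 l6] := h6 _ _ s0 sr rT r6.
have [k7 l7] := h7 _ _ s0 sr rT r7; have [k8 l8] := h8 _ _ s0 sr rT r8.
have [k9 l9] := h9 _ _ s0 sr rT r9; have [ka la] := ha _ _ s0 sr rT ra.
have [kb lb] := hb _ _ s0 sr rT rb; have [kc lc] := hc _ _ s0 sr rT rc.
have [kd ld] := hd _ _ s0 sr rT rd.
have D (u ux V Vx : R -> fct) : (forall t, 0 <= t -> H1_deriv (u t) (ux t) /\ H1_deriv (V t) (Vx t)) ->
    H1_deriv (u r - u s) (ux r - ux s) /\
    H1_deriv (V r - V s - (r - s) *: u s) (Vx r - Vx s - (r - s) *: ux s).
  move=> Du; have [a1 a2] := Du r r0; have [a3 a4] := Du s s0.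
  by split; [exact: (primB a1 a3)|exact: (primB (primB a2 a4) (primZ (r - s) a3))].
have [g1 f1] := D _ _ _ _ De; have [g2 f2] := D _ _ _ _ DY; have [g3 f3] := D _ _ _ _ Dz.
have [g4 f4] := D _ _ _ _ Dw; have [g5 f5] := D _ _ _ _ DZ.
rewrite -!normXE; split.
- have -> : eta = Num.sqrt (13 * E).
    by rewrite /E mulrC divfK ?pnatr_eq0// sqrtr_sqr gtr0_norm.
  rewrite /stpath lsub_tuple; apply: (normX_le (And5 g1 g2 g3 g4 g5)); split; eassumption.
- have -> : eta * (r - s) = Num.sqrt (13 * (E * (r - s) ^+ 2)).
    rewrite /E mulrA (mulrC 13) divfK ?pnatr_eq0// -exprMn sqrtr_sqr ger0_norm//.
    by rewrite mulr_ge0 ?(ltW eta0)// subr_ge0.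
  rewrite /stpath /stint lincr_tuple.
  apply: (normX_le (And5 f1 f2 f3 f4 f5)); split; eassumption.
Qed.

Lemma stpath_continuous : continuous_path stpath.
Proof.
have XU t : 0 <= t -> X (stpath t) by move=> /stpath_inX[].
split => // t0 t00; apply/cvgrPdist_le => eta eta0.
have [d d0 Hd] := stpath_incr (t0 + 1) eta0.
exists (Num.min d 1); first by rewrite /= lt_min d0 ltr01.
move=> t /=; rewrite lt_min => /andP[td t1]; rewrite in_itv/= andbT => t0'.
rewrite sub0r normrN normXB ger0_norm ?nrm_ge0//.
have [tt|tt] := leP t0 t.
  have [] := Hd t0 t t00 tt; rewrite -?(ler0_norm (x := t0 - t)) ?subr_le0//.
    by move: t1; rewrite ler0_norm ?subr_le0// opprB => /ltW; rewrite lerBlDl.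
  by move: td; rewrite ler0_norm ?subr_le0// opprB.
have Xt := XU t t0'; have Xt0 := XU t0 t00.
have -> : nrm b (lsub (stpath t) (stpath t0)) = nrm b (lsub (stpath t0) (stpath t)).
  exact: (nrmB (@inX_linsub R) (@bX_sip R)).
have [] // := Hd t t0 t0' (ltW tt).
  by rewrite lerDl.
by move: td; rewrite ger0_norm// subr_ge0 ltW.
Qed.

Lemma stpath_integral t : 0 <= t -> is_integral stpath t (stint t).
Proof.
move=> t0; apply/is_integralE.
apply: (integral_of_incr (@inX_linsub R) (@bX_sip R) t0 stpath_inX stint0) => eta eta0.
have [d d0 Hd] := stpath_incr t eta0.
by exists d => // s r s0 sr rt rd; have [_ ->] := Hd s r s0 sr rt rd.
Qed.

End components.
End state_path.

(** * Boundary reflections *)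

Section loc2.
Context {R : realType}.
Notation mu := (@lebesgue_measure R).
Implicit Types (a b c d k t x y : R) (f g h F G : R -> R).

Lemma loc2D f g : loc2 f -> loc2 g -> loc2 (fun x => f x + g x).
Proof. by move=> lf lg a b; exact: L2onD. Qed.

Lemma loc2B f g : loc2 f -> loc2 g -> loc2 (fun x => f x - g x).
Proof. by move=> lf lg a b; exact: L2onB. Qed.

Lemma loc2Z k f : loc2 f -> loc2 (fun x => k * f x).
Proof. by move=> lf a b; exact: L2onZ. Qed.

Lemma primR_loc2 F f : primR F f -> loc2 f.
Proof. by move=> Ff a b; exact: prim_L2 (Ff a b). Qed.

Lemma primR_loc2F F f : primR F f -> loc2 F.
Proof. by move=> Ff a b; exact: prim_L2on (Ff a b). Qed.

Lemma eq_primR F f G g : (forall x, F x = G x) -> (forall x, f x = g x) ->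
  primR F f -> primR G g.
Proof. by move=> FG fg H a b; apply: eq_prim (H a b). Qed.

Lemma primRD F f G g : primR F f -> primR G g ->
  primR (fun x => F x + G x) (fun x => f x + g x).
Proof. by move=> Hf Hg a b; exact: primD. Qed.

Lemma primRB F f G g : primR F f -> primR G g ->
  primR (fun x => F x - G x) (fun x => f x - g x).
Proof. by move=> Hf Hg a b; exact: primB. Qed.

Lemma primRZ k F f : primR F f -> primR (fun x => k * F x) (fun x => k * f x).
Proof. by move=> Hf a b; exact: primZ. Qed.

Lemma primR_shift F f t : primR F f -> primR (fun x => F (t + x)) (fun x => f (t + x)).
Proof. by move=> Hf a b; exact: prim_shift. Qed.

Lemma loc2_glue c f g : loc2 f -> loc2 g -> loc2 (fun x => if x <= c then f x else g x).
Proof.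
move=> lf lg a b.
have lfg : L2on a b (fun x => `|f x| + `|g x|).
  have l (h : R -> R) : loc2 h -> L2on a b (fun x => `|h x|).
    move=> lh; have [mh sh] := lh a b; split; first exact: measurableT_comp.
    by apply: eq_L1on sh => x _; rewrite real_normK ?num_real.
  by apply: L2onD; exact: l.
apply: (le_L2on _ _ lfg).
  apply: measurable_fun_if => //.
  - by apply: measurable_fun_ler.
  - by apply: measurable_funS (L2on_meas (lf a b)) => // x [].
  - by apply: measurable_funS (L2on_meas (lg a b)) => // x [].
by move=> x _; case: ifP => _; rewrite ?lerDl ?lerDr.
Qed.

Lemma loc2_ext c d f : L2on c d f -> loc2 (fun x => if c <= x <= d then f x else 0).
Proof.
move=> [mf lf] a b.
have E : (fun x => if c <= x <= d then f x else 0) = f \_ `[c, d].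
  by apply/funext => x; rewrite patchE mem_setE in_itv.
have E2 : EFin \o (fun x => (if c <= x <= d then f x else 0) ^+ 2) =
    (EFin \o (fun x => f x ^+ 2)) \_ `[c, d].
  apply/funext => x; rewrite patchE mem_setE in_itv/=.
  by case: ifP; rewrite ?expr0n.
split.
  rewrite E; apply/measurable_restrict => //.
  by apply: measurable_funS mf => // x [].
rewrite /L1on E2.
apply: (@integrableS _ _ _ _ setT) => //.
have H := @integrable_mkcond _ (measurableTypeR R) R mu `[c, d]%classic
  (EFin \o (fun x => f x ^+ 2)) (measurable_itv _).
by apply/H.
Qed.

(** The two terms form the oriented integral, since [intg] vanishes on reversed endpoints. *)
Lemma primR_intg c y f : loc2 f ->
  primR (fun x => y + (intg c x f - intg x c f)) f.
Proof.
move=> lf.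
have l1 a b : L1on a b f by exact: L2on_L1 (lf a b).
have h w : c <= w -> intg w c f = 0.
  by rewrite le_eqVlt => /predU1P[->|/int_rev//]; exact: int_pt.
move=> a b; apply: primI => // x z ax xz zb.
have [cx|xc] := leP c x.
  rewrite (int_cat cx xz (l1 _ _)) !h//; last exact: le_trans xz.
  by lra.
rewrite (int_rev f xc).
have [cz|zc] := leP c z.
  by rewrite (int_cat (ltW xc) cz (l1 _ _)) (h z)//; lra.
by rewrite (int_cat xz (ltW zc) (l1 _ _)) (int_rev f zc); lra.
Qed.

Lemma primR_of c y f : loc2 f -> exists2 F, primR F f & F c = y.
Proof.
move=> lf; exists (fun x => y + (intg c x f - intg x c f)); first exact: primR_intg.
by rewrite !int_pt subrr addr0.
Qed.

Lemma int_opn a b f g : L1on a b f -> L1on a b g ->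
  (forall x, a < x <= b -> f x = g x) -> intg a b f = intg a b g.
Proof.
move=> lf lg fg; rewrite /intg.
have sub (h : R -> R) : L1on a b h -> mu.-integrable `]a, b] (EFin \o h).
  by apply: integrableS => //; apply: subset_itv; rewrite bnd_simp.
rewrite -[LHS]Rintegral_itv_obnd_cbnd; last exact: sub.
rewrite -[RHS]Rintegral_itv_obnd_cbnd; last exact: sub.
by apply: eq_Rintegral => x; rewrite inE/= in_itv/=; exact: fg.
Qed.

(** The densities may differ at [a], a null set: a profile glued there takes the value of its
    earlier branch. *)
Lemma prim_eq a b F f G g : prim a b F f -> prim a b G g -> F a = G a ->
  (forall x, a < x <= b -> f x = g x) -> forall x, a <= x <= b -> F x = G x.
Proof.
move=> Ff Gg FGa fg x xab; rewrite Ff.2// Gg.2// FGa; congr (_ + _).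
have /andP[ax xb] := xab.
apply: int_opn => [||y /andP[ay yx]].
- by apply: L2on_L1; apply: L2on_sub Ff.1 _ _.
- by apply: L2on_L1; apply: L2on_sub Gg.1 _ _.
- by apply: fg; rewrite ay (le_trans yx).
Qed.

Lemma is_derive_expRM k x : is_derive x 1 (fun t : R => expR (k * t)) (k * expR (k * x)).
Proof.
rewrite mulrC; apply: (@is_derive1_comp R expR (fun t => k * t) x _ _ (is_derive_expR _)).
by have := is_deriveZ k (is_derive_id x (1 : R)); rewrite /= scaler1.
Qed.

Lemma continuous_expRM k : continuous (fun t : R => expR (k * t)).
Proof.
move=> x; apply: differentiable_continuous; apply/derivable1_diffP.
by have [] := is_derive_expRM k x.
Qed.

Lemma primR_expR k : primR (fun t => expR (k * t)) (fun t => k * expR (k * t)).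
Proof.
have cc : continuous (fun t : R => k * expR (k * t)).
  by move=> x; apply: cvgMr; exact: continuous_expRM.
move=> a b; apply: primI.
  by apply: L2on_cont; exact: continuous_subspaceT.
move=> x y _; rewrite le_eqVlt => /predU1P[-> _|xy _]; first by rewrite int_pt subrr.
rewrite /intg /Rintegral (@continuous_FTC2 _ _ (fun t => expR (k * t)))//.
- by apply: continuous_subspaceT.
- split; first by move=> z _; have [] := is_derive_expRM k z.
    exact/cvg_at_right_filter/continuous_expRM.
  exact/cvg_at_left_filter/continuous_expRM.
- by move=> z _; rewrite derive1E; have [_ ->] := is_derive_expRM k z.
Qed.

Lemma primRM F f G g : primR F f -> primR G g ->
  primR (fun x => F x * G x) (fun x => F x * g x + f x * G x).
Proof. by move=> Hf Hg a b; exact: primM. Qed.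

Lemma loc2_expM k f : loc2 f -> loc2 (fun t => expR (k * t) * f t).
Proof.
move=> lf a b; apply: L2on_mulc (lf a b).
by apply: continuous_subspaceT; exact: continuous_expRM.
Qed.


(* Solves y' = m + o, y(0) = y0 with o = al m - k y + h. *)
Section boundary.
Variables (al k y0 : R) (h : R -> R) (lh : loc2 h).

(** Variation of constants: this is the right-hand side of [y' + k y = (1 + al) m + h] times its
    integrating factor. *)
Definition ode_src (m : R -> R) t := expR (k * t) * ((1 + al) * m t + h t).

Definition ode_sol m t := expR (- k * t) * (y0 + (intg 0 t (ode_src m) - intg t 0 (ode_src m))).

Definition ode_out m t := al * m t - k * ode_sol m t + h t.

Lemma ode_primR m : loc2 m ->
  primR (ode_sol m) (fun t => m t + ode_out m t) /\ ode_sol m 0 = y0.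
Proof.
move=> lm; split; last by rewrite /ode_sol int_pt mulr0 expR0 mul1r subrr addr0.
have ls : loc2 (ode_src m).
  by apply: loc2_expM; apply: loc2D lh; exact: loc2Z.
have P1 : primR (fun t => y0 + (intg 0 t (ode_src m) - intg t 0 (ode_src m))) (ode_src m).
  exact: primR_intg.
apply: (eq_primR _ _ (primRM (primR_expR (- k)) P1)) => // t.
rewrite /ode_out /ode_src /ode_sol mulrA -expRD.
by rewrite -mulrDl addNr mul0r expR0; ring.
Qed.

Lemma ode_out_loc2 m : loc2 m -> loc2 (ode_out m).
Proof.
move=> lm; have [P _] := ode_primR lm.
by apply: loc2D lh; apply: loc2B; [exact: loc2Z|exact/loc2Z/(primR_loc2F P)].
Qed.

Lemma ode_out_causal m m' t : (forall s, 0 <= s <= t -> m s = m' s) -> 0 <= t ->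
  ode_out m t = ode_out m' t.
Proof.
move=> mm t0.
have E : ode_sol m t = ode_sol m' t.
  rewrite /ode_sol; congr (_ * (_ + (_ - _))); apply: eq_int => x /andP[x0 xt].
    by rewrite /ode_src mm// x0.
  by rewrite /ode_src mm// (le_trans t0 x0) (le_trans xt t0).
by rewrite /ode_out E mm// lexx t0.
Qed.

End boundary.

(** The first application settles all times up to 1, and each further one gains the delay 2. The
    iterates are thus eventually constant at every time, uniformly on left half-lines, and no
    contraction estimate is needed. *)
Lemma causal_fixpoint (Phi : (R -> R) -> R -> R) :
  (forall g, loc2 g -> loc2 (Phi g)) ->
  (forall g g' t, t <= 1 -> Phi g t = Phi g' t) ->
  (forall g g' T, (forall t, t <= T -> g t = g' t) ->
     forall t, t <= T + 2 -> Phi g t = Phi g' t) ->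
  exists2 g, loc2 g & forall t, g t = Phi g t.
Proof.
move=> lPhi base step.
pose it n := iter n Phi (fun _ => 0).
have lit n : loc2 (it n).
  by elim: n => [|n IH]; [move=> a b; exact: L2on_cst|exact: lPhi].
have stab n t : t <= 1 + 2 * n%:R -> it n.+1 t = it n.+2 t.
  elim: n t => [|n IH] t tn; first by apply: base; move: tn; rewrite mulr0 addr0.
  by apply: (step _ _ (1 + 2 * n%:R)) => //; move: tn; rewrite -natr1; lra.
have stab2 n j t : t <= 1 + 2 * n%:R -> it (n + j).+1 t = it n.+1 t.
  move=> tn; elim: j => [|j IH]; first by rewrite addn0.
  rewrite addnS -stab//; apply: le_trans tn _.
  by rewrite lerD2l ler_wpM2l// ler_nat leq_addr.
pose N t := Num.trunc `|t|.
have NN t : t <= 1 + 2 * (N t)%:R.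
  have := truncnS_gt `|t|; rewrite -/(N t) -natr1.
  have := ler_norm t; have : 0 <= (N t)%:R :> R by []; lra.
pose g t := it (N t).+1 t.
have gE n t : t <= 1 + 2 * n%:R -> g t = it n.+1 t.
  move=> tn; rewrite /g; have [nN|Nn] := leqP n (N t).
    by rewrite -(subnKC nN) stab2.
  by rewrite -(subnKC (ltnW Nn)) stab2.
exists g.
  move=> a b; apply: eq_L2on (lit (N b).+1 a b) => x /andP[_ xb].
  by rewrite (gE (N b))// (le_trans xb).
move=> t; have tN := NN t.
rewrite (gE (N t).+1); last by rewrite -natr1; lra.
apply: (step _ _ (1 + 2 * (N t)%:R)) => //; last by lra.
by move=> s sN; rewrite (gE (N t)).
Qed.

(* d'Alembert's formula z(x,t) = p(t - x) + r(t + x) for data (z0, z1): the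
   outgoing profiles f = p' on the left and g = r' on the right are the fixed
   point of two successive boundary reflections, the second one delayed by 2. *)
Lemma wave_pair (a b rho c : R) (z0 z0x z1 h : R -> R) : 1 + b != 0 ->
  prim 0 1 z0 z0x -> L2on 0 1 z1 -> loc2 h ->
  exists p r f g : R -> R,
  [/\ primR p f /\ primR r g,
      forall x, 0 <= x <= 1 -> p (- x) + r x = z0 x,
      forall x, 0 <= x <= 1 -> f (- x) + g x = z1 x,
      forall t, 0 < t -> g t - f t = a * (p t + r t) + b * (f t + g t) + h t &
      forall t, 0 < t -> g (t + 1) = rho * f (t - 1) - c * (p (t - 1) + r (t + 1))].
Proof.
move=> b1 Hz lz1 lh.
pose h0 t := (- (1 + b)^-1) * h t.
have lh0 : loc2 h0 by exact: loc2Z.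
have lh1 : loc2 (fun _ : R => 0) by move=> u v; exact: L2on_cst.
(* The initial data fix [f] on [[-1, 0]] and [g] on [[0, 1]], from [f (- x) + g x = z1 x] and
   [g x - f (- x) = z0x x]; 0 is a default elsewhere. *)
pose F0 t := if -1 <= t <= - 0 then (z1 (- t) - z0x (- t)) / 2 else 0.
pose G0 t := if 0 <= t <= 1 then (z1 t + z0x t) / 2 else 0.
have lF0 : loc2 F0.
  apply: loc2_ext.
  have := L2onZ 2^-1 (@L2on_opp R (-1) (- 0) (fun t => z1 t - z0x t) _).
  rewrite !opprK => /(_ (L2onB lz1 (prim_L2 Hz))).
  by apply: eq_L2on => x _; rewrite mulrC.
have lG0 : loc2 G0.
  apply: loc2_ext; have := L2onZ 2^-1 (L2onD lz1 (prim_L2 Hz)).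
  by apply: eq_L2on => x _; rewrite mulrC.
(* The condition at 0, solved for the outgoing [f], reads [f = al0 * g - k0 * y + h0] with
   [y = p + r]. *)
pose al0 := (1 - b) / (1 + b); pose k0 := a / (1 + b).
pose S g t := if t <= 0 then F0 t else ode_out al0 k0 (z0 0) h0 g t.
pose m1 (f : R -> R) t := f (-1 + t).
(* What returns as [g t] was reflected at [x = 1] at time [t - 1] and left [x = 0] as [f (t - 2)]:
   two crossings give the delay 2. *)
pose T f t := if t <= 1 then G0 t else ode_out rho c (z0 1) (fun _ => 0) (m1 f) (-1 + t).
have lS g : loc2 g -> loc2 (S g).
  by move=> lg; apply: loc2_glue => //; exact: ode_out_loc2.
have lT f : loc2 f -> loc2 (T f).
  move=> lf; apply: loc2_glue => //; apply: loc2_shift; apply: ode_out_loc2 => //.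
  exact: loc2_shift.
have base (u u' : R -> R) t : t <= 1 -> T (S u) t = T (S u') t by rewrite /T => ->.
have caus (u u' : R -> R) s : (forall t, t <= s -> u t = u' t) ->
    forall t, t <= s + 2 -> T (S u) t = T (S u') t.
  move=> us t ts; rewrite /T; case: leP => [//|t1].
  apply: ode_out_causal => [w /andP[w0 w1]|]; last by lra.
  rewrite /m1 /S; case: leP => [//|ww].
  by apply: ode_out_causal => [v /andP[v0 v1]|]; [apply: us; lra|exact: ltW].
have [g lg gE] := @causal_fixpoint (fun g => T (S g)) (fun g lg => lT _ (lS _ lg)) base caus.
pose f := S g.
have lf : loc2 f by exact: lS.
(* Only the sum of the profiles matters; the free constant is fixed by [p 0 = 0]. *)
have [p pf p0] := primR_of 0 0 lf.
have [r rg r0] := primR_of 0 (z0 0) lg.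
exists p, r, f, g.
have [Py y0] := ode_primR al0 k0 (z0 0) lh0 lg.
have [Px x0] := ode_primR rho c (z0 1) lh1 (loc2_shift (-1) lf).
have init x : 0 <= x <= 1 -> p (- x) + r x = z0 x.
  have P1 := primD (prim_opp (pf (- 1) (- 0))) (rg 0 1).
  apply: (prim_eq P1 Hz); first by rewrite oppr0 p0 r0 add0r.
  move=> x' /andP[/ltW x'0 x'1]; rewrite gE /f /S /T x'1 oppr_le0 x'0 /F0 /G0 x'0 x'1.
  by rewrite oppr0 lerN2 x'1 oppr_le0 x'0/= opprK; field.
split => //.
- move=> x /andP[x00 x1]; rewrite gE /f /S /T x1 oppr_le0 x00 /F0 /G0 x00 x1.
  by rewrite oppr0 lerN2 x1 oppr_le0 x00/= opprK; field.
- move=> t t0.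
  (* The trace and the solution of the boundary equation have the same density at positive times and
     the same value at 0. *)
  have E : p t + r t = ode_sol al0 k0 (z0 0) h0 g t.
    have P1 := primD (pf 0 t) (rg 0 t).
    apply: (prim_eq P1 (Py 0 t)); first by rewrite p0 r0 add0r y0.
      by move=> x /andP[xx _]; rewrite addrC /f /S leNgt xx.
    by rewrite lexx (ltW t0).
  rewrite E /f /S leNgt t0 /= /ode_out /h0 /al0 /k0.
  by field.
have g1E x : 0 < x -> g (1 + x) = ode_out rho c (z0 1) (fun _ => 0) (m1 f) x.
  by move=> xx; rewrite gE /T gerDl leNgt xx addKr.
move=> t t0.
have E : p (-1 + t) + r (1 + t) = ode_sol rho c (z0 1) (fun _ => 0) (m1 f) t.
  have P1 := primD (primR_shift (-1) pf 0 t) (primR_shift 1 rg 0 t).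
  apply: (prim_eq P1 (Px 0 t)).
  + by rewrite x0 !addr0 init// ler01 lexx.
  + by move=> x /andP[xx _]; rewrite g1E.
  + by rewrite lexx (ltW t0).
by rewrite !(addrC t) E g1E// /ode_out addr0.
Qed.

End loc2.

(** * Boundary conditions of travelling waves *)

Section dalembert.
Context {R : realType}.
Notation fct := (fct R).
Implicit Types (a b c k t x : R) (f g h p r y s P Q H F G : R -> R).

(** The solution is [y (t - x)], with [y] glued at 0 from the initial datum read backwards and the
    boundary input. The compatibility hypothesis makes the two pieces meet, so that [y] is
    absolutely continuous across the junction. *)
Lemma transport k (Y0 Y0x s sd : R -> R) : prim 0 1 Y0 Y0x -> primR s sd ->
  Y0 0 = k * s 0 -> exists y yd : R -> R, [/\ primR y yd,
    forall x, 0 <= x <= 1 -> y (- x) = Y0 x,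
    forall x, 0 <= x <= 1 -> yd (- x) = - Y0x x &
    forall t, 0 <= t -> y t = k * s t].
Proof.
move=> HY Hs Y00.
pose d0 t := if -1 <= t <= - 0 then - Y0x (- t) else 0.
have ld0 : loc2 d0.
  apply: loc2_ext; apply/L2onN/L2on_opp; rewrite !opprK; exact: prim_L2 HY.
pose yd t := if t <= 0 then d0 t else k * sd t.
have lyd : loc2 yd by apply: loc2_glue => //; apply: loc2Z; exact: primR_loc2 Hs.
have [y Hy y0] := primR_of 0 (Y0 0) lyd.
have yd0 x : 0 <= x <= 1 -> yd (- x) = - Y0x x.
  by move=> /andP[x0 x1]; rewrite /yd oppr_le0 x0 /d0 lerN2 x1 oppr0 oppr_le0 x0/= opprK.
exists y, yd; split => //.
- move=> x x01.
  apply: (prim_eq (prim_opp (Hy (- 1) (- 0))) HY); first by rewrite oppr0.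
    by move=> z /andP[/ltW z0 z1]; rewrite yd0 ?opprK// z0.
  by [].
- move=> t t0.
  apply: (prim_eq (Hy 0 t) (primRZ k Hs 0 t)); first by rewrite y0.
    by move=> z /andP[z0 _]; rewrite /yd leNgt z0.
  by rewrite t0 lexx.
Qed.

Definition wv p r (t x : R) : R := p (t - x) + r (t + x).

(** The integral over [[0, t]] of the wave whose profiles are the derivatives of [p] and [r]. *)
Definition dwv p r (t x : R) : R := p (t - x) - p (- x) + (r (t + x) - r x).

Lemma dwvE p r t x : dwv p r t x = wv p r t x - wv p r 0 x.
Proof. by rewrite /dwv /wv !add0r; lra. Qed.

Lemma dwv0 p r t : dwv p r t 0 = p t - p 0 + (r t - r 0).
Proof. by rewrite /dwv subr0 oppr0 addr0. Qed.

Lemma pathL2_wv p f r g : primR p f -> primR r g -> pathL2 (wv f g : R -> fct) (dwv p r).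
Proof.
move=> pf rg.
apply: (eq_pathL2 (pathL2_lin 1 (pathL2_bwd pf) (pathL2_fwd rg))) => t x;
  by rewrite fct_linE mul1r.
Qed.

Lemma pathH1_wv P p f Q r g : primR P p -> primR p f -> primR Q r -> primR r g ->
  pathH1 (wv p r : R -> fct) (dwv P Q).
Proof.
move=> Pp pf Qr rg.
apply: (eq_pathH1 (pathH1_lin 1 (pathH1_bwd pf Pp) (pathH1_fwd rg Qr))) => t x;
  by rewrite fct_linE mul1r.
Qed.

Lemma primR_bwd P p t : primR P p ->
  prim 0 1 (fun x => P (t - x) - P (- x)) (fun x => - (p (t - x) - p (- x))).
Proof.
move=> Pp.
have H1 := @prim_opp _ 0 1 _ _ (primR_shift t Pp (- 1) (- 0)).
have H2 := @prim_opp _ 0 1 _ _ (Pp (- 1) (- 0)).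
by apply: eq_prim (primB H1 H2) => // x _; rewrite opprB opprK addrC.
Qed.

Lemma dwv_prim P p Q r t : primR P p -> primR Q r ->
  prim 0 1 (dwv P Q t) (dwv (fun x => - p x) r t).
Proof.
move=> Pp Qr; have := primD (primR_bwd t Pp) (primB (primR_shift t Qr 0 1) (Qr 0 1)).
by apply: eq_prim => // x _; rewrite /dwv; lra.
Qed.

Lemma primRN P p : primR P p -> primR (fun x => - P x) (fun x => - p x).
Proof. by move=> H a b; exact: primN. Qed.

Lemma dwv_prim2 p f r g t : primR p f -> primR r g ->
  prim 0 1 (dwv (fun x => - p x) r t) (dwv f g t).
Proof.
move=> pf rg; apply: eq_prim (dwv_prim t (primRN pf) rg) => // x _.
by rewrite /dwv !opprK.
Qed.

Lemma prim_eq0 F f G g t : primR F f -> primR G g -> 0 <= t ->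
  (forall x, 0 < x -> f x = g x) -> F t - F 0 = G t - G 0.
Proof.
move=> Ff Gg t0 fg.
have P1 := primB (Ff 0 t) (prim_cst 0 t (F 0)).
have P2 := primB (Gg 0 t) (prim_cst 0 t (G 0)).
apply: (prim_eq P1 P2); first by rewrite !subrr.
  by move=> x /andP[x0 _]; rewrite fg.
by rewrite t0 lexx.
Qed.

Section boundary_conditions.
Variables (P p f Q r g : R -> R).
Hypotheses (Pp : primR P p) (pf : primR p f) (Qr : primR Q r) (rg : primR r g).

(** The flux of the wave at 0 is only an L^2 function of time, but a mild solution needs the
    boundary condition for its time integral; integrating the law of the profiles over [[0, t]]
    gives it. *)
Lemma left_bc a b h H t : primR H h ->
  (forall t, 0 < t -> g t - f t = a * (p t + r t) + b * (f t + g t) + h t) -> 0 <= t ->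
  dwv (fun x => - p x) r t 0 = a * dwv P Q t 0 + b * dwv p r t 0 + (H t - H 0).
Proof.
move=> Hh E t0.
have P1 := primRB rg pf.
have P2 := primRD (primRD (primRZ a (primRD Pp Qr)) (primRZ b (primRD pf rg))) Hh.
have := prim_eq0 P1 P2 t0 E.
by rewrite !dwv0; lra.
Qed.

Lemma right_int rho c t :
  (forall t, 0 < t -> g (t + 1) = rho * f (t - 1) - c * (p (t - 1) + r (t + 1))) -> 0 <= t ->
  r (t + 1) - r 1 = rho * (p (t - 1) - p (-1)) - c * dwv P Q t 1.
Proof.
move=> E t0.
have P1 := primR_shift 1 rg.
have P2 := primRB (primRZ rho (primR_shift (-1) pf))
  (primRZ c (primRD (primR_shift (-1) Pp) (primR_shift 1 Qr))).
have := prim_eq0 P1 P2 t0; rewrite !addr0 /dwv !(addrC t) => -> //; first by lra.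
by move=> x x0; rewrite (addrC 1) (addrC (-1)) E.
Qed.

Lemma right_bc c t :
  (forall t, 0 < t -> g (t + 1) = 1 * f (t - 1) - c * (p (t - 1) + r (t + 1))) -> 0 <= t ->
  dwv (fun x => - p x) r t 1 = - c * dwv P Q t 1.
Proof. by move=> E t0; have := right_int E t0; rewrite [dwv (fun x => - p x) r t 1]/dwv; lra. Qed.

(** With [rho = -1] and [c = 0] the law makes the trace at 1 constant in time, and it starts at
    0. *)
Lemma right_dirichlet t :
  (forall t, 0 < t -> g (t + 1) = -1 * f (t - 1) - 0 * (p (t - 1) + r (t + 1))) ->
  p (- 1) + r 1 = 0 -> 0 <= t -> wv p r t 1 = 0 /\ dwv P Q t 1 = 0.
Proof.
move=> E pr t0.
have D u : 0 <= u -> p (u - 1) + r (u + 1) = 0.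
  by move=> u0; have := right_int E u0; rewrite mul0r; lra.
split; first by rewrite /wv D.
have P1 := primRD (primR_shift (-1) Pp) (primR_shift 1 Qr).
have P0 : primR (fun _ : R => 0) (fun _ => 0) by move=> u v; exact: prim_cst.
have := prim_eq0 P1 P0 t0; rewrite !addr0 subrr /dwv !(addrC t) => H.
rewrite -[RHS]H; first by lra.
by move=> x x0; rewrite (addrC 1) (addrC (-1)) D// ltW.
Qed.

End boundary_conditions.

End dalembert.

(** * Existence *)

Section existence.
Context {R : realType}.
Notation state := (state R).
Notation fct := (fct R).

Lemma eqX_refl (W : state) : eqX W W.
Proof.
case: W => [[[[[[[e e'] Y] z] z'] w] w'] Z].
by split; (try split) => //; exact: aeW.
Qed.

(** The condition of z is subtracted from that of v: [D] and [e] are the traces of eps and its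
    velocity, and [c0 * e] stands for [Y_x(0)]. *)
Lemma left_eps_scalar (a b q c0 c1 A A' B B' d d' D e : R) :
  A = a * B + b * d -> A' = a * B' + b * d' -> B - B' = (1 - c0) * D ->
  d - d' = (1 - c0) * e -> a * (1 - c0) = c1 -> b * (1 - c0) = c0 - q ->
  A - A' - c0 * e = - q * e + c1 * D.
Proof.
move=> -> -> hB hd ha hb.
have -> : a * B + b * d - (a * B' + b * d') = a * (B - B') + b * (d - d') by ring.
by rewrite hB hd !mulrA ha hb; ring.
Qed.

Lemma mild_exists (q c0 c1 c2 c3 : R)
    (h1 : 0 < c1 / (1 - c0)) (h2 : 0 < (c0 - q) / (1 - c0))
    (h3 : 0 < (c2 - q) / (1 - c2))
    (eps0 eps1 Y0 z0 z1 w0 w1 Z0 : fct)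
    (hX : inX (eps0, eps1, Y0, z0, z1, w0, w1, Z0))
    (hY0 : Y0 0 = - c0 * eps0 0)
    (hZ0 : Z0 0 = - (c2 / (1 - c2)) * w0 0) :
  exists U : R -> state, mild_solution q c0 c1 c2 c3 (eps0, eps1, Y0, z0, z1, w0, w1, Z0) U.
Proof.
have [[[ex He] le1] [Yx HY] [[[zx Hz] z01] lz1] [[wx Hw] lw1] [Zx HZ]] := hX.
have c0n : 1 - c0 != 0.
  by apply/eqP => E; move: h1; rewrite E invr0 mulr0 ltxx.
set a := c1 / (1 - c0) in h1; set b := (c0 - q) / (1 - c0) in h2.
set b2 := (c2 - q) / (1 - c2) in h3.
have ac : a * (1 - c0) = c1 by rewrite /a divfK.
have bc : b * (1 - c0) = c0 - q by rewrite /b divfK.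
have b1n : 1 + b != 0 by rewrite gt_eqF// addr_gt0.
have b2n : 1 + b2 != 0 by rewrite gt_eqF// addr_gt0.
have l0 : loc2 (fun _ : R => 0 : R) by move=> u v; exact: L2on_cst.
have P0 : primR (fun _ : R => 0 : R) (fun _ => 0) by move=> u v; exact: prim_cst.
have Hv := primD (primD He HY) Hz.
have lv1 := L2onB (L2onD le1 lz1) (prim_L2 HY).
(* For v, [rho = 1] and [c = 0] give the free end; for z, [rho = -1] and [c = 0] give the clamped
   one. *)
have [pv [rv [fv [gv [[pfv rgv] v0E v1E vL vR]]]]] := wave_pair a 1 0 b1n Hv lv1 l0.
have [pz [rz [fz [gz [[pfz rgz] z0E z1E zL zR]]]]] := wave_pair a (-1) 0 b1n Hz lz1 l0.
have i0 := @itv01_0 R; have i1 := @itv01_1 R.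
pose s (t : R) := (1 - c0)^-1 * (pv t + rv t - (pz t + rz t)).
have Hs : primR s (fun t => (1 - c0)^-1 * (fv t + gv t - (fz t + gz t))).
  exact: (primRZ _ (primRB (primRD pfv rgv) (primRD pfz rgz))).
have s0 : s 0 = eps0 0.
  have := v0E 0 i0; have := z0E 0 i0; rewrite !oppr0 /s => -> ->.
  by rewrite hY0; move: (eps0 0 : R) (z0 0 : R) => u v; field.
have Y00 : Y0 0 = - c0 * s 0 by rewrite s0.
have [y [yd [Hy y0E y1E yS]]] := transport HY Hs Y00.
(* Since [eps = v - z - Y] and Y is a function of [t - x], it is absorbed in the profile travelling
   to the right. *)
pose pe (t : R) := pv t - pz t - y t; pose re (t : R) := rv t - rz t.
pose fe (t : R) := fv t - fz t - yd t; pose ge (t : R) := gv t - gz t.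
have pfe : primR pe fe by exact: (primRB (primRB pfv pfz) Hy).
have rge : primR re ge by exact: (primRB rgv rgz).
have lh : loc2 (fun t => c1 * (pe t + re t)).
  by apply: loc2Z; apply: loc2D; [exact: primR_loc2F pfe|exact: primR_loc2F rge].
have [pw [rw [fw [gw [[pfw rgw] w0E w1E wL wR]]]]] := wave_pair 0 1 c3 b2n Hw lw1 lh.
have Hsw := primRD pfw rgw.
have Z00 : Z0 0 = - (c2 / (1 - c2)) * (pw 0 + rw 0).
  by rewrite hZ0; have := w0E 0 i0; rewrite oppr0 => ->.
have [zz [zzd [Hzz zz0E _ zzS]]] := transport HZ Hsw Z00.
(* One more primitive of each profile: the time integral of the state is made of waves with these
   profiles. *)
have [Pv HPv _] := primR_of 0 0 (primR_loc2F pfv).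
have [Rv HRv _] := primR_of 0 0 (primR_loc2F rgv).
have [Pz HPz _] := primR_of 0 0 (primR_loc2F pfz).
have [Rz HRz _] := primR_of 0 0 (primR_loc2F rgz).
have [Pw HPw _] := primR_of 0 0 (primR_loc2F pfw).
have [Rw HRw _] := primR_of 0 0 (primR_loc2F rgw).
have [YY HYY _] := primR_of 0 0 (primR_loc2F Hy).
have [ZZ HZZ _] := primR_of 0 0 (primR_loc2F Hzz).
pose Pe (t : R) := Pv t - Pz t - YY t; pose Re (t : R) := Rv t - Rz t.
have HPe : primR Pe pe by exact: (primRB (primRB HPv HPz) HYY).
have HRe : primR Re re by exact: (primRB HRv HRz).
pose S (t : R) := (1 - c0)^-1 * (Pv t + Rv t - (Pz t + Rz t)).
have HS : primR S s by exact: (primRZ _ (primRB (primRD HPv HRv) (primRD HPz HRz))).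
have Dir t : 0 <= t -> wv pz rz t 1 = 0 /\ dwv Pz Rz t 1 = 0.
  by apply: (right_dirichlet HPz pfz HRz rgz zR); rewrite z0E.
pose U := stpath (wv pe re : R -> fct) (wv fe ge) (fun t x => y (t - x))
  (wv pz rz) (wv fz gz) (wv pw rw) (wv fw gw) (fun t x => zz (t - x)).
pose V := stint (dwv Pe Re : R -> fct) (dwv pe re) (fun t x => YY (t - x) - YY (- x))
  (dwv Pz Rz) (dwv pz rz) (dwv Pw Rw) (dwv pw rw) (fun t x => ZZ (t - x) - ZZ (- x)).
have q1 := pathH1_wv HPe pfe HRe rge; have q2 := pathL2_wv pfe rge.
have q3 := pathH1_bwd Hy HYY.
have q4 := pathH1_wv HPz pfz HRz rgz; have q5 := pathL2_wv pfz rgz.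
have q6 := pathH1_wv HPw pfw HRw rgw; have q7 := pathL2_wv pfw rgw.
have q8 := pathH1_bwd Hzz HZZ.
have D1 t : 0 <= t -> wv pz rz t 1 = 0 by move=> /Dir[].
have D2 t : 0 <= t -> dwv Pz Rz t 1 = 0 by move=> /Dir[].
exists U; split.
- exact: (stpath_continuous q1 q2 q3 q4 q5 q6 q7 q8 D1 D2).
- split; first split.
  + move=> x x01; rewrite /wv !add0r /pe /re (y0E _ x01).
    by have := v0E _ x01; have := z0E _ x01; lra.
  + apply: aeW => x x01; rewrite /wv !add0r /fe /ge (y1E _ x01).
    by have := v1E _ x01; have := z1E _ x01; lra.
  + by move=> x x01; rewrite sub0r y0E.
  + split; first by move=> x x01; rewrite /wv !add0r z0E.
    by apply: aeW => x x01; rewrite /wv !add0r z1E.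
  + split; first by move=> x x01; rewrite /wv !add0r w0E.
    by apply: aeW => x x01; rewrite /wv !add0r w1E.
  + by move=> x x01; rewrite sub0r zz0E.
move=> t t0; exists (V t); split.
  exact: (stpath_integral q1 q2 q3 q4 q5 q6 q7 q8 D1 D2 t0).
have [XU XV] := stpath_inX q1 q2 q3 q4 q5 q6 q7 q8 D1 D2 t0.
have [XU0 _] := stpath_inX q1 q2 q3 q4 q5 q6 q7 q8 D1 D2 (lexx 0).
exists (dwv (fun x => - pe x) re t), (dwv fe ge t), (fun x => - (y (t - x) - y (- x))),
  (dwv (fun x => - pz x) rz t), (dwv fz gz t), (dwv (fun x => - pw x) rw t), (dwv fw gw t),
  (fun x => - (zz (t - x) - zz (- x))).
have EW : U t - U 0 = (dwv pe re t, dwv fe ge t, - (fun x => - (y (t - x) - y (- x)) : R^o),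
  dwv pz rz t, dwv fz gz t, dwv pw rw t, dwv fw gw t,
  - (fun x => - (zz (t - x) - zz (- x)) : R^o)) :> state.
  rewrite /U /stpath state_lsub lsub_tuple.
  have E p r : wv p r t - wv p r 0 = dwv p r t :> fct.
    by apply/funext => x; rewrite dwvE.
  have E2 (p : R -> R) : (fun x => p (t - x)) - (fun x => p (0 - x)) =
      - (fun x => - (p (t - x) - p (- x)) : R^o) :> fct.
    have hx x : p (t - x) - p (0 - x) = - - (p (t - x) - p (- x)) by rewrite sub0r opprK.
    by apply/funext => x; exact: hx.
  by rewrite !E !E2.
have pes x : 0 <= x -> pe x + re x = s x.
  by move=> x0; rewrite /pe /re yS// /s; field.
have SE : dwv Pe Re t 0 = S t - S 0.
  have := prim_eq0 (primRD HPe HRe) HS t0 (fun x x0 => pes x (ltW x0)).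
  by rewrite dwv0; lra.
have sE : dwv pe re t 0 = s t - s 0.
  by rewrite dwv0; have := pes t t0; have := pes 0 (lexx 0); lra.
have YE : YY t - YY 0 = - c0 * dwv Pe Re t 0.
  rewrite SE mulrBr.
  exact: (prim_eq0 HYY (primRZ (- c0) HS) t0 (fun x x0 => yS x (ltW x0))).
have ZE : ZZ t - ZZ 0 = - (c2 / (1 - c2)) * dwv Pw Rw t 0.
  rewrite dwv0.
  have := prim_eq0 HZZ (primRZ (- (c2 / (1 - c2))) (primRD HPw HRw)) t0 (fun x x0 => zzS x (ltW x0)).
  by move=> ->; ring.
split.
- split; [exact: (dwv_prim t HPe HRe)|exact: (dwv_prim t HPz HRz)|
    exact: (dwv_prim t HPw HRw)|exact: (primR_bwd t HYY)|exact: (primR_bwd t HZZ)].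
- split; [exact: (dwv_prim2 t pfe rge)|exact: (dwv_prim2 t pfz rgz)|exact: (dwv_prim2 t pfw rgw)].
- split.
  + split; last exact: D2.
    have := left_bc HPz pfz HRz rgz P0 zL t0; rewrite subrr addr0; exact.
  + split.
      have Lv := left_bc HPv pfv HRv rgv P0 vL t0.
      have Lz := left_bc HPz pfz HRz rgz P0 zL t0.
      have X1 : dwv Pv Rv t 0 - dwv Pz Rz t 0 = (1 - c0) * dwv Pe Re t 0.
        by rewrite SE /S !dwv0; field.
      have X2 : dwv pv rv t 0 - dwv pz rz t 0 = (1 - c0) * dwv pe re t 0.
        by rewrite sE /s !dwv0; field.
      rewrite subrr addr0 in Lv; rewrite subrr addr0 in Lz.
      rewrite -(left_eps_scalar Lv Lz X1 X2 ac bc) sE !dwv0 /pe /re (yS t t0) (yS 0 (lexx 0)).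
      by lra.
    have := right_bc HPv pfv HRv rgv vR t0.
    by rewrite /dwv /pe /re; lra.
  + by rewrite subr0 oppr0.
  + split.
      have := left_bc HPw pfw HRw rgw (primRZ c1 (primRD HPe HRe)) wL t0.
      by rewrite mul0r add0r => ->; rewrite -/b2 [dwv Pe Re t 0]dwv0; congr (_ + _); ring.
    exact: (right_bc HPw pfw HRw rgw wR t0).
  + by rewrite subr0 oppr0.
- split; first exact: XV.
  by rewrite -EW state_lsub; exact: (subB (@inX_linsub R) XU XU0).
- by rewrite EW; exact: eqX_refl.
Qed.

End existence.

Unset Implicit Arguments.

Theorem theorem5p1 (R : realType) (q c0 c1 c2 c3 : R)
    (q_gt0 : 0 < q) (q_neq1 : q <> 1)
    (h1 : 0 < c1 / (1 - c0)) (h2 : 0 < (c0 - q) / (1 - c0))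
    (h3 : 0 < (c2 - q) / (1 - c2)) (h4 : 0 < c3)
    (eps0 eps1 Y0 z0 z1 w0 w1 Z0 : fct R)
    (hX : inX (eps0, eps1, Y0, z0, z1, w0, w1, Z0))
    (hY0 : Y0 0 = - c0 * eps0 0)
    (hZ0 : Z0 0 = - (c2 / (1 - c2)) * w0 0) :
  exists U : R -> state R,
    [/\ mild_solution q c0 c1 c2 c3
          (eps0, eps1, Y0, z0, z1, w0, w1, Z0) U,
        (forall U' : R -> state R,
            mild_solution q c0 c1 c2 c3
              (eps0, eps1, Y0, z0, z1, w0, w1, Z0) U' ->
            forall t : R, 0 <= t -> eqX (U' t) (U t)) &
        exists M mu : R, [/\ 0 < M, 0 < mu &
          forall t : R, 0 <= t -> normX (U t) <= M * expR (- mu * t)]].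
Proof.
have [U mU] := mild_exists c3 h1 h2 h3 hX hY0 hZ0.
have [M [m [M0 m0 HM]]] := mild_decay h1 h2 h3 h4.
exists U; split=> //.
  by move=> U' mU' t t0; exact: mild_unique hX mU' mU t t0.
(* The added 1 keeps the constant positive when the initial state has norm 0. *)
exists (M * (nrm (@bX R) (U 0) + 1)), m; split=> //.
  by rewrite mulr_gt0// ltr_wpDl// nrm_ge0.
move=> t t0; rewrite normXE (le_trans (HM U (mild_mildlike mU) t t0))//.
rewrite mulrAC ler_wpM2r ?expR_ge0// ler_wpM2l ?(ltW M0)//.
by rewrite lerDl.
Qed.
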